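(* Let $\phi$ be a non-degenerate Orlicz function satisfying the following conditions: (i) $\lim_{t \to 0} \phi(t)/t^2 = 0$; (ii) $\phi$ satisfies the $\Delta_2$-condition at zero; (iii) $\phi$ is submultiplicative at zero. Then there is a compact set $K \subset \mathbb{T}$ which supports a non-zero Schwartz distribution $S$ such that $\widehat{S} \in \ell_\phi$, but which does not support any non-zero finite complex Borel measure $\mu$ such that $\widehat{\mu} \in \ell_\phi$.
   Context: $\mathbb{T} = \mathbb{R}/2\pi\mathbb{Z}$ is the circle; $\widehat{S}=(\widehat{S}(n))_{n\in\mathbb{Z}}$ denotes the Fourier coefficients of a distribution or measure $S$ on $\mathbb{T}$; a compact set $K$ supports a distribution or measure if the support of the latter is contained in $K$. An Orlicz function $\phi$ is a continuous, non-decreasing and convex function on $[0,\infty)$ with $\phi(0)=0$ and $\lim_{t\to\infty}\phi(t)=\infty$. It is degenerate if $\phi(t_0)=0$ for some $t_0>0$, and non-degenerate otherwise. The Orlicz space $\ell_\phi$ consists of all scalar sequences $x=\{x_n\}_{n\in\mathbb{Z}}$ such that $\sum_{n\in\mathbb{Z}}\phi(|x_n|/\rho)<\infty$ for some $\rho>0$. The function $\phi$ satisfies the $\Delta_2$-condition at zero if $\limsup_{t\to 0}\phi(2t)/\phi(t)<\infty$. It is submultiplicative at zero if there exist constants $M$ and $t_0>0$ such that $\phi(st)\leq M\phi(s)\phi(t)$ for all $0<s,t<t_0$. *)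

(* Defs.v *)
From HB Require Import structures.
From mathcomp Require Import all_boot all_order all_algebra.
From mathcomp Require Import generic_quotient complex.
From mathcomp Require Import all_classical all_reals all_analysis.

Set Implicit Arguments.
Unset Strict Implicit.
Unset Printing Implicit Defensive.

Import Order.TTheory GRing.Theory Num.Theory.
Import numFieldNormedType.Exports.
Import ComplexField.Normc.

Local Open Scope classical_set_scope.
Local Open Scope complex_scope.
Local Open Scope ring_scope.
Local Open Scope quotient_scope.

Section Circle.
Variable R : realType.

Definition circle_rel (x y : R) : bool :=
  `[< exists k : int, y = x + (trigo.pi *+ 2) *~ k >].

Fact circle_rel_refl : reflexive circle_rel.
Proof. by move=> x; apply/asboolP; exists 0; rewrite mulr0z addr0. Qed.

Fact circle_rel_sym : symmetric circle_rel.
Proof.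
move=> x y; apply/asboolP/asboolP => -[k ->]; exists (- k);
  by rewrite mulrNz addrK.
Qed.

Fact circle_rel_trans : transitive circle_rel.
Proof.
move=> y x z /asboolP[k ->] /asboolP[l ->]; apply/asboolP; exists (k + l).
by rewrite mulrzDr addrA.
Qed.

Definition circle_equiv : equiv_rel R :=
  EquivRel circle_rel circle_rel_refl circle_rel_sym circle_rel_trans.

Definition circle : Type := quotient_topology {eq_quot circle_equiv}.

HB.instance Definition _ := Topological.on circle.
HB.instance Definition _ := Pointed.on circle.
HB.instance Definition _ := Quotient.on circle.

Definition tproj (x : R) : circle := \pi_circle x.

(* The character t |-> exp(i n t); it does not depend on the representative
   of t, see expiE. *)
Definition expi (n : int) (t : circle) : R[i] :=
  cos (repr t *~ n) +i* sin (repr t *~ n).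

Lemma expiE (n : int) (x : R) :
  expi n (tproj x) = cos (x *~ n) +i* sin (x *~ n).
Proof.
have per f (y : R) (m : int) : periodic f (trigo.pi *+ 2) ->
    f (y + (trigo.pi *+ 2) *~ m) = f y :> R.
  move=> pf; case: m => m; first by rewrite -pmulrn periodicn.
  by rewrite NegzE mulrNz -pmulrn -(periodicn pf m.+1) subrK.
have /asboolP[k xk] : circle_rel x (repr (tproj x)).
  rewrite -[circle_rel x _]/(circle_equiv x (repr (tproj x))).
  by apply/eqmodP; rewrite [RHS]reprK.
rewrite /expi {}xk mulrzDl -mulrzA !per//; [exact: sinD2pi|exact: cosD2pi].
Qed.

Definition lift_re (f : circle -> R[i]) (x : R) : R := complex.Re (f (tproj x)).
Definition lift_im (f : circle -> R[i]) (x : R) : R := complex.Im (f (tproj x)).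

Definition smooth (f : circle -> R[i]) : Prop :=
  forall (k : nat) (x : R),
    derivable (lift_re f)^`(k)%classic x 1 /\
    derivable (lift_im f)^`(k)%classic x 1.

Definition dern (k : nat) (f : circle -> R[i]) (x : R) : R[i] :=
  (lift_re f)^`(k)%classic x +i* (lift_im f)^`(k)%classic x.

Definition Cnorm (N : nat) (f : circle -> R[i]) : R :=
  \sum_(k < N.+1) sup (range (fun x => normc (dern k f x))).

(* A distribution is a continuous linear functional on the Frechet space of
   smooth functions.  It is represented by a total function whose values
   outside the smooth functions are irrelevant. *)
Record schwartz_distribution : Type := SchwartzDistribution {
  dist_val :> (circle -> R[i]) -> R[i] ;
  dist_linear : forall (a : R[i]) (f g : circle -> R[i]),
    smooth f -> smooth g ->
    dist_val (fun t => a * f t + g t) = a * dist_val f + dist_val g ;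
  dist_continuous : exists (C : R) (N : nat), forall f : circle -> R[i],
    smooth f -> normc (dist_val f) <= C * Cnorm N f }.

Definition dist_nonzero (S : schwartz_distribution) : Prop :=
  exists2 f : circle -> R[i], smooth f & S f != 0.

Definition dist_vanishes_on (S : schwartz_distribution) (U : set circle)
    : Prop :=
  forall f : circle -> R[i], smooth f ->
    closure [set t | f t != 0] `<=` U -> S f = 0.

Definition dist_support (S : schwartz_distribution) : set circle :=
  ~` \bigcup_(U in [set U | open U /\ dist_vanishes_on S U]) U.

(* Fourier coefficients are normalized as <S, exp(-int)>, without 1/(2 pi),
   both for distributions and for measures. *)
Definition dist_fourier (S : schwartz_distribution) (n : int) : R[i] :=
  S (expi (- n)).

Definition borel_circle := g_sigma_algebraType (@open circle).

Definition jordan_plus (nu : {charge set borel_circle -> \bar R}) :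
    {measure set borel_circle -> \bar R} :=
  jordan_pos (projT2 (cid (projT2 (cid (Hahn_decomposition nu))))).
Definition jordan_minus (nu : {charge set borel_circle -> \bar R}) :
    {measure set borel_circle -> \bar R} :=
  jordan_neg (projT2 (cid (projT2 (cid (Hahn_decomposition nu))))).

Definition charge_integral (nu : {charge set borel_circle -> \bar R})
    (f : circle -> R) : R :=
  \int[jordan_plus nu]_t f t - \int[jordan_minus nu]_t f t.

(* A finite complex Borel measure, given by its real and imaginary parts, which
   are finite signed measures (charges take only finite values). *)
Record complex_measure : Type := ComplexMeasure {
  cm_re : {charge set borel_circle -> \bar R} ;
  cm_im : {charge set borel_circle -> \bar R} }.

Definition cm_val (mu : complex_measure) (A : set borel_circle) : R[i] :=
  fine (cm_re mu A) +i* fine (cm_im mu A).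

Definition cm_nonzero (mu : complex_measure) : Prop :=
  exists2 A : set borel_circle, measurable A & cm_val mu A != 0.

(* For Borel U, this says that the total variation of mu vanishes on U. *)
Definition cm_vanishes_on (mu : complex_measure) (U : set circle) : Prop :=
  forall A : set borel_circle, measurable A -> A `<=` U -> cm_val mu A = 0.

Definition cm_support (mu : complex_measure) : set circle :=
  ~` \bigcup_(U in [set U | open U /\ cm_vanishes_on mu U]) U.

Definition cm_integral (mu : complex_measure) (f : circle -> R[i]) : R[i] :=
  let u t := complex.Re (f t) in
  let v t := complex.Im (f t) in
  (charge_integral (cm_re mu) u - charge_integral (cm_im mu) v) +i*
  (charge_integral (cm_re mu) v + charge_integral (cm_im mu) u).

Definition cm_fourier (mu : complex_measure) (n : int) : R[i] :=
  cm_integral mu (expi (- n)).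

End Circle.

Section Orlicz.
Variable R : realType.

(* Orlicz functions live on [0, +oo[; the values of phi at negative arguments
   are never used. *)
Record orlicz_function (phi : R -> R) : Prop := OrliczFunction {
  orlicz_continuous : {within `[0, +oo[, continuous phi} ;
  orlicz_nondecreasing : {in `[0, +oo[ &, nondecreasing phi} ;
  orlicz_convex : convex_function (E := R^o) `[0, +oo[ phi ;
  orlicz0 : phi 0 = 0 ;
  orlicz_cvg : phi t @[t --> +oo] --> +oo }.

Definition degenerate (phi : R -> R) : Prop :=
  exists2 t0 : R, 0 < t0 & phi t0 = 0.

Definition orlicz_space (phi : R -> R) : set (int -> R[i]) :=
  [set x | exists2 rho : R, 0 < rho &
    (\esum_(n in [set: int]) (phi (normc (x n) / rho))%:E < +oo)%E].

Definition delta2_at_zero (phi : R -> R) : Prop :=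
  (limf_esup (fun t : R => (phi (2 * t) / phi t)%:E) 0^'+ < +oo)%E.

Definition submultiplicative_at_zero (phi : R -> R) : Prop :=
  exists (M t0 : R), 0 < t0 /\
    forall s t : R, 0 < s < t0 -> 0 < t < t0 ->
      phi (s * t) <= M * phi s * phi t.

End Orlicz.

(* Main.v *)
(* With P_j(x) the average over k < N_j of cos(L_j 9^k x), the compact set is
   K = {P_j >= dl for all j}, where L_j tends to infinity.

   No measure: if the Fourier coefficients of a real measure nu on K vanish at
   infinity, then so do those of its restriction to any Borel set A (the sets A
   with this property form a lambda-system, and the open sets belong to it by
   Fejer approximation).  For A the positive set of a Hahn decomposition,
   dl nu^+(K) is at most the integral of P_j over A, which tends to 0; hence
   nu^+ = 0, and likewise nu^- = 0.  Coefficients in l_phi vanish at infinity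
   because phi is non-degenerate.

   A distribution: S is the limit of continuous functions f_j with
   f_(j+1) = f_j w theta(P_j), where theta is a cutoff that vanishes on
   {P_j <= dl} and w is a signed average of Riesz products
   prod_(k < N) (1 + s cos(L_j 9^k x)) over several parameters s near a small
   tau.  The signs are chosen such that the coefficients of w carried by at most
   m0 of the frequencies L_j 9^k cancel.  The other ones are so small that
   phi(st) <= A phi(s) phi(t) makes their phi-modular small, and each of these
   Riesz products concentrates on {P_j ~ s/2}, so that the cutoff is a small
   perturbation in L^2.  As phi(t) = o(t^2), perturbations that are small in L^2
   have small phi-modular. *)

From HB Require Import structures.
Require Import Defs.
From mathcomp Require Import all_boot all_order all_algebra complex finmap.
From mathcomp Require Import all_classical all_reals all_analysis.
From mathcomp Require Import ring lra zify.

Set Implicit Arguments.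
Unset Strict Implicit.
Unset Printing Implicit Defensive.

Import Order.TTheory GRing.Theory Num.Theory.
Import numFieldNormedType.Exports.
Import ComplexField.Normc.

Local Open Scope classical_set_scope.
Local Open Scope ring_scope.

(** * Continuous periodic functions and Fourier coefficients *)

Section CircleFunctions.
Variable R : realType.
Local Notation C := R[i].
Local Notation tau := (@trigo.pi R *+ 2).

(** The obstacle is that [dl] must be the same at all stages. A single Riesz product with parameter
    s and N frequencies concentrates where P_j is about s/2 only if N s^2 is large, while the
    simplest of its frequencies alone add about 2N phi(s/2) to the modular. Letting s tend to 0
    would make this cost small, but then P_j would tend to 0 with s and no positive [dl] would
    survive. Cancelling all coefficients carried by at most m0 frequencies removes the cost at a
    fixed s. The signed average has total mass up to 8^m0, so everything else must gain a geometric
    factor in m0. Hence N = r m0 with r of order 1 / tau^2: the part of the Riesz products with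
    small P_j gains 128^(-m0) in mean square against a loss of 64^m0, whereas r phi(4 tau) stays
    small because phi(t) = o(t^2). So this hypothesis already fixes tau, before it serves for the
    perturbations, and m0 remains free to make each step as small as needed. *)

Lemma conjcM (x y : C) : conjc (x * y) = conjc x * conjc y. Proof. exact: rmorphM. Qed.

Definition cperiodic : {pred R -> C} := fun f =>
  `[< [/\ continuous (fun x => complex.Re (f x)),
          continuous (fun x => complex.Im (f x)) &
          forall x, f (x + tau) = f x] >].

Lemma cperiodic_subring : subring_closed cperiodic.
Proof.
split.
- by apply/asboolP; split => // x; exact: cvg_cst.
- move=> f g /asboolP[f1 f2 f3] /asboolP[g1 g2 g3]; apply/asboolP; split.
  + rewrite (_ : (fun x => _) = (fun x => complex.Re (f x) - complex.Re (g x))).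
      by move=> x; apply: cvgB; [exact: f1|exact: g1].
    by apply/funext => x; rewrite /= -raddfB.
  + rewrite (_ : (fun x => _) = (fun x => complex.Im (f x) - complex.Im (g x))).
      by move=> x; apply: cvgB; [exact: f2|exact: g2].
    by apply/funext => x; rewrite /= -raddfB.
  + by move=> x; rewrite -[LHS]/(f (x + tau) - g (x + tau)) f3 g3.
- move=> f g /asboolP[f1 f2 f3] /asboolP[g1 g2 g3]; apply/asboolP; split.
  + rewrite (_ : (fun x => _) = (fun x => complex.Re (f x) * complex.Re (g x)
       - complex.Im (f x) * complex.Im (g x))).
      by move=> x; apply: cvgB; apply: cvgM;
        [exact: f1|exact: g1|exact: f2|exact: g2].
    by apply/funext => x; rewrite -[(f * g) x]/(f x * g x); case: (f x) (g x) => ? ? [].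
  + rewrite (_ : (fun x => _) = (fun x => complex.Re (f x) * complex.Im (g x)
       + complex.Im (f x) * complex.Re (g x))).
      by move=> x; apply: cvgD; apply: cvgM;
        [exact: f1|exact: g2|exact: f2|exact: g1].
    by apply/funext => x; rewrite -[(f * g) x]/(f x * g x); case: (f x) (g x) => ? ? [].
  + by move=> x; rewrite -[LHS]/(f (x + tau) * g (x + tau)) f3 g3.
Qed.

HB.instance Definition _ :=
  GRing.isSubringClosed.Build (R -> C) cperiodic cperiodic_subring.

(** Bundling makes these functions a commutative ring: products over frequencies are bigops, and
    [ring] rearranges them without evaluation at points. *)
Record cpf := CPF { cpf_val :> R -> C; cpf_valP : cpf_val \in cperiodic }.
HB.instance Definition _ := [isSub for cpf_val].
HB.instance Definition _ := [Choice of cpf by <:].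
HB.instance Definition _ := [SubChoice_isSubComNzRing of cpf by <:].

Lemma cpfP (f g : cpf) : (forall x, f x = g x) -> f = g.
Proof. by move=> fg; apply/val_inj/funext. Qed.

Lemma cpfD (f g : cpf) x : (f + g) x = f x + g x. Proof. by []. Qed.
Lemma cpfB (f g : cpf) x : (f - g) x = f x - g x. Proof. by []. Qed.
Lemma cpfM (f g : cpf) x : (f * g) x = f x * g x. Proof. by []. Qed.
Lemma cpf0 x : (0 : cpf) x = 0. Proof. by []. Qed.
Lemma cpf1 x : (1 : cpf) x = 1. Proof. by []. Qed.
Lemma cpf_sum I (s : seq I) P (F : I -> cpf) x :
  (\sum_(i <- s | P i) F i) x = \sum_(i <- s | P i) F i x.
Proof. by elim/big_rec2: _ => // i a b Pi <-. Qed.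
Lemma cpf_prod I (s : seq I) P (F : I -> cpf) x :
  (\prod_(i <- s | P i) F i) x = \prod_(i <- s | P i) F i x.
Proof. by elim/big_rec2: _ => // i a b Pi <-. Qed.

Lemma cpf_contRe (f : cpf) : continuous (fun x => complex.Re (f x)).
Proof. by have /asboolP[] := cpf_valP f. Qed.
Lemma cpf_contIm (f : cpf) : continuous (fun x => complex.Im (f x)).
Proof. by have /asboolP[] := cpf_valP f. Qed.
Lemma cpf_per (f : cpf) x : f (x + tau) = f x.
Proof. by have /asboolP[] := cpf_valP f. Qed.
Lemma cpf_perz (f : cpf) x (k : int) : f (x + tau *~ k) = f x.
Proof.
have pn n y : f (y + tau *~ n%:Z) = f y.
  rewrite -pmulrn; elim: n => [|n IH]; first by rewrite mulr0n addr0.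
  by rewrite mulrSr addrA cpf_per.
by case: k => n; [exact: pn|rewrite NegzE mulrNz -[LHS](pn n.+1) subrK].
Qed.

Definition mk_cpf (f : R -> C) (H1 : continuous (fun x => complex.Re (f x)))
    (H2 : continuous (fun x => complex.Im (f x)))
    (H3 : forall x, f (x + tau) = f x) : cpf :=
  @CPF f (asboolT (And3 H1 H2 H3)).

(* Values are given by opaque specifications, so that simplification does not
   unfold the bundled functions. *)
Fact cc_spec (a : C) : {f : cpf | forall x, f x = a}.
Proof.
have H : (fun=> a) \in cperiodic by apply/asboolP; split => // x; exact: cvg_cst.
by exists (CPF H).
Qed.
Definition cc (a : C) : cpf := sval (cc_spec a).
Lemma ccE a x : cc a x = a. Proof. exact: (svalP (cc_spec a)). Qed.

Fact cc_zmod_morphism : zmod_morphism cc.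
Proof. by move=> a b; apply: cpfP => x; rewrite cpfB !ccE. Qed.
Fact cc_monoid_morphism : monoid_morphism cc.
Proof. by split => [|a b]; apply: cpfP => x; rewrite ?cpfM !ccE. Qed.
HB.instance Definition _ := GRing.isZmodMorphism.Build C cpf cc cc_zmod_morphism.
HB.instance Definition _ := GRing.isMonoidMorphism.Build C cpf cc cc_monoid_morphism.

Lemma ccM a b : cc (a * b) = cc a * cc b. Proof. exact: rmorphM. Qed.
Lemma ccD a b : cc (a + b) = cc a + cc b. Proof. exact: rmorphD. Qed.
Lemma cc1 : cc 1 = 1. Proof. exact: rmorph1. Qed.
Lemma cc0 : cc 0 = 0. Proof. exact: rmorph0. Qed.

Lemma continuous_mulz n : continuous (fun x : R => x *~ n).
Proof.
rewrite (_ : (fun x => _) = (fun x : R => x * n%:~R)).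
  by move=> x; apply: cvgM; [exact: cvg_id|exact: cvg_cst].
by apply/funext => x; rewrite mulrzr.
Qed.

Fact ce_spec (n : int) :
  {f : cpf | forall x, f x = (cos (x *~ n) +i* sin (x *~ n))%C}.
Proof.
have H1 : continuous (fun x : R => cos (x *~ n)).
  by move=> x; apply: (@continuous_comp _ _ _ (fun x => x *~ n) cos);
    [exact: continuous_mulz|exact: continuous_cos].
have H2 : continuous (fun x : R => sin (x *~ n)).
  by move=> x; apply: (@continuous_comp _ _ _ (fun x => x *~ n) sin);
    [exact: continuous_mulz|exact: continuous_sin].
have H3 x : (cos ((x + tau) *~ n) +i* sin ((x + tau) *~ n) = cos (x *~ n) +i* sin (x *~ n))%C.
  by rewrite -!expiE /tproj; congr (expi n _); apply/eqmodP;
    apply/asboolP; exists (-1); rewrite mulrN1z addrK.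
by exists (@mk_cpf (fun x => (cos (x *~ n) +i* sin (x *~ n))%C) H1 H2 H3).
Qed.
Definition ce n : cpf := sval (ce_spec n).
Lemma ceE n x : ce n x = (cos (x *~ n) +i* sin (x *~ n))%C.
Proof. exact: (svalP (ce_spec n)). Qed.
Lemma ce0 : ce 0 = 1.
Proof. by apply: cpfP => x; rewrite ceE mulr0z cos0 sin0. Qed.
Lemma ceD m n : ce (m + n) = ce m * ce n.
Proof.
apply: cpfP => x; rewrite cpfM !ceE mulrzDr cosD sinD.
by rewrite /GRing.mul /= /GRing.mul /=; congr Complex; rewrite addrC.
Qed.

Fact cj_spec (f : cpf) : {g : cpf | forall x, g x = (f x)^*%C}.
Proof.
have H1 : continuous (fun x => complex.Re (f x)^*%C).
  rewrite (_ : (fun x => _) = (fun x => complex.Re (f x))); first exact: cpf_contRe.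
  by apply/funext => x; case: (f x).
have H2 : continuous (fun x => complex.Im (f x)^*%C).
  rewrite (_ : (fun x => _) = (fun x => - complex.Im (f x))).
    by move=> x; apply: cvgN; exact: cpf_contIm.
  by apply/funext => x; case: (f x).
have H3 x : ((f (x + tau))^* = (f x)^*)%C by rewrite cpf_per.
by exists (@mk_cpf (fun x => (f x)^*%C) H1 H2 H3).
Qed.
Definition cj (f : cpf) : cpf := sval (cj_spec f).
Lemma cjE f x : cj f x = (f x)^*%C. Proof. exact: (svalP (cj_spec f)). Qed.
Fact cj_zmod_morphism : zmod_morphism cj.
Proof. by move=> a b; apply: cpfP => x; rewrite !(cjE, cpfB) rmorphB. Qed.
Fact cj_monoid_morphism : monoid_morphism cj.
Proof.
split=> [|a b]; apply: cpfP => x; first by rewrite !(cjE, cpf1) rmorph1.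
by rewrite !(cjE, cpfM) rmorphM.
Qed.
HB.instance Definition _ := GRing.isZmodMorphism.Build cpf cpf cj cj_zmod_morphism.
HB.instance Definition _ := GRing.isMonoidMorphism.Build cpf cpf cj cj_monoid_morphism.
Lemma cj_ce n : cj (ce n) = ce (- n).
Proof. by apply: cpfP => x; rewrite cjE !ceE mulrNz cosN sinN. Qed.
Lemma cj_cc a : cj (cc a) = cc a^*%C.
Proof. by apply: cpfP => x; rewrite cjE !ccE. Qed.

Local Notation mu := (@lebesgue_measure R).
Definition rmean (g : R -> R) : R := tau^-1 * \int[mu]_(x in `[0, tau]) g x.

Lemma tau_gt0 : 0 < tau. Proof. by rewrite mulrn_wgt0// pi_gt0. Qed.

Lemma rmean_int (g : R -> R) : continuous g ->
  mu.-integrable `[0, tau] (EFin \o g).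
Proof.
move=> cg; apply: continuous_compact_integrable; first exact: segment_compact.
exact: continuous_subspaceT.
Qed.

Lemma rmeanB (f g : R -> R) : continuous f -> continuous g ->
  rmean (fun x => f x - g x) = rmean f - rmean g.
Proof.
move=> cf cg; rewrite /rmean RintegralB//; [|exact: rmean_int|exact: rmean_int].
by rewrite mulrBr.
Qed.
Lemma rmeanD (f g : R -> R) : continuous f -> continuous g ->
  rmean (fun x => f x + g x) = rmean f + rmean g.
Proof.
move=> cf cg; rewrite /rmean RintegralD//; [|exact: rmean_int|exact: rmean_int].
by rewrite mulrDr.
Qed.
Lemma rmeanZ (a : R) (f : R -> R) : continuous f -> rmean (fun x => a * f x) = a * rmean f.
Proof.
move=> cf; rewrite /rmean RintegralZl//; last exact: rmean_int.
by rewrite mulrCA.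
Qed.
Lemma rmean_ge0 (f : R -> R) : (forall x, 0 <= f x) -> 0 <= rmean f.
Proof.
move=> f0; rewrite mulr_ge0//; first by rewrite invr_ge0 ltW// tau_gt0.
exact: Rintegral_ge0.
Qed.

Lemma rmean_FTC (f F : R -> R) : continuous f ->
  (forall x : R, is_derive x 1 F (f x)) -> rmean f = tau^-1 * (F tau - F 0).
Proof.
move=> cf dF; rewrite /rmean /Rintegral (@continuous_FTC2 _ f F)//=.
- exact: tau_gt0.
- exact: continuous_subspaceT.
- have cF (x : R) : F y @[y --> x] --> F x.
    by apply: differentiable_continuous; apply/derivable1_diffP; case: (dF x).
  split.
  + by move=> x _; case: (dF x).
  + by apply: cvg_at_right_filter; exact: cF.
  + by apply: cvg_at_left_filter; exact: cF.
- by move=> x _; rewrite derive1E; case: (dF x).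
Qed.

Lemma rmean1 : rmean (fun=> 1) = 1.
Proof.
rewrite (@rmean_FTC _ id).
- by rewrite subr0 mulVf// gt_eqF// tau_gt0.
- by move=> x; exact: cvg_cst.
Qed.

Lemma is_derive_mulz n (x : R) : is_derive x 1 (fun x : R => x *~ n) n%:~R.
Proof.
rewrite (_ : (fun x => _) = (n%:~R : R) \*: (@id R)).
  by apply: is_derive_eq; rewrite /GRing.scale /= mulr1.
by apply/funext => y; rewrite /= /GRing.scale /= mulrzl.
Qed.

Lemma rmean_cosz (n : int) : n != 0 -> rmean (fun x => cos (x *~ n)) = 0.
Proof.
move=> n0; have nR : (n%:~R : R) != 0 by rewrite intr_eq0.
have dF (x : R) : is_derive x 1 (fun x => n%:~R^-1 * sin (x *~ n)) (cos (x *~ n)).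
  have d1 := is_derive_mulz n x.
  have d2 : is_derive x 1 (fun x => sin (x *~ n)) (cos (x *~ n) *: n%:~R).
    exact: (@is_derive1_comp _ sin (fun x => x *~ n)).
  apply: is_derive_eq; rewrite /GRing.scale /=.
  by rewrite mulrCA mulVf ?mulr1.
rewrite (rmean_FTC _ dF); last by have := @cpf_contRe (ce n); under eq_fun do rewrite ceE.
have /(congr1 (@complex.Im R)) := cpf_per (ce n) 0.
by rewrite !ceE add0r /= mul0rz sin0 => ->; rewrite mulr0 subrr mulr0.
Qed.

Lemma rmean_sinz (n : int) : rmean (fun x => sin (x *~ n)) = 0.
Proof.
have [->|n0] := eqVneq n 0.
  rewrite (_ : (fun x => _) = (fun x => 0 * 1)); last first.
    by apply/funext => x; rewrite mulr0z sin0 mul0r.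
  by rewrite rmeanZ ?mul0r// => x; exact: cvg_cst.
have nR : (n%:~R : R) != 0 by rewrite intr_eq0.
have dF (x : R) : is_derive x 1 (fun x => - n%:~R^-1 * cos (x *~ n)) (sin (x *~ n)).
  have d1 := is_derive_mulz n x.
  have d2 : is_derive x 1 (fun x => cos (x *~ n)) (- sin (x *~ n) *: n%:~R).
    exact: (@is_derive1_comp _ cos (fun x => x *~ n)).
  apply: is_derive_eq; rewrite /GRing.scale /=.
  by rewrite mulNr mulNr mulrN opprK mulrCA mulVf ?mulr1.
rewrite (rmean_FTC _ dF); last by have := @cpf_contIm (ce n); under eq_fun do rewrite ceE.
have /(congr1 (@complex.Re R)) := cpf_per (ce n) 0.
by rewrite !ceE add0r /= mul0rz cos0 => ->; rewrite subrr mulr0.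
Qed.

Definition cmean (f : R -> C) : C :=
  (rmean (fun x => complex.Re (f x)) +i* rmean (fun x => complex.Im (f x)))%C.

Definition M (f : cpf) : C := cmean f.

Arguments M : simpl never.
Fact M_zmod_morphism : zmod_morphism M.
Proof.
move=> f g; rewrite /M /cmean.
have -> : rmean (fun x => complex.Re ((f - g) x)) =
    rmean (fun x => complex.Re (f x)) - rmean (fun x => complex.Re (g x)).
  rewrite -rmeanB; [|exact: cpf_contRe|exact: cpf_contRe].
  by congr rmean; apply/funext => x; rewrite cpfB raddfB.
have -> : rmean (fun x => complex.Im ((f - g) x)) =
    rmean (fun x => complex.Im (f x)) - rmean (fun x => complex.Im (g x)).
  rewrite -rmeanB; [|exact: cpf_contIm|exact: cpf_contIm].
  by congr rmean; apply/funext => x; rewrite cpfB raddfB.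
by [].
Qed.
HB.instance Definition _ := GRing.isZmodMorphism.Build cpf C M M_zmod_morphism.

Lemma MD f g : M (f + g) = M f + M g. Proof. exact: raddfD. Qed.
Lemma MB f g : M (f - g) = M f - M g. Proof. exact: raddfB. Qed.
Lemma MZ a f : M (cc a * f) = a * M f.
Proof.
have cR := @cpf_contRe f; have cI := @cpf_contIm f.
rewrite /M /cmean.
have -> : rmean (fun x => complex.Re ((cc a * f) x)) =
    complex.Re a * rmean (fun x => complex.Re (f x))
    - complex.Im a * rmean (fun x => complex.Im (f x)).
  rewrite -!rmeanZ// -rmeanB; last 2 first.
  - by move=> x; apply: cvgM; [exact: cvg_cst|exact: cR].
  - by move=> x; apply: cvgM; [exact: cvg_cst|exact: cI].
  by congr rmean; apply/funext => x; rewrite cpfM ccE; case: (a) (f x) => ? ? [].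
have -> : rmean (fun x => complex.Im ((cc a * f) x)) =
    complex.Re a * rmean (fun x => complex.Im (f x))
    + complex.Im a * rmean (fun x => complex.Re (f x)).
  rewrite -!rmeanZ// -rmeanD; last 2 first.
  - by move=> x; apply: cvgM; [exact: cvg_cst|exact: cI].
  - by move=> x; apply: cvgM; [exact: cvg_cst|exact: cR].
  by congr rmean; apply/funext => x; rewrite cpfM ccE; case: (a) (f x) => ? ? [].
by case: a.
Qed.

Lemma M_cj f : M (cj f) = (M f)^*%C.
Proof.
have cI := @cpf_contIm f.
rewrite /M /cmean /=; congr Complex.
  by congr rmean; apply/funext => x; rewrite cjE; case: (f x).
rewrite -mulN1r -rmeanZ//; congr rmean; apply/funext => x.
by rewrite cjE; case: (f x) => ? ?; rewrite /= mulN1r.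
Qed.

Lemma M_ce n : M (ce n) = (n == 0)%:R.
Proof.
have [->|n0] := eqVneq n 0; last first.
  rewrite /M /cmean; under eq_fun do rewrite ceE.
  by under [in X in (_ +i* X)%C]eq_fun do rewrite ceE; rewrite /= rmean_cosz// rmean_sinz.
have r0 : rmean (fun=> 0) = 0.
  by rewrite -[RHS](rmean_sinz 0); congr rmean; apply/funext => x; rewrite mulr0z sin0.
by rewrite ce0 /M /cmean /= r0 rmean1.
Qed.
Lemma M1 : M 1 = 1. Proof. by rewrite -ce0 M_ce eqxx. Qed.
Lemma M_cc a : M (cc a) = a. Proof. by rewrite -[cc a]mulr1 MZ M1 mulr1. Qed.

Lemma M_ge0 (f : cpf) : (forall x, 0 <= f x) -> 0 <= M f.
Proof.
move=> f0; rewrite lecE /=; apply/andP; split.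
  rewrite (_ : (fun x => _) = (fun x => 0 * 1)).
    by rewrite rmeanZ ?mul0r// => x; exact: cvg_cst.
  apply/funext => x; rewrite mul0r.
  by have := f0 x; rewrite lecE /= => /andP[/eqP].
by apply: rmean_ge0 => x; have := f0 x; rewrite lecE /= => /andP[].
Qed.
Lemma le_M (f g : cpf) : (forall x, f x <= g x) -> M f <= M g.
Proof.
by move=> fg; rewrite -subr_ge0 -raddfB; apply: M_ge0 => x; rewrite cpfB subr_ge0.
Qed.

(** Integration is done separately on real and imaginary parts, so the triangle inequality with
    constant 1 needs a rotation: a unimodular [u] makes M (u f) equal to |M f|, and the real part of
    u f is at most |f|. *)
Lemma norm_M_le (f h : cpf) : (forall x, `|f x| <= h x) -> `|M f| <= M h.
Proof.
move=> fh.
have [/eqP z0|z0] := boolP (M f == 0).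
  by rewrite z0 normr0; apply: M_ge0 => x; apply: le_trans (fh x).
pose u := (M f)^*%C / `|M f|.
have un : `|u| = 1.
  by rewrite /u normrM normrV ?unitfE ?normr_eq0// normr_id normcJ mulfV// normr_eq0.
have uM : u * M f = `|M f|.
  by rewrite /u mulrAC [_^*%C * _]mulrC -sqr_normc expr2 mulfK// normr_eq0.
pose g := cc 2^-1 * (cc u * f + cj (cc u * f)).
have gM : M g = `|M f|.
  rewrite /g MZ raddfD /= M_cj MZ uM.
  have -> : `|M f|^*%C = `|M f| by rewrite normc_def conjc_real.
  by rewrite -mulr2n -[_ *+ 2 in X in _ * X]mulr_natl mulKf// pnatr_eq0.
rewrite -gM; apply: le_M => x; apply: le_trans (fh x).
have -> : g x = (complex.Re (u * f x))%:C%C.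
  rewrite /g !(cpfM, cpfD, cjE) !ccE addcJ.
  by rewrite mulKf// pnatr_eq0.
apply: (@le_trans _ _ (`|complex.Re (u * f x)|%:C%C)).
  by rewrite lecR ler_norm.
by apply: le_trans (normc_ge_Re _) _; rewrite normrM un mul1r.
Qed.

Lemma norm_M_bound (f : cpf) (b : C) : (forall x, `|f x| <= b) -> `|M f| <= b.
Proof. by move=> fb; rewrite -[b]M_cc; apply: norm_M_le => x; rewrite ccE. Qed.

Definition coef (f : cpf) (n : int) : C := M (f * ce (- n)).

Lemma coefZ a f n : coef (cc a * f) n = a * coef f n.
Proof. by rewrite /coef -mulrA MZ. Qed.
Lemma coefD f g n : coef (f + g) n = coef f n + coef g n.
Proof. by rewrite /coef mulrDl raddfD. Qed.
Lemma coefB f g n : coef (f - g) n = coef f n - coef g n.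
Proof. by rewrite /coef mulrBl raddfB. Qed.
Lemma coef_sum I (s : seq I) P (F : I -> cpf) n :
  coef (\sum_(i <- s | P i) F i) n = \sum_(i <- s | P i) coef (F i) n.
Proof. by rewrite /coef mulr_suml raddf_sum. Qed.
Lemma coefMe f m n : coef (f * ce m) n = coef f (n - m).
Proof. by rewrite /coef -mulrA -ceD opprB. Qed.
Lemma coef_ce m n : coef (ce m) n = (m == n)%:R.
Proof. by rewrite /coef -ceD M_ce subr_eq0. Qed.
Lemma coef_cc a n : coef (cc a) n = a * (n == 0)%:R.
Proof. by rewrite -[cc a]mulr1 coefZ -ce0 coef_ce eq_sym. Qed.
Lemma coef0E f : coef f 0 = M f. Proof. by rewrite /coef oppr0 ce0 mulr1. Qed.

Lemma norm_ce n x : `|ce n x| = 1.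
Proof. by rewrite ceE normc_def /= cos2Dsin2 sqrtr1. Qed.

Lemma norm_coef_bound (f : cpf) (b : C) n : (forall x, `|f x| <= b) -> `|coef f n| <= b.
Proof.
by move=> fb; apply: norm_M_bound => x; rewrite cpfM normrM norm_ce mulr1.
Qed.

(** With p the partial Fourier sum over s, f - p is orthogonal to p; expanding the non-negative mean
    of |f - p|^2 leaves the inequality. *)
Lemma bessel (f : cpf) (s : seq int) : uniq s ->
  \sum_(n <- s) `|coef f n| ^+ 2 <= M (f * cj f).
Proof.
move=> us; pose p := \sum_(n <- s) cc (coef f n) * ce n.
have fp g : M (g * cj p) = \sum_(n <- s) (coef f n)^*%C * coef g n.
  rewrite /p raddf_sum mulr_sumr raddf_sum; apply: eq_bigr => n _.
  by rewrite /= rmorphM /= cj_cc cj_ce mulrCA MZ.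
have cp n : n \in s -> coef p n = coef f n.
  move=> ns; rewrite /p coef_sum (bigD1_seq n)//= coefZ coef_ce eqxx mulr1.
  by rewrite big1 ?addr0// => m /negbTE mn; rewrite coefZ coef_ce mn mulr0.
have : 0 <= M ((f - p) * cj (f - p)).
  by apply: M_ge0 => x; rewrite cpfM cjE mulcJ_ge0.
rewrite rmorphB /= mulrBr mulrBl raddfB /= [M ((f - p) * cj p)]fp.
rewrite big1_seq ?subr0; last first.
  by move=> n /andP[_ ns]; rewrite coefB cp// subrr mulr0.
rewrite raddfB /= subr_ge0; apply: le_trans.
rewrite -[p * cj f](_ : cj (f * cj p) = _); last first.
  rewrite rmorphM /= mulrC; congr (_ * _); apply: cpfP => x.
  by rewrite !cjE conjcK.
rewrite M_cj fp (raddf_sum (@conjc R)); apply: ler_sum => n _.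
rewrite -[X in _ <= X]/(((coef f n)^*%C * coef f n)^*%C).
by rewrite conjcM conjcK sqr_normc.
Qed.

End CircleFunctions.

(** * The real-valued modulus of complex numbers *)

Section Normc.
Variable R : realType.
Local Notation C := R[i].
Implicit Types z w : C.

Lemma normrcE z : `|z| = (normc z)%:C%C.
Proof. by case: z => a b; rewrite normc_def. Qed.
Lemma normc_ge0 z : 0 <= normc z.
Proof. by case: z => a b; rewrite /= sqrtr_ge0. Qed.
Lemma normc_le_sum I (s : seq I) P (F : I -> C) :
  normc (\sum_(i <- s | P i) F i) <= \sum_(i <- s | P i) normc (F i).
Proof.
elim/big_rec2: _ => [|i a b _ ab]; first by rewrite normc0.
by rewrite (le_trans (le_normcD _ _))// lerD2l.
Qed.
Lemma normcR (a : R) : normc a%:C%C = `|a|.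
Proof. by rewrite /= expr0n /= addr0 sqrtr_sqr. Qed.
Lemma normc_nat n : normc (n%:R : C) = n%:R.
Proof. by rewrite -(rmorph_nat (real_complex R)) normcR ger0_norm. Qed.
Lemma normcB z w : normc (z - w) <= normc z + normc w.
Proof. by rewrite (le_trans (le_normcD _ _))// normcN. Qed.
Lemma normc_distC z w : normc (z - w) = normc (w - z).
Proof. by rewrite -normcN opprB. Qed.
Lemma normc_Re z : `|complex.Re z| <= normc z.
Proof.
by case: z => a b; rewrite /= -sqrtr_sqr ler_sqrt ?lerDl ?sqr_ge0// addr_ge0// sqr_ge0.
Qed.
Lemma normc_Im z : `|complex.Im z| <= normc z.
Proof.
by case: z => a b; rewrite /= -sqrtr_sqr ler_sqrt ?lerDr ?sqr_ge0// addr_ge0// sqr_ge0.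
Qed.
Lemma normc_ReIm z : normc z <= `|complex.Re z| + `|complex.Im z|.
Proof.
rewrite {1}[z]complexE (le_trans (le_normcD _ _))// normcM !normcR.
by rewrite {1}/normc expr0n expr1n add0r sqrtr1 mul1r.
Qed.
Lemma normcX2 z : ((normc z) ^+ 2)%:C%C = z * conjc z.
Proof. by rewrite -sqr_normc normrcE rmorphXn. Qed.
End Normc.
Arguments ComplexField.Normc.normc : simpl never.

(** * Fejer means *)

Section Fejer.
Variable R : realType.
Local Notation C := R[i].
Local Notation tau := (@trigo.pi R *+ 2).
Implicit Types f g h : cpf R.

Lemma normc_M_bound f (b : R) :
  (forall x, normc (f x) <= b) -> normc (M f) <= b.
Proof.
move=> fb; rewrite -lecR -normrcE; apply: norm_M_bound => x.
by rewrite normrcE lecR.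
Qed.
Lemma normc_coef_bound f (b : R) n :
  (forall x, normc (f x) <= b) -> normc (coef f n) <= b.
Proof.
move=> fb; rewrite -lecR -normrcE; apply: norm_coef_bound => x.
by rewrite normrcE lecR.
Qed.
Lemma normc_ce n (x : R) : normc (ce R n x) = 1.
Proof. by apply: complexI; rewrite -normrcE norm_ce. Qed.
Lemma bessel_bound f (b : R) (s : seq int) : uniq s ->
  (forall x, normc (f x) <= b) -> \sum_(n <- s) normc (coef f n) ^+ 2 <= b ^+ 2.
Proof.
move=> us fb; rewrite -lecR.
have -> : (\sum_(n <- s) normc (coef f n) ^+ 2)%:C%C =
    \sum_(n <- s) `|coef f n| ^+ 2.
  rewrite (rmorph_sum (real_complex R)); apply: eq_bigr => n _.
  by rewrite normrcE -rmorphXn.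
apply: le_trans (bessel f us) _; rewrite -[X in _ <= X]M_cc; apply: le_M => x.
rewrite cpfM cjE -normcX2 ccE lecR ler_pXn2r// ?nnegrE ?normc_ge0//.
exact: le_trans (normc_ge0 _) (fb x).
Qed.

Lemma near0_shift (x : R) : exists k : int, - pi <= x + tau *~ k <= pi.
Proof.
have t0 := tau_gt0 R.
pose k := Num.floor ((x + pi) / tau); exists (- k).
have k1 : k%:~R * tau <= x + pi.
  by rewrite -ler_pdivlMr// floor_le_tmp.
have k2 : x + pi < (k + 1)%:~R * tau.
  by rewrite -ltr_pdivrMr// floorD1_gt.
rewrite intrD mulrDl mul1r mulr2n in k2; rewrite mulrNz -[tau *~ _]mulrzl.
set K := _ * _ in k1 k2 *; rewrite -!mulr2n in k2 *.
by apply/andP; split; lra.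
Qed.

Lemma cpf_bounded f : exists2 B : R, 0 <= B & forall x, normc (f x) <= B.
Proof.
have t0 := tau_gt0 R.
have bd (g : R -> R) : continuous g -> exists B, forall x, 0 <= x <= tau -> `|g x| <= B.
  move=> cg.
  have := @continuous_compact R R g `[0, tau] (continuous_subspaceT cg) (@segment_compact _ _ _).
  move=> /compact_bounded[B0 [_ HB]]; exists (`|B0| + 1) => x x0.
  apply: (HB (`|B0| + 1)); first by rewrite (le_lt_trans (ler_norm _))// ltrDl.
  by exists x => //=; rewrite in_itv.
have [B1 H1] := bd _ (@cpf_contRe _ f).
have [B2 H2] := bd _ (@cpf_contIm _ f).
have H x : normc (f x) <= B1 + B2.
  have [k /andP[k1 k2]] := near0_shift (x - pi).
  rewrite -(cpf_perz f x k); set y := x + _.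
  have y0 : 0 <= y <= tau by rewrite /y; apply/andP; split; lra.
  by rewrite (le_trans (normc_ReIm _))// lerD// ?H1// H2.
by exists (B1 + B2) => //; apply: le_trans (normc_ge0 _) (H 0).
Qed.

(** Only x is confined to [a, b], while t may lie just outside; later, x alone has to be brought
    into a fixed period. *)
Lemma real_unif (g : R -> R) (a b e : R) : continuous g -> 0 < e ->
  exists2 d : R, 0 < d & forall x t, a <= x <= b -> `|x - t| < d -> `|g x - g t| <= e.
Proof.
move=> cg e0.
have := @segment_compact R a b; rewrite compact_near_coveringP => /(_ R 0^'+
  (fun d x => forall t, `|x - t| < d -> `|g x - g t| <= e) _).
case.
  move=> x _.
  have /cvgrPdist_lt/(_ (e / 2)) := cg x; rewrite divr_gt0// => /(_ isT).
  move=> [/= r r0 Hr].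
  exists ([set y | `|x - y| < r / 2], [set d | d < r / 2]).
    split => /=.
      by exists (r / 2) => //=; rewrite divr_gt0.
    exists (r / 2) => /=; first by rewrite divr_gt0.
    by move=> d /=; rewrite sub0r normrN => /(le_lt_trans (ler_norm _)) ? _.
  move=> [y d] /= [xy dr] t yt.
  have h1 : `|g x - g y| < e / 2.
    by apply: Hr => /=; rewrite (lt_trans xy)// ltr_pdivrMr// ltr_pMr// ltr1n.
  have h2 : `|g x - g t| < e / 2.
    apply: Hr => /=; apply: le_lt_trans (ler_distD y x t) _.
    by rewrite (splitr r) ltrD// (lt_trans yt).
  apply: le_trans (ler_distD (g x) (g y) (g t)) _.
  by rewrite distrC (splitr e) ltW// ltrD.
move=> r /= r0 H; exists (r / 2); first by rewrite divr_gt0.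
move=> x t xab xt; apply: (H (r / 2)) => //=.
- by rewrite sub0r normrN gtr0_norm ?divr_gt0// ltr_pdivrMr// ltr_pMr// ltr1n.
- by rewrite divr_gt0.
Qed.

(** The modulus of continuity is put in Korovkin form, because 1 - cos (x - t) is then the only
    non-constant function whose mean against the Fejer kernel has to be computed. *)
Lemma cpf_unif f (e : R) : 0 < e -> exists2 K : R, 0 <= K &
  forall x t, normc (f x - f t) <= e + K * (1 - cos (x - t)).
Proof.
move=> e0; have p0 := pi_gt0 R.
have e20 : 0 < e / 2 by rewrite divr_gt0.
have [d1 d10 H1] := real_unif 0 tau (@cpf_contRe _ f) e20.
have [d2 d20 H2] := real_unif 0 tau (@cpf_contIm _ f) e20.
have [B B0 HB] := cpf_bounded f.
pose d := Num.min (Num.min d1 d2) pi.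
have d0 : 0 < d by rewrite !lt_min d10 d20 p0.
have dpi : d <= pi by rewrite ge_min lexx orbT.
have cd : 0 < 1 - cos d.
  rewrite subr_gt0 -[X in _ < X]cos0 ltr_cos//; rewrite in_itv /=.
    by rewrite lexx (ltW p0).
  by rewrite (ltW d0).
(* If x and t are at distance at least [d] modulo 2 pi, then 1 - cos (x - t) >= 1 - cos d, and this
   constant restores the trivial bound 2 B. *)
exists (2 * B / (1 - cos d)); first by rewrite divr_ge0 ?mulr_ge0// ltW.
move=> x t.
have [l /andP[l1 l2]] := near0_shift (x - pi).
pose x' := x + tau *~ l.
have x'0 : 0 <= x' <= tau by rewrite /x'; apply/andP; split; lra.
have [k /andP[k1 k2]] := near0_shift (x' - t).
pose t' := t - tau *~ k.
have -> : f x = f x' by rewrite cpf_perz.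
have -> : f t = f t' by rewrite /t' -mulrNz cpf_perz.
have -> : cos (x - t) = cos (x' - t').
  have := congr1 (@complex.Re R) (cpf_perz (ce R 1) (x - t) (l + k)).
  by rewrite !ceE !mulr1z /= => <-; congr cos; rewrite /x' /t' mulrzDr; lra.
have xt : `|x' - t'| <= pi by rewrite ler_norml /t'; apply/andP; split; lra.
have cle := cos_le1 (x' - t').
have [xtd|dxt] := ltP `|x' - t'| d.
  apply: (@le_trans _ _ e); last first.
    by rewrite lerDl mulr_ge0 ?subr_ge0// divr_ge0 ?mulr_ge0// ltW.
  rewrite (le_trans (normc_ReIm _))// !raddfB /=.
  have := H1 x' t' x'0; have := H2 x' t' x'0.
  move: xtd; rewrite /d !lt_min => /andP[/andP[-> ->] _].
  by move=> /(_ isT) ? /(_ isT) ?; lra.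
have cc : cos (x' - t') <= cos d.
  rewrite -(cos_norm (x' - t')) leNgt ltr_cos; first by rewrite -leNgt.
  - by rewrite in_itv /= normr_ge0.
  - by rewrite in_itv /= (ltW d0).
apply: (@le_trans _ _ (2 * B)).
  by rewrite (le_trans (normcB _ _))// mulr2n mulrDl mul1r lerD.
have : 2 * B <= 2 * B / (1 - cos d) * (1 - cos (x' - t')).
  rewrite mulrAC ler_pdivlMr// ler_wpM2l ?mulr_ge0//; lra.
by move=> *; lra.
Qed.

End Fejer.

Section FejerMeans.
Variable R : realType.
Local Notation C := R[i].
Implicit Types f g h : cpf R.
Local Notation ce := (ce R).

(** The Cesaro mean, with weight 1 - |n| / N at frequency n. Summing over pairs (j, k) exhibits its
    kernel as the square |D|^2 / N, hence as non-negative. *)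
Definition fejer N f : cpf R :=
  \sum_(j < N) \sum_(k < N)
     cc (N%:R^-1 * coef f (j%:Z - k%:Z)) * ce (j%:Z - k%:Z).

Definition fkernel N (x : R) : cpf R :=
  let D := \sum_(j < N) cc (ce j%:Z x) * ce (- j%:Z) in
  cc N%:R^-1 * (D * cj D).

Lemma fejerE N f x : fejer N f x = M (f * fkernel N x).
Proof.
have -> : f * fkernel N x = \sum_(j < N) \sum_(k < N)
    cc (N%:R^-1 * ce (j%:Z - k%:Z) x) * (f * ce (- (j%:Z - k%:Z))).
  rewrite /fkernel mulrCA mulr_suml mulr_sumr mulr_sumr; apply: eq_bigr => j _.
  rewrite raddf_sum !mulr_sumr; apply: eq_bigr => k _.
  rewrite /= rmorphM /= cj_cc cj_ce opprK.
  rewrite -[(ce k x)^*%C]cjE cj_ce opprB !ceD cpfM !ccM.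
  by ring.
rewrite raddf_sum cpf_sum; apply: eq_bigr => j _.
rewrite raddf_sum cpf_sum; apply: eq_bigr => k _.
rewrite cpfM ccE [RHS]/= MZ -[M (f * _)]/(coef f _) -!mulrA.
by congr (_ * _); exact: mulrC.
Qed.

Lemma fkernel_ge0 N x t : 0 <= fkernel N x t.
Proof.
rewrite !cpfM cjE mulr_ge0 ?mulcJ_ge0//.
by rewrite ccE invr_ge0 ler0n.
Qed.

(** The value is N - |n| for |n| < N and 0 otherwise. *)
Definition lagcount N (n : int) : nat :=
  \sum_(j < N) \sum_(k < N) ((j%:Z - k%:Z == n)%R : nat).

Lemma coef_fejer N f n :
  coef (fejer N f) n = (N%:R^-1 * (lagcount N n)%:R) * coef f n.
Proof.
rewrite /fejer /lagcount natr_sum mulr_sumr mulr_suml coef_sum.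
apply: eq_bigr => j _; rewrite natr_sum mulr_sumr mulr_suml coef_sum.
apply: eq_bigr => k _; rewrite coefZ coef_ce.
by case: eqP => [->|_]; rewrite ?mulr0 ?mul0r// !mulr1.
Qed.

Lemma lagcount_le N n : (lagcount N n <= N)%N.
Proof.
rewrite /lagcount -[X in (_ <= X)%N]card_ord -sum1_card; apply: leq_sum => j _.
have [/existsP[k0 /eqP k0E]|/existsPn H] := boolP [exists k : 'I_N, j%:Z - k%:Z == n].
  rewrite (bigD1 k0)//= k0E eqxx big1// => k kk0.
  apply/eqP; rewrite eqb0; apply: contra kk0 => /eqP; rewrite -k0E.
  by move=> /addrI/oppr_inj[] /eqP.
by rewrite big1// => k _; apply/eqP; rewrite eqb0.
Qed.

Lemma lagcount_eq0 N n : (N <= `|n|)%N -> lagcount N n = 0%N.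
Proof.
move=> Nn; rewrite /lagcount big1// => j _; rewrite big1// => k _.
apply/eqP; rewrite eqb0; apply/eqP => jkn.
by have := ltn_ord j; have := ltn_ord k; lia.
Qed.

Lemma lagcount0 N : lagcount N 0 = N.
Proof.
rewrite /lagcount -[RHS]card_ord -sum1_card; apply: eq_bigr => j _.
rewrite (bigD1 j)//= subrr eqxx big1// => k kj.
by apply/eqP; rewrite eqb0 subr_eq0 eq_sym; apply: contra kj => /eqP[] /eqP.
Qed.

Lemma lagcountN N n : lagcount N (- n) = lagcount N n.
Proof.
rewrite /lagcount exchange_big /=; apply: eq_bigr => j _; apply: eq_bigr => k _.
by rewrite -opprB eqr_opp.
Qed.

Lemma lagcount1 N : lagcount N.+1 1 = N.
Proof.
rewrite /lagcount exchange_big /= big_ord_recr /=.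
rewrite [X in (_ + X)%N]big1 ?addn0; last first.
  by move=> j _; apply/eqP; rewrite eqb0; apply/eqP; have := ltn_ord j; lia.
rewrite -[RHS]card_ord -sum1_card; apply: eq_bigr => k _.
have kN : (k.+1 < N.+1)%N by rewrite ltnS.
rewrite (bigD1 (Ordinal kN))//= big1 ?addn0.
  by apply/eqP; rewrite eqb1; apply/eqP; lia.
move=> j jk; apply/eqP; rewrite eqb0; apply: contra jk => /eqP jk.
by apply/eqP/val_inj => /=; lia.
Qed.

(** Korovkin's argument: the kernel is non-negative with mean 1, and the mean of 1 - cos (x - t)
    against it is exactly 1 / (N + 1). *)
Lemma fejer_approx f (e : R) : 0 < e ->
  exists N0, forall N x, (N0 <= N)%N -> normc (f x - fejer N.+1 f x) <= e.
Proof.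
move=> e0; have e20 : 0 < e / 2 by rewrite divr_gt0.
have [K K0 HK] := cpf_unif f e20.
have [N0 HN0] : exists N0 : nat, K / (e / 2) < N0%:R.
  exists (Num.truncn (K / (e / 2))).+1.
  by have /andP[] := truncn_itv (divr_ge0 K0 (ltW e20)).
exists N0 => N x N0N.
pose hx : cpf R := 1 - cc 2^-1 * (cc (ce 1 x) * ce (- 1) + cc (ce (- 1) x) * ce 1).
have hxE t : hx t = (1 - cos (x - t))%:C%C.
  rewrite /hx cpfB !(cpfM, cpfD) !ceE !ccE.
  rewrite !mulrN1z !mulr1z !cosN !sinN cosB cpf1.
  have -> : (2^-1 : C) = (2^-1)%:C%C by rewrite fmorphV rmorph_nat.
  by apply/eqP; rewrite eq_complex; apply/andP; split; apply/eqP => /=; field.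
have N1 : (N.+1%:R : C) != 0 by rewrite pnatr_eq0.
have M1 : M (fkernel N.+1 x) = 1.
  rewrite -[fkernel _ _]mul1r -fejerE /fejer.
  transitivity ((N.+1%:R^-1 * (lagcount N.+1 0)%:R) * (1 : cpf R) x); last first.
    by rewrite lagcount0 mulVf// mulr1.
  rewrite /lagcount natr_sum mulr_sumr mulr_suml cpf_sum; apply: eq_bigr => j _.
  rewrite natr_sum mulr_sumr mulr_suml cpf_sum; apply: eq_bigr => k _.
  rewrite cpfM ccE -ce0 coef_ce eq_sym.
  by case: eqP => [->|_]; rewrite ?mulr0 ?mul0r ?mulr1.
have Fce m : fejer N.+1 (ce m) x = N.+1%:R^-1 * (lagcount N.+1 m)%:R * ce m x.
  rewrite /fejer /lagcount natr_sum mulr_sumr mulr_suml cpf_sum; apply: eq_bigr => j _.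
  rewrite natr_sum mulr_sumr mulr_suml cpf_sum; apply: eq_bigr => k _.
  rewrite cpfM ccE coef_ce eq_sym.
  by case: eqP => [->|_]; rewrite ?mulr0 ?mul0r ?mulr1.
have Mh : M (hx * fkernel N.+1 x) = N.+1%:R^-1.
  rewrite /hx mulrBl mul1r raddfB /= M1 -mulrA MZ mulrDl raddfD /= -!mulrA !MZ -!fejerE.
  have L1 : lagcount N.+1 (- 1) = N by rewrite (lagcountN _ 1) lagcount1.
  have E : ce 1 x * ce (- 1) x = 1 by rewrite -cpfM -ceD subrr ce0 cpf1.
  have F1 : fejer N.+1 (ce 1) x = N.+1%:R^-1 * N%:R * ce 1 x.
    by rewrite Fce lagcount1.
  have FN1 : fejer N.+1 (ce (- 1)) x = N.+1%:R^-1 * N%:R * ce (- 1) x.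
    by rewrite Fce L1.
  rewrite [X in 1 - 2^-1 * (_ * X + _)]FN1 [X in 1 - 2^-1 * (_ + _ * X)]F1.
  transitivity (1 - N.+1%:R^-1 * (N%:R : C) * (ce 1 x * ce (- 1) x)).
    by move: (N.+1%:R^-1 : C) => u; field.
  rewrite E mulr1; have -> : (N%:R : C) = N.+1%:R - 1 by rewrite -natr1 addrK.
  by rewrite mulrBr mulVf// mulr1 opprB addrC subrK.
have -> : f x - fejer N.+1 f x = M ((cc (f x) - f) * fkernel N.+1 x).
  by rewrite mulrBl raddfB /= MZ M1 mulr1 fejerE.
rewrite -lecR -normrcE.
apply: (@le_trans _ _ (M ((cc (e / 2)%:C%C + cc K%:C%C * hx) * fkernel N.+1 x))).
  apply: norm_M_le => t; rewrite !cpfM normrM (ger0_norm (fkernel_ge0 _ _ _)).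
  rewrite ler_wpM2r ?fkernel_ge0// cpfB cpfD cpfM hxE.
  rewrite !ccE.
  by rewrite -rmorphM -rmorphD normrcE lecR HK.
rewrite mulrDl raddfD /= MZ M1 mulr1 -mulrA MZ Mh.
have -> : (N.+1%:R^-1 : C) = (N.+1%:R^-1)%:C%C by rewrite fmorphV rmorph_nat.
rewrite -rmorphM -rmorphD lecR {2}(splitr e) lerD2l ler_pdivrMr//.
rewrite mulrC -ler_pdivrMr// (le_trans (ltW HN0))// ler_nat (leq_trans N0N)//.
Qed.

Lemma M_fejer N g f : M (g * fejer N f) =
  \sum_(j < N) \sum_(k < N)
    N%:R^-1 * coef f (j%:Z - k%:Z) * coef g (k%:Z - j%:Z).
Proof.
rewrite /fejer mulr_sumr raddf_sum; apply: eq_bigr => j _.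
rewrite mulr_sumr raddf_sum; apply: eq_bigr => k _.
by rewrite /= mulrCA MZ [coef g _]/coef opprB.
Qed.

(** The weight telescopes, and at |n| >= 1 it dominates 1 / n^2 since (m + 1)(m + 2) <= 6 m^2 for m
    >= 1; it is the form in which the decay of smooth coefficients is recorded. *)
Lemma sum_weight n : \sum_(i < n) 6 / ((i.+1 * i.+2)%:R : R) <= 6.
Proof.
suff : \sum_(i < n) 6 / ((i.+1 * i.+2)%:R : R) = 6 - 6 / n.+1%:R.
  by move=> ->; rewrite lerBlDr lerDl divr_ge0.
elim: n => [|n IH]; first by rewrite big_ord0 divr1 subrr.
rewrite big_ord_recr /= IH natrM -!(natr1, natrD); field.
by rewrite !natr1 !pnatr_eq0.
Qed.

Lemma sum_weight_lag N (j : nat) : (j < N)%N ->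
  \sum_(k < N) 6 / (((`|j%:Z - k%:Z|.+1 * `|j%:Z - k%:Z|.+2)%N)%:R : R) <= 12.
Proof.
move=> jN.
have -> : N = (j + (N - j))%N by rewrite subnKC// ltnW.
rewrite big_split_ord /=.
have -> : (12 : R) = 6 + 6 by rewrite -natrD.
apply: lerD; last first.
  apply: le_trans (sum_weight (N - j)); apply: ler_sum => k _ /=.
  by rewrite (_ : `|_ - _|%N = k) //; lia.
rewrite (reindex_inj rev_ord_inj) /=.
apply: (@le_trans _ _ (\sum_(i < j) 6 / ((i.+1 * i.+2)%:R : R))); last exact: sum_weight.
apply: ler_sum => k _.
rewrite (_ : `|_ - _|%N = k.+1); last by have := ltn_ord k; lia.
by rewrite ler_pM2l// lef_pV2 ?posrE ?ltr0n// ler_nat leq_mul.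
Qed.

(** Parseval's formula is replaced by its finite version for Fejer means: each row of the double sum
    contributes at most 12 b q / (N + 1) by [sum_weight_lag], and the Fejer error is arbitrarily
    small. *)
Lemma pairing_bound g f (b q : R) : 0 <= b -> 0 <= q ->
  (forall n, normc (coef g n) <= b) ->
  (forall n, normc (coef f n) <= q * (6 / ((`|n|.+1 * `|n|.+2)%:R : R))) ->
  normc (M (g * f)) <= 12 * b * q.
Proof.
move=> b0 q0 gb fq; apply/ler_addgt0Pr => e e0.
have [B B0 HB] := cpf_bounded g.
have d0 : 0 < e / (B + 1) by rewrite divr_gt0// ltr_wpDl.
have [N HN] := fejer_approx f d0.
have -> : g * f = g * fejer N.+1 f + g * (f - fejer N.+1 f) by ring.
rewrite MD (le_trans (le_normcD _ _))// lerD//; last first.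
  apply: normc_M_bound => x; rewrite cpfM normcM.
  apply: (@le_trans _ _ (B * (e / (B + 1)))).
    by rewrite ler_pM ?normc_ge0// cpfB HN.
  rewrite mulrCA ler_piMr ?(ltW e0)// ler_pdivrMr ?ltr_wpDl//.
  by rewrite mul1r lerDl.
rewrite M_fejer (le_trans (normc_le_sum _ _ _))//.
apply: (@le_trans _ _ (\sum_(j < N.+1) N.+1%:R^-1 * (12 * b * q))); last first.
  by rewrite sumr_const card_ord -[X in X <= _]mulr_natl mulrA mulfV ?mul1r// pnatr_eq0.
apply: ler_sum => j _; rewrite (le_trans (normc_le_sum _ _ _))//.
apply: (@le_trans _ _ (N.+1%:R^-1 * b * q *
   \sum_(k < N.+1) 6 / (((`|j%:Z - k%:Z|.+1 * `|j%:Z - k%:Z|.+2)%N)%:R : R))).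
  rewrite mulr_sumr; apply: ler_sum => k _.
  rewrite !normcM normcV normc_nat -!mulrA ler_wpM2l ?invr_ge0//.
  by rewrite mulrC ler_pM ?normc_ge0.
have : N.+1%:R^-1 * (12 * b * q) = N.+1%:R^-1 * b * q * 12 by ring.
move=> ->; rewrite ler_wpM2l ?mulr_ge0 ?invr_ge0//.
exact: sum_weight_lag.
Qed.

End FejerMeans.

(** * Signed averages of Riesz products *)

Section Weights.
Variable R : realType.

(** Up to the sign (-1)^M, the M-th forward difference of f at 0. *)
Definition altsum (M : nat) (f : nat -> R) : R :=
  \sum_(i < M.+1) (-1) ^+ i * 'C(M, i)%:R * f i.

Lemma altsumS M f : altsum M.+1 f = altsum M (fun i => f i - f i.+1).
Proof.
rewrite /altsum big_ord_recl /= bin0 expr0 !mul1r.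
under eq_bigr do rewrite /bump /= add1n binS natrD mulrDr mulrDl.
rewrite big_split /= big_ord_recr /= bin_small// mulr0 mul0r addr0 addrA.
under [RHS]eq_bigr do rewrite mulrBr.
rewrite [RHS]big_split /=; congr (_ + _).
  by rewrite [RHS]big_ord_recl /= bin0 expr0 !mul1r; congr (_ + _).
by apply: eq_bigr => i _; rewrite exprS mulN1r !mulNr.
Qed.

Lemma eq_altsum M f g : (forall i, f i = g i) -> altsum M f = altsum M g.
Proof. by move=> fg; apply: eq_bigr => i _; rewrite fg. Qed.

(** An M-th difference annihilates polynomials of degree less than M, since each difference lowers
    the degree. *)
Lemma altsum_pow M m (x : R) : (m < M)%N -> altsum M (fun i => (x + i%:R) ^+ m) = 0.
Proof.
elim: M m => // M IH m mM; rewrite altsumS.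
rewrite (@eq_altsum _ _ (fun i => - \sum_(j < m) (x + i%:R) ^+ j *+ 'C(m, j))).
  rewrite /altsum; under eq_bigr do rewrite mulrN mulr_sumr.
  rewrite sumrN exchange_big big1 ?oppr0// => j _ /=.
  under eq_bigr => i _ do rewrite -[_ ^+ j *+ _]mulr_natr mulrA.
  rewrite -mulr_suml (_ : \sum_(i < _) _ = 0) ?mul0r//.
  by apply: IH; rewrite (leq_trans (ltn_ord j)).
move=> i; have -> : x + i.+1%:R = 1 + (x + i%:R) by rewrite -natr1; ring.
rewrite [(1 + _) ^+ m]exprDn big_ord_recr /= subnn binn expr0 mulr1n mul1r opprD addrCA subrr addr0.
by congr (- _); apply: eq_bigr => j _; rewrite expr1n mul1r.
Qed.

Definition rising M (x : R) := \prod_(j < M.+1) (x + j%:R).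

Lemma rising_gt0 M (x : R) : 0 < x -> 0 < rising M x.
Proof. by move=> x0; apply: prodr_gt0 => j _; rewrite ltr_wpDr. Qed.

(** The partial fraction expansion of M! / (x (x + 1) ... (x + M)). *)
Lemma altsum_inv M (x : R) : 0 < x ->
  altsum M (fun i => (x + i%:R)^-1) = M`!%:R / rising M x.
Proof.
elim: M x => [|M IH] x x0.
  rewrite /altsum /rising !big_ord_recl !big_ord0 /= bin0 expr0 !mul1r.
  by rewrite !addr0 mulr1.
have x10 : 0 < x + 1 by rewrite addr_gt0.
rewrite altsumS.
have -> : altsum M (fun i => (x + i%:R)^-1 - (x + i.+1%:R)^-1) =
    altsum M (fun i => (x + i%:R)^-1) - altsum M (fun i => (x + 1 + i%:R)^-1).
  rewrite /altsum -sumrB; apply: eq_bigr => i _.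
  by rewrite -mulrBr -natr1 (addrC i%:R) addrA.
rewrite !IH//.
have r1 : rising M.+1 x = rising M x * (x + M.+1%:R).
  by rewrite /rising big_ord_recr.
have r2 : rising M.+1 x = x * rising M (x + 1).
  rewrite /rising big_ord_recl /= addr0; congr (_ * _); apply: eq_bigr => i _.
  by rewrite /bump /= natrD addrA.
have y0 : 0 < x + M.+1%:R by rewrite addr_gt0.
have -> : rising M x = rising M.+1 x / (x + M.+1%:R).
  by rewrite r1 mulfK// gt_eqF.
have -> : rising M (x + 1) = rising M.+1 x / x.
  by rewrite r2 mulrC mulKf// gt_eqF.
have := rising_gt0 M.+1 x0; move: (rising M.+1 x) => r r0.
rewrite factS natrM; move: (M.+1%:R : R) (M`!%:R : R) y0 => k m y0; field.
by rewrite !gt_eqF.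
Qed.

Lemma rising_bin M : (0 < M)%N ->
  rising M (M%:R : R) / M`!%:R = M%:R * 'C(M.*2, M)%:R.
Proof.
move=> M0; have f0 : (M`!%:R : R) != 0 by rewrite pnatr_eq0 -lt0n fact_gt0.
apply: (mulIf f0); rewrite mulfVK// -mulrA -natrM bin_ffact ffact_prod.
rewrite /rising big_ord_recl /= addr0; congr (_ * _).
rewrite natr_prod [RHS](reindex_inj rev_ord_inj); apply: eq_bigr => i _ /=.
by rewrite -natrD; congr _%:R; rewrite /bump /=; have := ltn_ord i; lia.
Qed.

Lemma sum_binR n : \sum_(i < n.+1) 'C(n, i)%:R = 2 ^+ n :> R.
Proof.
have := exprDn (1 : R) 1 n; rewrite -[1 + 1]/2 => ->; apply: eq_bigr => i _.
by rewrite !expr1n mul1r.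
Qed.

Lemma bin_le_exp n i : ('C(n, i)%:R : R) <= 2 ^+ n.
Proof.
have [ni|ni] := ltnP n i; first by rewrite bin_small// exprn_ge0.
have ni' : (i < n.+1)%N by [].
rewrite -sum_binR (bigD1 (Ordinal ni'))//= lerDl sumr_ge0//.
Qed.

(** These are the Lagrange coefficients that recover p(0) from the values of p at M, ..., 2M, for
    polynomials p of degree at most M. Starting the nodes at M keeps them within a factor 2 of each
    other, so that after rescaling all Riesz parameters are comparable; the price is a total mass of
    up to 8^M. *)
Lemma weights M : (0 < M)%N -> exists nu : nat -> R,
  [/\ \sum_(i < M.+1) nu i = 1,
      forall m, (0 < m <= M)%N -> \sum_(i < M.+1) nu i * (M%:R + i%:R) ^+ m = 0 &
      \sum_(i < M.+1) `|nu i| <= 8 ^+ M].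
Proof.
move=> M0; have MR : 0 < (M%:R : R) by rewrite ltr0n.
have Mi i : (M%:R + i%:R : R) != 0 by rewrite gt_eqF// ltr_wpDr.
pose kap : R := M%:R * 'C(M.*2, M)%:R.
have kapE : kap = rising M M%:R / M`!%:R by rewrite rising_bin.
have kap0 : kap != 0.
  by rewrite mulf_neq0 ?gt_eqF// ltr0n bin_gt0 -addnn leq_addr.
(* (M + i)^m times the weight is, up to a constant, a term of the M-th difference of
   x^(m-1), which vanishes for 0 < m <= M. *)
exists (fun i => (-1) ^+ i * 'C(M, i)%:R * ((M%:R + i%:R)^-1 * kap)); split.
- under eq_bigr do rewrite mulrA.
  rewrite -mulr_suml -[X in X * _]/(altsum M (fun i => (M%:R + i%:R)^-1)).
  rewrite altsum_inv//.
  have -> : M`!%:R / rising M M%:R = kap^-1 by rewrite kapE invf_div.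
  by rewrite mulVf.
- move=> [//|m] mM.
  transitivity (kap * altsum M (fun i => (M%:R + i%:R) ^+ m)).
    rewrite mulr_sumr; apply: eq_bigr => i _; rewrite exprS.
    have := Mi i; move: (_ + _) => y y0; field.
    by [].
  by rewrite altsum_pow// mulr0.
- apply: (@le_trans _ _ (\sum_(i < M.+1) 'C(M, i)%:R * 4 ^+ M)).
    apply: ler_sum => i _; rewrite normrM [X in _ * X]ger0_norm; last first.
      by rewrite mulr_ge0 ?invr_ge0 ?addr_ge0// /kap mulr_ge0.
    rewrite normrM normrX normrN1 expr1n mul1r ger0_norm// ler_wpM2l//.
    have h1 : (M%:R + i%:R)^-1 * M%:R <= 1 :> R.
      by rewrite mulrC ler_pdivrMr ?ltr_wpDr// mul1r lerDl.
    have h0 : 0 <= (M%:R + i%:R)^-1 * M%:R :> R by rewrite mulr_ge0// invr_ge0 addr_ge0.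
    rewrite /kap mulrA -[leRHS]mul1r; apply: ler_pM => //.
    + rewrite (le_trans (bin_le_exp _ _))// -muln2 mulnC exprM.
      by rewrite -natrX.
  rewrite -mulr_suml sum_binR -exprMn.
  by rewrite -natrM.
Qed.

End Weights.

(** * Frequencies of Riesz products in base 9 *)

Section RieszFreq.

(* The pairs (n, m) where n = sum_(k < N) eps_k 9^k with eps_k in {-1, 0, 1} and m
   is the number of non-zero eps_k: n is a frequency of
   prod_(k < N) (1 + s cos(9^k x)), with coefficient (s/2)^m. *)
Fixpoint rfreq (N : nat) : seq (int * nat) :=
  if N is N'.+1 then
    rfreq N' ++ [seq (p.1 + (9 ^ N')%N%:Z, p.2.+1) | p <- rfreq N']
             ++ [seq (p.1 - (9 ^ N')%N%:Z, p.2.+1) | p <- rfreq N']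
  else [:: (0, 0%N)].

Lemma rfreq_bound N p : p \in rfreq N -> (2 * `|p.1| < 9 ^ N)%N.
Proof.
elim: N p => [|N IH] [a m]; first by rewrite inE => /eqP[-> _].
rewrite /= !mem_cat => /or3P[/IH|/mapP[[b l] /IH + [-> _]]|/mapP[[b l] /IH + [-> _]]] /=;
  rewrite expnS; move: (9 ^ N)%N => X /= *; lia.
Qed.

(** The frequencies built so far have modulus below 9^N / 2, so their translates by 0, 9^N and -9^N
    are disjoint. *)
Lemma rfreq_uniq N : uniq [seq p.1 | p <- rfreq N].
Proof.
elim: N => // N IH; set X : int := (9 ^ N)%N%:Z.
have -> : [seq p.1 | p <- rfreq N.+1] = [seq p.1 | p <- rfreq N] ++
    [seq p.1 + X | p <- rfreq N] ++ [seq p.1 + - X | p <- rfreq N].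
  by rewrite /= !map_cat -!map_comp.
have U (a : int) : uniq [seq p.1 + a | p <- rfreq N].
  by rewrite (map_comp (fun x => x + a)) map_inj_uniq//; exact: addIr.
rewrite !cat_uniq IH !U /= andbT; apply/andP; split.
  apply/hasPn => x; rewrite mem_cat => xx; apply/mapP => -[[b l] /rfreq_bound /= qb /= xq].
  case/orP: xx => /mapP[[d i] /rfreq_bound /= rb] /=;
  by move: @X; move: (9 ^ N)%N qb rb xq => X /= *; lia.
apply/hasPn => x /mapP[[b l] /rfreq_bound /= rb ->]; apply/mapP => -[[d i] /rfreq_bound qb] /=.
by move: @X; move: (9 ^ N)%N qb rb => X /= *; lia.
Qed.

Lemma rfreq0 N : (0, 0%N) \in rfreq N.
Proof. by elim: N => // N IH; rewrite /= mem_cat IH. Qed.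

Lemma rfreq_eq0 N p : p \in rfreq N -> (p.1 == 0) = (p.2 == 0%N).
Proof.
elim: N p => [|N IH] [a m]; first by rewrite inE => /eqP[-> ->].
rewrite /= !mem_cat => /or3P[/IH//|/mapP[[b l] /rfreq_bound qb [-> ->]]|/mapP[[b l] /rfreq_bound qb [-> ->]]] /=;
  by move: (9 ^ N)%N qb => X /= *; lia.
Qed.

(** A generating function, in place of the count of C(N, m) 2^m frequencies with m non-zero
    digits. *)
Lemma rfreq_sum (T : comPzRingType) (x : T) N :
  \sum_(p <- rfreq N) x ^+ p.2 = (1 + 2 * x) ^+ N.
Proof.
elim: N => [|N IH]; first by rewrite /= big_seq1 !expr0.
rewrite /= !big_cat !big_map /= IH.
under [X in _ + (X + _)]eq_bigr do rewrite exprS.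
under [X in _ + (_ + X)]eq_bigr do rewrite exprS.
by rewrite -mulr_sumr IH exprSr; ring.
Qed.

End RieszFreq.

(** * Riesz products and means of products of quartic polynomials in lacunary cosines *)

Section Riesz.
Variable R : realType.
Local Notation C := R[i].
Local Notation ce := (ce R).
Implicit Types f g h F : cpf R.

Definition cosn n : cpf R := cc 2^-1 * (ce n + ce (- n)).

Lemma inv2C : (2^-1 : C) = (2^-1)%:C%C.
Proof. by rewrite fmorphV rmorph_nat. Qed.

Lemma cosnE n x : cosn n x = (cos (x *~ n))%:C%C.
Proof.
rewrite /cosn cpfM cpfD !ceE ccE mulrNz cosN sinN inv2C.
by apply/eqP; rewrite eq_complex; apply/andP; split; apply/eqP => /=; field.
Qed.

Lemma cosnM m n : cosn m * cosn n = cc 2^-1 * (cosn (m + n) + cosn (m - n)).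
Proof. by rewrite /cosn !opprD opprK !ceD; ring. Qed.
Lemma cosn0 : cosn 0 = 1.
Proof.
by apply: cpfP => x; rewrite cosnE mulr0z cos0 cpf1.
Qed.
Lemma cosnN n : cosn (- n) = cosn n.
Proof. by rewrite /cosn opprK addrC. Qed.

Definition spec (d : nat) f := forall n : int, (d < `|n|)%N -> coef f n = 0.

Lemma coef_cosn f m n :
  coef (f * cosn m) n = 2^-1 * (coef f (n - m) + coef f (n + m)).
Proof. by rewrite /cosn mulrCA coefZ mulrDr coefD !coefMe opprK. Qed.

Lemma M_cosn d f m : spec d f -> (d < `|m|)%N -> M (f * cosn m) = 0.
Proof.
move=> df dm; rewrite -coef0E coef_cosn sub0r add0r !df ?addr0 ?mulr0//.
by rewrite abszN.
Qed.

Lemma specD d f g : spec d f -> spec d g -> spec d (f + g).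
Proof. by move=> df dg n dn; rewrite coefD df// dg// addr0. Qed.
Lemma specZ d a f : spec d f -> spec d (cc a * f).
Proof. by move=> df n dn; rewrite coefZ df// mulr0. Qed.
Lemma spec_cosn d e f m : spec d f -> (d + `|m| <= e)%N -> spec e (f * cosn m).
Proof.
move=> df me n en; rewrite coef_cosn !df ?addr0 ?mulr0//; lia.
Qed.

(** Powers of the cosine are linearized because a function of low frequency, when paired with them,
    only sees the constant term. *)
Lemma quartic_cosn (a1 a2 a3 a4 : C) m (c := cosn m) :
  1 + cc a1 * c + cc a2 * c ^+ 2 + cc a3 * c ^+ 3 + cc a4 * c ^+ 4 =
  cc (1 + a2 / 2 + a4 * 3 / 8) + cc (a1 + a3 * 3 / 4) * cosn m +
  cc (a2 / 2 + a4 / 2) * cosn (m *+ 2) + cc (a3 / 4) * cosn (m *+ 3) +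
  cc (a4 / 8) * cosn (m *+ 4).
Proof.
have c2 : c ^+ 2 = cc 2^-1 * (1 + cosn (m *+ 2)).
  by rewrite expr2 cosnM subrr cosn0 -mulr2n; ring.
have c3 : c ^+ 3 = cc (3 / 4) * cosn m + cc 4^-1 * cosn (m *+ 3).
  rewrite exprS c2 mulrCA mulrDr mulr1 cosnM -mulrS.
  rewrite (_ : m - m *+ 2 = - m) ?cosnN; last by rewrite mulr2n opprD addNKr.
  have -> : (3 / 4 : C) = 2^-1 + 2^-1 * 2^-1 by field.
  have -> : (4^-1 : C) = 2^-1 * 2^-1 by field.
  by rewrite ccD !ccM /c; ring.
have c4 : c ^+ 4 = cc (3 / 8) + cc 2^-1 * cosn (m *+ 2) + cc 8^-1 * cosn (m *+ 4).
  rewrite (exprD c 2 2) !c2 mulrACA -ccM.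
  have -> : (1 + cosn (m *+ 2)) * (1 + cosn (m *+ 2)) =
     1 + cosn (m *+ 2) + cosn (m *+ 2) + cosn (m *+ 2) * cosn (m *+ 2) by ring.
  rewrite cosnM subrr cosn0 (_ : m *+ 2 + m *+ 2 = m *+ 4); last by rewrite -mulrnDr.
  have -> : (3 / 8 : C) = 2^-1 * 2^-1 * (1 + 2^-1) by field.
  have -> : (8^-1 : C) = 2^-1 * 2^-1 * 2^-1 by field.
  have e : (2^-1 : C) = 2^-1 * 2^-1 + 2^-1 * 2^-1 by field.
  by rewrite [X in _ + X * cosn (m *+ 2) + _](congr1 (@cc R) e) !(ccM, ccD) cc1; ring.
rewrite c2 c3 c4.
have -> : cc (1 + a2 / 2 + a4 * 3 / 8) = 1 + cc a2 * cc 2^-1 + cc a4 * cc (3 / 8).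
  by rewrite !ccD -mulrA !ccM cc1.
have -> : cc (a1 + a3 * 3 / 4) = cc a1 + cc a3 * cc (3 / 4).
  by rewrite ccD -mulrA !ccM.
by rewrite !ccD !ccM /c; ring.
Qed.

(** The frequencies of f are at most d < |m|, so the terms of frequency m, 2m, 3m and 4m have mean
    zero against f: with respect to [M], f and A are uncorrelated. *)
Lemma M_quartic d f m (a1 a2 a3 a4 : C) :
  spec d f -> (d < `|m|)%N ->
  let A := 1 + cc a1 * cosn m + cc a2 * cosn m ^+ 2 + cc a3 * cosn m ^+ 3 +
           cc a4 * cosn m ^+ 4 in
  M (f * A) = (1 + a2 / 2 + a4 * 3 / 8) * M f /\ spec (d + 4 * `|m|) (f * A).
Proof.
move=> df dm A; rewrite /A quartic_cosn.
have MfZ a n : (d < `|n|)%N -> M (f * (cc a * cosn n)) = 0.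
  by move=> dn; rewrite mulrCA MZ (M_cosn df)// mulr0.
have sfZ a n : (d + `|n| <= d + 4 * `|m|)%N -> spec (d + 4 * `|m|) (f * (cc a * cosn n)).
  by move=> dn; rewrite mulrCA; apply: specZ; exact: spec_cosn dn.
set b0 := 1 + _ + _; set b1 := a1 + _; set b2 := _ + a4 / 2.
rewrite !(mulrDr f); split.
  rewrite !MD !MfZ ?addr0; try lia.
  by rewrite mulrC MZ.
do 4 (apply: specD; last by apply: sfZ; lia).
by rewrite mulrC; apply: specZ => n dn; apply: df; lia.
Qed.

Lemma M_prod_quartic N (L : nat) (a1 a2 a3 a4 : C) : (0 < L)%N ->
  M (\prod_(k < N) (1 + cc a1 * cosn (L * 9 ^ k)%N
      + cc a2 * cosn (L * 9 ^ k)%N ^+ 2 + cc a3 * cosn (L * 9 ^ k)%N ^+ 3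
      + cc a4 * cosn (L * 9 ^ k)%N ^+ 4)) = (1 + a2 / 2 + a4 * 3 / 8) ^+ N.
Proof.
move=> L0; pose F (k : nat) := 1 + cc a1 * cosn (L * 9 ^ k)%N
      + cc a2 * cosn (L * 9 ^ k)%N ^+ 2 + cc a3 * cosn (L * 9 ^ k)%N ^+ 3
      + cc a4 * cosn (L * 9 ^ k)%N ^+ 4.
(* The induction carries the spectrum along. It stays strictly below L 9^N, whence the predecessor,
   and the next factor raises it to less than 5 L 9^N <= L 9^(N+1). *)
suff [] : M (\prod_(k < N) F k) = (1 + a2 / 2 + a4 * 3 / 8) ^+ N /\
   spec (L * 9 ^ N).-1 (\prod_(k < N) F k) by [].
elim: N => [|N [IH1 IH2]].
  rewrite big_ord0 M1 expr0; split=> // n; rewrite expn0 muln1 => Ln.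
  by rewrite -ce0 coef_ce; case: eqP => // n0; move: Ln; rewrite -n0; lia.
have LN : (0 < L * 9 ^ N)%N by rewrite muln_gt0 L0 expn_gt0.
rewrite big_ord_recr /=.
have [|H1 H2] := @M_quartic _ _ (L * 9 ^ N)%N a1 a2 a3 a4 IH2.
  by move: (L * 9 ^ N)%N LN => X *; lia.
split; first by rewrite H1 IH1 exprS.
move=> n; rewrite expnS mulnCA => nL; apply: H2; move: nL LN.
move: (L * 9 ^ N)%N => X *; lia.
Qed.

Definition riesz (s : R) (L N : nat) : cpf R :=
  \prod_(k < N) (1 + cc s%:C%C * cosn (L * 9 ^ k)%N).

Lemma rieszE s L N : riesz s L N =
  \sum_(p <- rfreq N) cc ((s / 2) ^+ p.2)%:C%C * ce (L%:Z * p.1).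
Proof.
elim: N => [|N IH].
  by rewrite /riesz big_ord0 /= big_seq1 expr0 mulr0 ce0 mulr1 cc1.
rewrite /riesz big_ord_recr /= -/(riesz s L N) IH !big_cat !big_map /= addrA.
rewrite mulrDr mulr1 -addrA; congr (_ + _).
rewrite -big_split mulr_suml; apply: eq_bigr => p _ /=.
rewrite /cosn PoszM mulrBr !(mulrDr L%:Z) !ceD exprS.
have -> : (s / 2 * (s / 2) ^+ p.2)%:C%C = s%:C%C * 2^-1 * ((s / 2) ^+ p.2)%:C%C.
  by rewrite inv2C !rmorphM.
by rewrite !ccM; ring.
Qed.

Lemma riesz_val s L N x :
  riesz s L N x = (\prod_(k < N) (1 + s * cos (x *~ (L * 9 ^ k)%N)))%:C%C.
Proof.
rewrite /riesz cpf_prod (rmorph_prod (real_complex R)); apply: eq_bigr => k _.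
rewrite cpfD cpfM ccE cosnE cpf1. by rewrite (rmorphD (real_complex R)) (rmorphM (real_complex R)).
Qed.

Definition trigavg (L N : nat) (x : R) : R :=
  (\sum_(k < N) cos (x *~ (L * 9 ^ k)%N)) / N%:R.

(** A polynomial majorant of e^(-y) turns the exponential moment of a Riesz product into the mean of
    a product of quartics, which is explicit. It comes from e^y >= (1 + y / 4)^4. *)
Lemma expR_quad (y : R) : `|y| <= 1 / 4 -> expR (- y) <= 1 - y + 3 / 4 * y ^+ 2.
Proof.
rewrite ler_norml => /andP[y1 y2].
have h : 1 + y / 4 <= expR (y / 4) by exact: expR_ge1Dx.
have h0 : 0 < 1 + y / 4 by lra.
have h4 : (1 + y / 4) ^+ 4 <= expR y.
  have -> : expR y = expR (y / 4) ^+ 4.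
    by rewrite -expRM_natl; congr expR; field.
  by rewrite ler_pXn2r// ?nnegrE ?expR_ge0// ltW.
rewrite expRN -[X in X <= _]mul1r ler_pdivrMr ?expR_gt0//.
apply: (@le_trans _ _ ((1 - y + 3 / 4 * y ^+ 2) * (1 + y / 4) ^+ 4)).
  rewrite -subr_ge0.
  have -> : (1 - y + 3 / 4 * y ^+ 2) * (1 + y / 4) ^+ 4 - 1 =
     y ^+ 2 * (1 / 8 + 7 / 16 * y + 57 / 256 * y ^+ 2 + 11 / 256 * y ^+ 3 + 3 / 1024 * y ^+ 4).
    by field.
  apply: mulr_ge0; first exact: sqr_ge0.
  have h1 : 0 <= y ^+ 2 * (57 / 256 + 11 / 256 * y) by apply: mulr_ge0; [exact: sqr_ge0|lra].
  have h2 : 0 <= (y ^+ 2) ^+ 2 by exact: sqr_ge0.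
  have -> : 1 / 8 + 7 / 16 * y + 57 / 256 * y ^+ 2 + 11 / 256 * y ^+ 3 + 3 / 1024 * y ^+ 4
     = 1 / 8 + 7 / 16 * y + y ^+ 2 * (57 / 256 + 11 / 256 * y) + 3 / 1024 * (y ^+ 2) ^+ 2.
    by ring.
  by move: h1 h2; move: (y ^+ 2 * _) ((y ^+ 2) ^+ 2) => u v *; lra.
rewrite ler_wpM2l//; have := sqr_ge0 y; move: (y ^+ 2) => u *; lra.
Qed.

End Riesz.

(** * Concentration of Riesz products and their signed averages *)

Section Block.
Variable R : realType.
Local Notation C := R[i].
Local Notation ce := (ce R).
Implicit Types f g h F : cpf R.

Lemma bessel_dom f h (v : R) (s : seq int) : uniq s ->
  (forall x, ((normc (f x)) ^+ 2)%:C%C <= h x) -> M h = v%:C%C ->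
  \sum_(n <- s) normc (coef f n) ^+ 2 <= v.
Proof.
move=> us fh Mh; rewrite -lecR -Mh.
have -> : (\sum_(n <- s) normc (coef f n) ^+ 2)%:C%C =
    \sum_(n <- s) `|coef f n| ^+ 2.
  rewrite (rmorph_sum (real_complex R)); apply: eq_bigr => n _.
  by rewrite normrcE -rmorphXn.
apply: le_trans (bessel f us) _; apply: le_M => x.
by rewrite cpfM cjE -normcX2.
Qed.

(* Chernoff bound: [h] is the product over k of
   be (1 + s c_k)^2 (1 - s c_k + 3/4 (s c_k)^2) with c_k = cos(L 9^k x), where the last
   factor dominates e^(-s c_k) and be dominates e^(s^2 / 32).  It has degree 4 in each
   c_k, so its mean factorizes because the frequencies grow in base 9. *)
Lemma riesz_tail (s : R) (L N : nat) : 0 < s <= 1 / 4 -> (0 < L)%N -> (0 < N)%N ->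
  exists h v, [/\ M h = v%:C%C, v <= (1 - s ^+ 2 / 16) ^+ N,
     (forall x, 0 <= h x) &
     forall x, trigavg L N x < s / 32 ->
       ((normc (riesz s L N x)) ^+ 2)%:C%C <= h x].
Proof.
move=> /andP[s0 s1] L0 N0.
have s20 : 0 < s ^+ 2 by rewrite exprn_gt0.
have s21 : s ^+ 2 <= 1 / 16.
  have -> : 1 / 16 = (1 / 4) ^+ 2 :> R by field.
  by rewrite ler_pXn2r// ?nnegrE ?ltW// divr_ge0.
pose be : R := (1 - s ^+ 2 / 32)^-1.
have be0 : 0 < be by rewrite invr_gt0; lra.
pose A (c : R) := (1 + s * c) ^+ 2 * (1 - s * c + 3 / 4 * (s * c) ^+ 2).
have Aexp c : `|c| <= 1 -> (1 + s * c) ^+ 2 * expR (- (s * c)) <= A c.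
  move=> c1; rewrite /A; apply: ler_wpM2l; first exact: sqr_ge0.
  apply: expR_quad; rewrite normrM (gtr0_norm s0).
  by rewrite (le_trans _ s1)// ler_piMr// ltW.
have A0 c : `|c| <= 1 -> 0 <= A c.
  by move=> c1; apply: le_trans (Aexp c c1); rewrite mulr_ge0 ?sqr_ge0 ?expR_ge0.
pose c (x : R) (k : nat) := cos (x *~ (L * 9 ^ k)%N%:Z).
have c1 x k : `|c x k| <= 1 by exact: cos_max.
(* The coefficients of c^2, c^3 and c^4 in [A c]; that of c is s. *)
pose a2 : C := (- (s ^+ 2 / 4))%:C%C. pose a3 : C := (s ^+ 3 / 2)%:C%C.
pose a4 : C := (3 / 4 * s ^+ 4)%:C%C.
pose h0 := \prod_(k < N) (1 + cc s%:C%C * cosn R (L * 9 ^ k)%N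
      + cc a2 * cosn R (L * 9 ^ k)%N ^+ 2 + cc a3 * cosn R (L * 9 ^ k)%N ^+ 3
      + cc a4 * cosn R (L * 9 ^ k)%N ^+ 4).
have h0E x : h0 x = (\prod_(k < N) A (c x k))%:C%C.
  rewrite /h0 cpf_prod (rmorph_prod (real_complex R)); apply: eq_bigr => k _.
  have cX f m y : (f ^+ m) y = f y ^+ m.
    by elim: m => // m IH; rewrite !exprS cpfM IH.
  rewrite !(cosnE, cX, cpfD, cpfM, ccE) cpf1 -/(c x k).
  rewrite /a2 /a3 /a4 -!(rmorphXn (real_complex R)) -!(rmorphM (real_complex R)) /=.
  have -> : (1 : C) = (1 : R)%:C%C by [].
  rewrite -!(rmorphD (real_complex R)); congr (_%:C%C); rewrite /A.
  by move: (c x k) => z; field.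
exists (cc (be ^+ N)%:C%C * h0), ((be * (1 - s ^+ 2 / 8 + 9 / 32 * s ^+ 4)) ^+ N).
split.
- rewrite MZ M_prod_quartic// exprMn rmorphM; congr (_ * _).
  rewrite rmorphXn; congr (_ ^+ _); rewrite /a2 /a4.
  have e2 : (2^-1 : C) = (2^-1)%:C%C by rewrite fmorphV rmorph_nat.
  have e3 : (3 : C) = 3%:C%C by rewrite rmorph_nat.
  have e8 : (8^-1 : C) = (8^-1)%:C%C by rewrite fmorphV rmorph_nat.
  rewrite e2 e3 e8 -!(rmorphM (real_complex R)) /=.
  have -> : (1 : C) = (1 : R)%:C%C by [].
  by rewrite -!(rmorphD (real_complex R)); congr (_%:C%C); field.
- have s4 : s ^+ 4 = s ^+ 2 * s ^+ 2 by rewrite -exprD.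
  rewrite ler_pXn2r// ?nnegrE.
  + rewrite /be mulrC ler_pdivrMr; last lra.
    rewrite s4; move: (s ^+ 2) s20 s21 => u u0 u1; nra.
  + rewrite mulr_ge0 ?(ltW be0)//; rewrite s4; move: (s ^+ 2) s20 s21 => u u0 u1; nra.
  + by lra.
- move=> x; rewrite cpfM ccE h0E -rmorphM ler0c mulr_ge0//.
    by rewrite exprn_ge0// ltW.
  by apply: prodr_ge0 => k _; exact: A0.
move=> x tx; rewrite riesz_val normcR real_normK ?num_real//.
rewrite cpfM ccE h0E -rmorphM lecR -prodrXl.
have sumc : \sum_(k < N) c x k <= N%:R * (s / 32).
  by move: tx; rewrite /trigavg ltr_pdivrMr ?ltr0n// mulrC => /ltW.
have e1 : 1 <= \prod_(k < N) (be * expR (- (s * c x k))).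
  apply: (@le_trans _ _ (\prod_(k < N) expR (s ^+ 2 / 32 - s * c x k))).
    rewrite -expR_sum -[X in X <= _]expR0 ler_expR sumrB sumr_const card_ord -mulr_sumr.
    rewrite subr_ge0; apply: le_trans (ler_wpM2l (ltW s0) sumc) _.
    by rewrite -[leRHS]mulr_natl mulrCA expr2 -(mulrA s s).
  apply: ler_prod => k _; rewrite expR_ge0/= expRD ler_wpM2r ?expR_ge0//.
  rewrite -[leLHS]invrK /be lef_pV2 ?posrE ?invr_gt0 ?expR_gt0//; last lra.
  by rewrite -expRN expR_ge1Dx.
apply: (@le_trans _ _ (\prod_(k < N) ((1 + s * c x k) ^+ 2 * (be * expR (- (s * c x k)))))).
  rewrite [leRHS]big_split /= -[X in X <= _]mulr1 ler_wpM2l//.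
  by apply: prodr_ge0 => k _; exact: sqr_ge0.
have -> : be ^+ N * \prod_(k < N) A (c x k) = \prod_(k < N) (be * A (c x k)).
  by rewrite [RHS]big_split /= prodr_const card_ord.
apply: ler_prod => k _; rewrite mulr_ge0 ?sqr_ge0 ?mulr_ge0 ?expR_ge0 ?(ltW be0)//=.
by rewrite mulrCA ler_wpM2l ?Aexp// ltW.
Qed.

(** The right side minus the left one, times the total weight, is a weighted sum of squares. It
    moves the square inside an average of Riesz products at the cost of one factor of the total
    mass. *)
Lemma jensen_sum (I : Type) (r : seq I) (a b : I -> R) :
  (forall i, 0 <= a i) -> 0 < \sum_(i <- r) a i ->
  (\sum_(i <- r) a i * b i) ^+ 2 <=
  (\sum_(i <- r) a i) * \sum_(i <- r) a i * b i ^+ 2.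
Proof.
move=> a0; set A := \sum_(i <- r) a i; set B := \sum_(i <- r) a i * b i.
set D := \sum_(i <- r) a i * b i ^+ 2 => A0.
have : 0 <= \sum_(i <- r) a i * (A * b i - B) ^+ 2.
  by apply: sumr_ge0 => i _; rewrite mulr_ge0 ?sqr_ge0.
have -> : \sum_(i <- r) a i * (A * b i - B) ^+ 2 = A * (A * D - B ^+ 2).
  transitivity (\sum_(i <- r) (A ^+ 2 * (a i * b i ^+ 2) - 2 * A * B * (a i * b i)
      + B ^+ 2 * a i)).
    by apply: eq_bigr => i _; ring.
  by rewrite big_split sumrB -!mulr_sumr -/A -/B -/D /=; ring.
by rewrite pmulr_rge0// subr_ge0.
Qed.

(** The parameters s_i = tau (m0 + i) / (2 m0) run through [tau / 2, tau], and [om m] is a multiple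
    of the m-th moment of the weights, hence zero for 0 < m <= m0. In the last clause [th] will be 1
    minus a cutoff: it lives where the average is below tau / 64 = (tau / 2) / 32, which is in the
    tail of every product involved. The factor 64^m0 is 8^m0 squared: the total mass enters once
    through [jensen_sum] and once through the sum over i. All estimates are uniform in L. *)
Lemma block (tau : R) (m0 : nat) : 0 < tau <= 1 / 4 -> (0 < m0)%N ->
  exists om : nat -> R,
  [/\ om 0%N = 1, (forall m, (0 < m <= m0)%N -> om m = 0),
      (forall m, `|om m| <= 8 ^+ m0 * (tau / 2) ^+ m) &
  forall N L, (0 < N)%N -> (0 < L)%N ->
  let w := \sum_(p <- rfreq N) cc (om p.2)%:C%C * ce (L%:Z * p.1) in
  (forall x, normc (w x) <= 8 ^+ m0 * 2 ^+ N) /\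
  (forall (th F : cpf R) (b : R) (s : seq int), (forall x, normc (F x) <= b) ->
     (forall x, normc (th x) <= 1) ->
     (forall x, tau / 64 <= trigavg L N x -> th x = 0) -> uniq s ->
   \sum_(n <- s) normc (coef (F * w * th) n) ^+ 2 <=
     b ^+ 2 * (64 ^+ m0 * (1 - tau ^+ 2 / 64) ^+ N))].
Proof.
move=> /andP[t0 t1] M0; have [nu [nu1 nu2 nu3]] := weights R M0.
have MR : 0 < (m0%:R : R) by rewrite ltr0n.
pose s (i : nat) := tau * (m0%:R + i%:R) / (2 * m0%:R).
have s_le i : (i < m0.+1)%N -> s i <= tau.
  move=> im; rewrite /s -mulrA ler_piMr ?(ltW t0)// ler_pdivrMr ?mulr_gt0//.
  by rewrite mul1r mulr2n mulrDl mul1r lerD2l ler_nat.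
have s_ge i : tau / 2 <= s i.
  have -> : s i = tau / 2 * ((m0%:R + i%:R) / m0%:R) by rewrite /s; field; rewrite gt_eqF.
  rewrite ler_pMr ?divr_gt0//.
  by rewrite ler_pdivlMr// mul1r lerDl.
have s_gt0 i : 0 < s i by rewrite (lt_le_trans _ (s_ge i))// divr_gt0.
pose om m := \sum_(i < m0.+1) nu i * (s i / 2) ^+ m.
exists om; split.
- by rewrite /om -nu1; apply: eq_bigr => i _; rewrite expr0 mulr1.
- move=> m mM; rewrite /om.
  transitivity ((tau / (4 * m0%:R)) ^+ m * \sum_(i < m0.+1) nu i * (m0%:R + i%:R) ^+ m).
    rewrite mulr_sumr; apply: eq_bigr => i _; rewrite mulrCA -exprMn; congr (_ * _ ^+ _).
    by rewrite /s; field; rewrite gt_eqF.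
  by rewrite nu2// mulr0.
- move=> m; rewrite (le_trans (ler_norm_sum _ _ _))//.
  apply: (@le_trans _ _ (\sum_(i < m0.+1) `|nu i| * (tau / 2) ^+ m)).
    apply: ler_sum => i _; rewrite normrM ler_wpM2l//.
    have si : s i / 2 <= tau / 2 by rewrite ler_wpM2r ?invr_ge0// s_le.
    have s2 : 0 < s i / 2 by rewrite divr_gt0.
    by rewrite normrX (gtr0_norm s2) lerXn2r// nnegrE ?(ltW s2)// divr_ge0 ?(ltW t0).
  by rewrite -mulr_suml ler_wpM2r// exprn_ge0// divr_ge0// ltW.
move=> N L N0 L0 w.
have wE : w = \sum_(i < m0.+1) cc (nu i)%:C%C * riesz (s i) L N.
  under eq_bigr do rewrite rieszE mulr_sumr.
  rewrite exchange_big /w; apply: eq_bigr => p _ /=.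
  under eq_bigr do rewrite mulrA -ccM -rmorphM.
  by rewrite -mulr_suml -raddf_sum -(raddf_sum (real_complex R)).
have A1 : 1 <= \sum_(i < m0.+1) `|nu i|.
  by rewrite -nu1 ler_sum// => i _; exact: ler_norm.
have wx x : normc (w x) <= \sum_(i < m0.+1) `|nu i| * normc (riesz (s i) L N x).
  rewrite wE cpf_sum (le_trans (normc_le_sum _ _ _))//; apply: ler_sum => i _.
  by rewrite cpfM ccE normcM normcR.
have rz2 i x : (i < m0.+1)%N -> normc (riesz (s i) L N x) <= 2 ^+ N.
  move=> im; rewrite riesz_val normcR normr_prod.
  apply: (@le_trans _ _ (\prod_(k < N) 2)); last by rewrite prodr_const card_ord.
  apply: ler_prod => k _; rewrite normr_ge0 (le_trans (ler_normD _ _))//.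
  rewrite normr1 -[2]/(1 + 1) lerD2l normrM gtr0_norm//.
  rewrite -[X in _ <= X]mulr1; apply: ler_pM => //; first exact: ltW.
    by rewrite (le_trans (s_le _ im))//; lra.
  exact: cos_max.
split.
  move=> x; rewrite (le_trans (wx x))//.
  apply: (@le_trans _ _ (\sum_(i < m0.+1) `|nu i| * 2 ^+ N)).
    by apply: ler_sum => i _; rewrite ler_wpM2l// rz2.
  by rewrite -mulr_suml ler_wpM2r// exprn_ge0.
move=> th F b sq Fb th1 th0 us.
have /choice [H HH] : forall i : 'I_m0.+1, exists hv : cpf R * R,
   [/\ M hv.1 = hv.2%:C%C, hv.2 <= (1 - s i ^+ 2 / 16) ^+ N,
     (forall x, 0 <= hv.1 x) &
     forall x, trigavg L N x < s i / 32 ->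
       ((normc (riesz (s i) L N x)) ^+ 2)%:C%C <= hv.1 x].
  move=> i; have [|h [v [h1 h2 h3 h4]]] := @riesz_tail (s i) L N _ L0 N0.
    by rewrite s_gt0 (le_trans (s_le _ _))//.
  by exists (h, v).
set V := \sum_(i < m0.+1) `|nu i| in A1.
have V0 : 0 <= V by rewrite (le_trans _ A1).
have b0 : 0 <= b by rewrite (le_trans _ (Fb 0))// normc_ge0.
pose h := cc (b ^+ 2 * V)%:C%C * \sum_(i < m0.+1) cc `|nu i|%:C%C * (H i).1.
pose v := b ^+ 2 * V * \sum_(i < m0.+1) `|nu i| * (H i).2.
have Mh : M h = v%:C%C.
  rewrite /h MZ raddf_sum /v [RHS](rmorphM (real_complex R)); congr (_ * _).
  rewrite (rmorph_sum (real_complex R)); apply: eq_bigr => i _.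
  by rewrite /= MZ [RHS](rmorphM (real_complex R)); have [-> _ _ _] := HH i.
apply: le_trans (bessel_dom us _ Mh) _; last first.
  rewrite /v -mulrA ler_wpM2l ?sqr_ge0//.
  have -> : 64 ^+ m0 = 8 ^+ m0 * 8 ^+ m0 :> R by rewrite -exprMn -natrM.
  rewrite -mulrA ler_pM//.
    apply: sumr_ge0 => i _; rewrite mulr_ge0// -ler0c; have [<- _ h0 _] := HH i.
    exact: M_ge0.
  apply: (@le_trans _ _ (\sum_(i < m0.+1) `|nu i| * (1 - tau ^+ 2 / 64) ^+ N)).
    apply: ler_sum => i _; rewrite ler_wpM2l//; have [_ h2 _ _] := HH i.
    have si2 : (tau / 2) ^+ 2 <= s i ^+ 2.
      apply: lerXn2r; [|by rewrite nnegrE ltW|exact: s_ge].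
      by rewrite nnegrE divr_ge0// ltW.
    have ti2 : s i ^+ 2 <= 1.
      apply: exprn_ile1; first exact: ltW.
      by apply: le_trans (s_le _ (ltn_ord i)) _; lra.
    apply: le_trans h2 _; move: si2; rewrite expr_div_n => si2.
    have tau4 : tau ^+ 2 / 2 ^+ 2 = tau ^+ 2 / 4 by rewrite -natrX.
    by apply: lerXn2r; rewrite ?nnegrE; move: si2 ti2; rewrite tau4;
      move: (s i ^+ 2) (tau ^+ 2) => u u1 *; lra.
  rewrite -mulr_suml ler_wpM2r// exprn_ge0//.
  have : tau ^+ 2 <= 1 by apply: exprn_ile1; [exact: ltW|lra].
  by move: (tau ^+ 2) => u *; lra.
have hx x : h x = (b ^+ 2 * V)%:C%C * \sum_(i < m0.+1) `|nu i|%:C%C * (H i).1 x.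
  rewrite /h cpfM ccE cpf_sum; congr (_ * _); apply: eq_bigr => i _.
  by rewrite cpfM ccE.
move=> x; rewrite hx; have [tx|tx] := leP (tau / 64) (trigavg L N x).
  rewrite cpfM th0// mulr0 normc0 expr0n mulr_ge0//.
    by rewrite ler0c mulr_ge0// sqr_ge0.
  apply: sumr_ge0 => i _; rewrite mulr_ge0 ?ler0c//.
  by have [_ _ h0 _] := HH i; exact: h0.
apply: (@le_trans _ _ ((b ^+ 2 * V)%:C%C * \sum_(i < m0.+1) `|nu i|%:C%C * ((normc (riesz (s i) L N x)) ^+ 2)%:C%C)); last first.
  rewrite ler_wpM2l ?ler0c ?mulr_ge0 ?sqr_ge0//; apply: ler_sum => i _.
  rewrite ler_wpM2l ?ler0c//; have [_ _ _ h0] := HH i; apply: h0.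
  by apply: lt_le_trans tx _; have := s_ge i; lra.
under eq_bigr do rewrite -rmorphM.
rewrite -(rmorph_sum (real_complex R)) -rmorphM lecR !cpfM !normcM -mulrA exprMn.
rewrite -[leRHS]mulrA; apply: ler_pM; [exact: sqr_ge0|exact: sqr_ge0| |].
  by apply: lerXn2r; rewrite ?nnegrE ?normc_ge0// (le_trans _ (Fb x))// normc_ge0.
apply: (@le_trans _ _ ((\sum_(i < m0.+1) `|nu i| * normc (riesz (s i) L N x)) ^+ 2)).
  apply: lerXn2r; rewrite ?nnegrE ?mulr_ge0 ?normc_ge0//.
    by apply: sumr_ge0 => i _; rewrite mulr_ge0 ?normc_ge0.
  by rewrite (le_trans _ (wx x))// ler_piMr ?normc_ge0.
by apply: jensen_sum => //; rewrite (lt_le_trans _ A1).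
Qed.

End Block.

(** * The inductive step *)

Section OrliczFacts.
Variable R : realType.
Variable phi : R -> R.
Hypothesis phi_orlicz : orlicz_function phi.
Hypothesis phi_nondegenerate : ~ degenerate phi.
Hypothesis phi_small : phi t / t ^+ 2 @[t --> 0^'+] --> (0 : R).
Hypothesis phi_submult : submultiplicative_at_zero phi.

Lemma phi_mono s t : 0 <= s -> s <= t -> phi s <= phi t.
Proof.
move=> s0 st; apply: (orlicz_nondecreasing phi_orlicz) => //;
  by rewrite in_itv /= andbT// (le_trans s0).
Qed.
Lemma phi0 : phi 0 = 0. Proof. exact: orlicz0. Qed.
Lemma phi_ge0 t : 0 <= t -> 0 <= phi t.
Proof. by move=> t0; rewrite -phi0 phi_mono. Qed.
Lemma phi_gt0 t : 0 < t -> 0 < phi t.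
Proof.
move=> t0; rewrite lt_neqAle phi_ge0 ?ltW// andbT eq_sym; apply/eqP => p0.
by apply: phi_nondegenerate; exists t.
Qed.
Lemma phi_conv (l a b : R) : 0 <= l <= 1 -> 0 <= a -> 0 <= b ->
  phi (l * a + (1 - l) * b) <= l * phi a + (1 - l) * phi b.
Proof.
move=> l01 a0 b0.
have := @orlicz_convex _ _ phi_orlicz (Itv01 (proj1 (andP l01)) (proj2 (andP l01))) a b.
rewrite !inE /= !in_itv /= !andbT => /(_ a0 b0).
by [].
Qed.

(** The midpoint of 2a and 2b is a + b. The doubled argument is why the coefficients [om] are later
    estimated with a factor 2. *)
Lemma phi_half a b : 0 <= a -> 0 <= b ->
  phi (a + b) <= phi (2 * a) / 2 + phi (2 * b) / 2.
Proof.
move=> a0 b0.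
have := @phi_conv (1 / 2) (2 * a) (2 * b).
have -> : 1 / 2 * (2 * a) + (1 - 1 / 2) * (2 * b) = a + b by field.
have -> : 1 / 2 * phi (2 * a) + (1 - 1 / 2) * phi (2 * b) =
  phi (2 * a) / 2 + phi (2 * b) / 2 by field.
by apply; rewrite ?mulr_ge0//; apply/andP; split; lra.
Qed.

Lemma phi_sq (k : R) : 0 < k -> exists2 t1, 0 < t1 &
  forall t, 0 <= t < t1 -> phi t <= k * t ^+ 2.
Proof.
move=> k0; have /cvgrPdist_lt/(_ k k0) := phi_small.
move=> [d /= d0 H]; exists d => // t /andP[t0 td].
have [->|tn0] := eqVneq t 0; first by rewrite phi0 expr0n mulr0.
have tp : 0 < t by rewrite lt_neqAle eq_sym tn0.
have := H t; rewrite /= sub0r normrN gtr0_norm// => /(_ td tp).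
rewrite sub0r normrN ger0_norm; last by rewrite divr_ge0 ?phi_ge0// sqr_ge0.
by rewrite ltr_pdivrMr ?exprn_gt0// => /ltW.
Qed.

(** The point a + e is the convex combination of a and 2 (a + e) with weight e / (a + 2 e) on the
    latter, where phi is at most the square. *)
Lemma phi_lip (t1 a e : R) : (forall t, 0 <= t < t1 -> phi t <= t ^+ 2) ->
  0 <= a -> 0 <= e -> 2 * (a + e) < t1 ->
  phi (a + e) <= phi a + 4 * e * (a + e).
Proof.
move=> H a0 e0 ae.
have [->|en0] := eqVneq e 0; first by rewrite !addr0 mulr0 mul0r addr0.
have ep : 0 < e by rewrite lt_neqAle eq_sym en0.
have d0 : 0 < a + 2 * e by lra.
pose l := (a + e) / (a + 2 * e).
have l01 : 0 <= l <= 1.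
  rewrite /l; apply/andP; split; first by rewrite divr_ge0; lra.
  by rewrite ler_pdivrMr// mul1r; lra.
have := @phi_conv l a (2 * (a + e)) l01 a0.
have -> : l * a + (1 - l) * (2 * (a + e)) = a + e.
  by rewrite /l; field; rewrite gt_eqF.
move=> /(_ _)/le_trans; apply; first by lra.
have l1 : 1 - l = e / (a + 2 * e) by rewrite /l; field; rewrite gt_eqF.
apply: lerD.
  by rewrite -[X in _ <= X]mul1r ler_wpM2r ?phi_ge0//; case/andP: l01.
apply: (@le_trans _ _ (e / (a + 2 * e) * (2 * (a + e)) ^+ 2)).
  rewrite l1 ler_wpM2l ?divr_ge0//; last by apply: H; rewrite ae andbT; lra.
  by lra.
rewrite mulrAC ler_pdivrMr//.
have -> : e * (2 * (a + e)) ^+ 2 = 4 * (e * ((a + e) * (a + e))) by ring.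
have -> : 4 * e * (a + e) * (a + 2 * e) = 4 * (e * ((a + e) * (a + 2 * e))) by ring.
by rewrite ler_wpM2l// ler_wpM2l// ler_wpM2l//; lra.
Qed.

Lemma phi_subm : exists A t0, [/\ 1 <= A, 0 < t0 &
  forall s t, 0 <= s < t0 -> 0 <= t < t0 -> phi (s * t) <= A * (phi s * phi t)].
Proof.
have [A [t0 [t00 H]]] := phi_submult.
exists (Num.max 1 A), t0; split => //; first by rewrite le_max lexx.
move=> s t /andP[s0 st] /andP[tt0 tt].
have [->|sn0] := eqVneq s 0; first by rewrite mul0r phi0 mul0r mulr0.
have [->|tn0] := eqVneq t 0; first by rewrite mulr0 phi0 !mulr0.
have sp : 0 < s by rewrite lt_neqAle eq_sym sn0.
have tp : 0 < t by rewrite lt_neqAle eq_sym tn0.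
apply: le_trans (H s t _ _) _; rewrite ?sp ?tp//.
rewrite -mulrA ler_wpM2r ?mulr_ge0 ?phi_ge0//.
by rewrite le_max lexx orbT.
Qed.

Lemma phi_pow (A t0 u : R) m : 1 <= A ->
  (forall s t, 0 <= s < t0 -> 0 <= t < t0 -> phi (s * t) <= A * (phi s * phi t)) ->
  0 <= u < t0 -> u <= 1 -> phi (u ^+ m.+1) <= (A * phi u) ^+ m.+1.
Proof.
move=> A1 HA /andP[u0 ut] u1; have A0 : 0 <= A by lra.
elim: m => [|m IH]; first by rewrite !expr1 -[X in X <= _]mul1r ler_wpM2r ?phi_ge0.
rewrite exprS [X in _ <= X]exprS; apply: le_trans (HA _ _ _ _) _.
- by rewrite u0.
- by rewrite exprn_ge0//= (le_lt_trans _ ut)// exprS ler_piMr// exprn_ile1.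
- by rewrite mulrA ler_wpM2l// mulr_ge0 ?phi_ge0.
Qed.

Lemma bernoulli_ge (x : R) n : 0 <= x -> 1 + n%:R * x <= (1 + x) ^+ n.
Proof.
move=> x0; elim: n => [|n IH]; first by rewrite expr0 mul0r addr0.
rewrite exprS; apply: (@le_trans _ _ ((1 + x) * (1 + n%:R * x))).
  rewrite -natr1; have : 0 <= n%:R * x * x by rewrite !mulr_ge0.
  by rewrite !mulrDl !mulrDr !mul1r !mulr1 mulrA (mulrC x n%:R) => ?; lra.
by rewrite ler_wpM2l//; lra.
Qed.
Lemma bernoulli_le (x : R) n : 0 <= x <= 1 -> 1 - n%:R * x <= (1 - x) ^+ n.
Proof.
move=> /andP[x0 x1]; elim: n => [|n IH]; first by rewrite expr0 mul0r subr0.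
rewrite exprS; apply: (@le_trans _ _ ((1 - x) * (1 - n%:R * x))).
  rewrite -natr1; have : 0 <= n%:R * x * x by rewrite !mulr_ge0.
  rewrite (_ : (1 - x) * _ = 1 - (n%:R + 1) * x + n%:R * x * x); last by ring.
  by lra.
by rewrite ler_wpM2l//; lra.
Qed.

(** It converts Bernoulli's lower bound for one of the powers (1 + x)^n, (1 - x)^n into an upper
    bound for the other. *)
Lemma prod_pow_le1 (x : R) n : 0 <= x <= 1 -> (1 + x) ^+ n * (1 - x) ^+ n <= 1.
Proof.
move=> /andP[x0 x1]; rewrite -exprMn; apply: exprn_ile1.
  by apply: mulr_ge0; lra.
by rewrite mulrC -subr_sqr expr1n; have := sqr_ge0 x; lra.
Qed.
Lemma pow1D_le2 (x : R) n : 0 <= x <= 1 -> n%:R * x <= 1 / 2 -> (1 + x) ^+ n <= 2.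
Proof.
move=> x01 nx; have b := bernoulli_le n x01.
have c := prod_pow_le1 n x01.
have d : 0 <= (1 + x) ^+ n by rewrite exprn_ge0//; case/andP: x01 => *; lra.
have b2 : 1 / 2 <= (1 - x) ^+ n by lra.
have : (1 + x) ^+ n * (1 / 2) <= 1 by apply: le_trans c; rewrite ler_wpM2l.
by lra.
Qed.
Lemma pow1B_le (x : R) n : 0 <= x <= 1 -> 127 <= n%:R * x -> (1 - x) ^+ n <= 1 / 128.
Proof.
move=> x01 nx; have b := bernoulli_ge n (proj1 (andP x01)).
have c := prod_pow_le1 n x01.
have d : 0 <= (1 - x) ^+ n by rewrite exprn_ge0//; case/andP: x01 => *; lra.
have b2 : 128 <= (1 + x) ^+ n by lra.
have : 128 * (1 - x) ^+ n <= 1 by apply: le_trans c; rewrite ler_wpM2r.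
by lra.
Qed.

(** Put u = 4 tau and y = A phi(u). Submultiplicativity gives phi (2 |om m|) <= y^m for m > m0, and
    summation over the frequencies costs at most (1 + 8 y)^(r m0). The tail estimate needs r of
    order 1 / tau^2. Both demands are met because phi(u) <= k u^2 with k as small as desired.
    Neither tau nor r depends on m0. *)
Lemma riesz_params (A t0 : R) : 1 <= A -> 0 < t0 ->
  (forall s t, 0 <= s < t0 -> 0 <= t < t0 -> phi (s * t) <= A * (phi s * phi t)) ->
  exists (tau : R) (r : nat), [/\ 0 < tau <= 1 / 4, (0 < r)%N &
  forall (m0 : nat) (om : nat -> R), (0 < m0)%N ->
   (forall m, (0 < m <= m0)%N -> om m = 0) ->
   (forall m, `|om m| <= 8 ^+ m0 * (tau / 2) ^+ m) ->
   [/\ \sum_(p <- rfreq (r * m0) | p.1 != 0) phi (2 * `|om p.2|) <= 2^-1 ^+ m0,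
       64 ^+ m0 * (1 - tau ^+ 2 / 64) ^+ (r * m0) <= 2^-1 ^+ m0,
       (forall m, (0 < m)%N -> `|om m| <= 2^-1 ^+ m0) &
       (forall m, (0 < m)%N -> 2 * `|om m| < t0)]].
Proof.
move=> A1 t00 HA; have A0 : 0 < A by lra.
(* Since r tau^2 <= 64 * 128 and y <= 16 tau^2 / K, this value gives r y <= 1 / 16, hence r (8 y) <=
   1 / 2 as [pow1D_le2] requires. *)
have [K K0 KE] : exists2 K : R, 0 < K & K = 256 * (64 * 128).
  exists (256 * (64 * 128)); last by [].
  by apply: mulr_gt0; [|apply: mulr_gt0]; rewrite ltr0n.
pose k : R := (K * A)^-1.
have k0 : 0 < k by rewrite invr_gt0 mulr_gt0.
have [t1 t10 Ht1] := phi_sq k0.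
pose u : R := Num.min (Num.min t0 t1) 1 / 2.
have u0 : 0 < u by rewrite divr_gt0// !lt_min t00 t10 ltr01.
have ule : 2 * u = Num.min (Num.min t0 t1) 1 by rewrite /u; field.
have ut0 : 2 * u <= t0 by rewrite ule !ge_min lexx.
have ut1 : 2 * u <= t1 by rewrite ule !ge_min lexx orbT.
have u1 : 2 * u <= 1 by rewrite ule ge_min lexx orbT.
pose tau := u / 4; pose q := tau ^+ 2 / 64.
have t20 : 0 < tau ^+ 2 by rewrite exprn_gt0// divr_gt0.
have t21 : tau ^+ 2 <= 1 by apply: exprn_ile1; rewrite /tau; lra.
(* Then r tau^2 / 64 >= 127, and [pow1B_le] yields (1 - tau^2 / 64)^r <= 1 / 128, which beats 64
   with a factor 2 to spare. *)
pose r := (Num.truncn (64 * 127 / tau ^+ 2)).+1.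
have /andP[r1 r2] : r.-1%:R <= 64 * 127 / tau ^+ 2 < r%:R by apply: truncn_itv; rewrite divr_ge0// ltW.
have [y yE] : exists y, y = A * phi u by exists (A * phi u).
have y0 : 0 <= y by rewrite yE mulr_ge0 ?phi_ge0 ?ltW.
have yle : y <= tau ^+ 2 * (16 / K).
  have : phi u <= k * u ^+ 2 by apply: Ht1; rewrite ltW//=; lra.
  move=> /(ler_wpM2l (ltW A0)); rewrite -yE => /le_trans; apply.
  rewrite le_eqVlt; apply/orP; left; apply/eqP; rewrite /k /tau; field.
  by rewrite !gt_eqF.
have rle : r%:R * tau ^+ 2 <= 64 * 128.
  have : r%:R <= 64 * 127 / tau ^+ 2 + 1 by rewrite /r -natr1 lerD2r.
  move=> /(ler_wpM2r (ltW t20)) /le_trans; apply.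
  by rewrite mulrDl mulfVK ?gt_eqF// mul1r; lra.
exists tau, r; split => //.
  by rewrite /tau; apply/andP; split; lra.
move=> m0 om m00 om0 omb.
(* As u = 8 (tau / 2), the mass 8^m0 and the factor 2 are both covered by 8^m once m > m0. *)
have om2 m : (0 < m)%N -> 2 * `|om m| <= u ^+ m.
  move=> mp; have [mm|mm] := leqP m m0.
    by rewrite om0 ?mp// normr0 mulr0 exprn_ge0// ltW.
  apply: (@le_trans _ _ (2 * (8 ^+ m0 * (tau / 2) ^+ m))).
    by rewrite ler_wpM2l.
  have -> : u ^+ m = 8 ^+ m * (tau / 2) ^+ m.
    by rewrite -exprMn; congr (_ ^+ _); rewrite /tau; field.
  rewrite mulrA ler_wpM2r//; first by rewrite exprn_ge0// /tau; lra.
  rewrite -(subnKC mm) exprD exprS -[leLHS]mulr1; apply: ler_pM => //.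
  - by rewrite ler_wpM2r ?exprn_ge0// ler_nat.
  - by rewrite exprn_ege1// ler1n.
have ule1 m : (0 < m)%N -> u ^+ m <= u.
  by case: m => // m _; rewrite exprS ler_piMr ?(ltW u0)// exprn_ile1 ?(ltW u0)//; lra.
split.
(* Only m > m0 contributes, so a factor 4^(m - m0) >= 1 can be inserted; the sum is then extended to
   all frequencies and evaluated by [rfreq_sum]. *)
- have p2 : \sum_(p <- rfreq (r * m0) | p.1 != 0) phi (2 * `|om p.2|) <=
     \sum_(p <- rfreq (r * m0)) 4^-1 ^+ m0 * (4 * y) ^+ p.2.
    rewrite big_seq_cond [leRHS](bigID (fun p => p.1 != 0)) /=.
    rewrite [X in _ <= X + _]big_seq_cond -[leLHS]addr0; apply: lerD; last first.
      by apply: sumr_ge0 => p _; rewrite mulr_ge0// exprn_ge0 ?invr_ge0// mulr_ge0.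
    apply: ler_sum => -[a m] /andP[pm]; rewrite /= (rfreq_eq0 pm) /= -lt0n => mp.
    have [mm|mm] := leqP m m0.
      by rewrite om0 ?mp// normr0 mulr0 phi0 mulr_ge0// exprn_ge0 ?invr_ge0// mulr_ge0.
    apply: (@le_trans _ _ (y ^+ m)).
      apply: (@le_trans _ _ (phi (u ^+ m))); first by apply: phi_mono; rewrite ?mulr_ge0// om2.
      case: m mp {pm mm} => // m _; rewrite yE; apply: phi_pow A1 HA _ _; last by lra.
      by rewrite (ltW u0)/=; lra.
    rewrite exprMn mulrA -[leLHS]mul1r ler_wpM2r ?exprn_ge0//.
    rewrite exprVn mulrC ler_pdivlMr ?exprn_gt0// mul1r.
    by rewrite ler_weXn2l ?ler1n// ltnW.
  apply: le_trans p2 _; rewrite -mulr_sumr rfreq_sum exprM -exprMn.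
  have x0 : 0 <= 2 * (4 * y) by rewrite !mulr_ge0.
  have rx : r%:R * (2 * (4 * y)) <= 1 / 2.
    have h : r%:R * y <= r%:R * (tau ^+ 2 * (16 / K)) by rewrite ler_wpM2l.
    have h2 : r%:R * (tau ^+ 2 * (16 / K)) <= 1 / 16.
      rewrite mulrA [_ * (16 / K)]mulrA ler_pdivrMr// KE.
      by move: rle; move: (r%:R * tau ^+ 2) => z *; lra.
    have -> : r%:R * (2 * (4 * y)) = 8 * (r%:R * y) by ring.
    by move: h h2; move: (r%:R * y) (r%:R * (_ * _)) => v w *; lra.
  have x1 : 2 * (4 * y) <= 1.
    apply: (@le_trans _ _ (r%:R * (2 * (4 * y)))); last by lra.
    by rewrite ler_peMl// ler1n.
  have xr : (1 + 2 * (4 * y)) ^+ r <= 2 by apply: pow1D_le2 => //; rewrite x0.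
  rewrite lerXn2r ?nnegrE//.
    by rewrite mulr_ge0 ?invr_ge0// exprn_ge0// addr_ge0.
  by apply: (@le_trans _ _ (4^-1 * 2)); [rewrite ler_wpM2l|lra].
- have q01 : 0 <= q <= 1 by rewrite /q; apply/andP; split; lra.
  have q127 : 127 <= r%:R * q.
    have : 64 * 127 < r%:R * tau ^+ 2 by rewrite -ltr_pdivrMr.
    by rewrite /q mulrA => *; lra.
  rewrite exprM -exprMn lerXn2r ?nnegrE ?invr_ge0//.
    by rewrite mulr_ge0// exprn_ge0// subr_ge0; case/andP: q01.
  rewrite mulrC -ler_pdivlMr//; apply: le_trans (pow1B_le q01 q127) _.
  by lra.
- move=> m mp; have [mm|mm] := leqP m m0.
    by rewrite om0 ?mp// normr0 exprn_ge0// invr_ge0.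
  apply: (@le_trans _ _ (2 * `|om m|)); first by rewrite ler_peMl// ler1n.
  apply: (@le_trans _ _ (u ^+ m)); first exact: om2.
  apply: (@le_trans _ _ (2^-1 ^+ m)).
    by rewrite lerXn2r ?nnegrE ?(ltW u0)//; lra.
  by rewrite ler_wiXn2l ?(ltnW mm)//; lra.
- move=> m mp; apply: (@le_lt_trans _ _ u); last by lra.
  exact: le_trans (om2 m mp) (ule1 m mp).
Qed.

End OrliczFacts.

(** * Cutoffs, and coefficients moved to disjoint places *)

Section Step.
Variable R : realType.
Local Notation C := R[i].
Local Notation ce := (ce R).
Local Notation tau2 := (@trigo.pi R *+ 2).
Implicit Types f g h F : cpf R.

Lemma trigavgE (L N : nat) (x : R) :
  trigavg L N x = complex.Re ((cc N%:R^-1 * \sum_(k < N) cosn R (L * 9 ^ k)%N) x).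
Proof.
rewrite cpfM ccE cpf_sum /trigavg.
under [in RHS]eq_bigr do rewrite cosnE.
have -> : (N%:R^-1 : C) = (N%:R^-1)%:C%C by rewrite fmorphV rmorph_nat.
by rewrite -(rmorph_sum (real_complex R)) -(rmorphM (real_complex R)) /= mulrC.
Qed.

Lemma trigavg_cont L N : continuous (trigavg L N : R -> R).
Proof.
have := @cpf_contRe _ (cc N%:R^-1 * \sum_(k < N) cosn R (L * 9 ^ k)%N).
by under eq_fun do rewrite -trigavgE.
Qed.

Lemma trigavg_per (L N : nat) (x : R) : trigavg L N (x + tau2) = trigavg L N x.
Proof. by rewrite !trigavgE cpf_per. Qed.

Lemma real_cpf (g : R -> R) : continuous g -> (forall x, g (x + tau2) = g x) ->
  exists f, forall x, f x = (g x)%:C%C.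
Proof.
move=> cg pg.
have H2 : continuous (fun x : R => complex.Im (g x)%:C%C) by move=> x; exact: cvg_cst.
have H3 x : (g (x + tau2))%:C%C = (g x)%:C%C by rewrite pg.
by exists (@mk_cpf R (fun x => (g x)%:C%C) cg H2 H3).
Qed.

Lemma clamp_cpf (u : R -> R) : continuous u -> (forall x, u (x + tau2) = u x) ->
  exists th : cpf R, [/\ forall x, u x <= 0 -> th x = 0, forall x, 1 <= u x -> th x = 1,
    forall x, normc (th x) <= 1 & forall x, normc (1 - th x) <= 1].
Proof.
(* This is [u] clamped to [0, 1], written with absolute values so that continuity is immediate. *)
move=> cu pu; pose g (x : R) : R := (`|u x| - `|u x - 1| + 1) / 2.
have [||f fE] := @real_cpf g.
- move=> x; apply: cvgM; last exact: cvg_cst.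
  apply: cvgD; last exact: cvg_cst.
  apply: cvgB; apply: cvg_norm; first exact: cu.
  by apply: cvgB; [exact: cu|exact: cvg_cst].
- by move=> x; rewrite /g pu.
have g01 x : 0 <= g x <= 1.
  rewrite /g; move: (u x) => v.
  have := ler_distD 0 v 1; have := ler_distD 1 v 0; have := ler_distD v 1 0.
  have := ler_normD (v - 1) 1; have := ler_normB 1 v; rewrite subrK !subr0 sub0r normrN normr1 (distrC 1).
  by move=> *; apply/andP; split; lra.
exists f; split => x.
- move=> h; rewrite fE /g !ler0_norm//; last by lra.
  by rewrite (_ : (- u x - - (u x - 1) + 1) / 2 = 0)//; field.
- move=> h; rewrite fE /g !ger0_norm; [|by lra|by lra].
  by rewrite (_ : (u x - (u x - 1) + 1) / 2 = 1)//; field.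
- by rewrite fE normcR; have /andP[? ?] := g01 x; rewrite ger0_norm.
- have -> : 1 - f x = (1 - g x)%:C%C by rewrite fE rmorphB.
  by rewrite normcR; have /andP[? ?] := g01 x; rewrite ger0_norm; lra.
Qed.

Lemma cutoff (L N : nat) (d : R) : 0 < d -> exists th : cpf R,
  [/\ forall x, trigavg L N x <= d -> th x = 0,
      forall x, 2 * d <= trigavg L N x -> th x = 1,
      forall x, normc (th x) <= 1 & forall x, normc (1 - th x) <= 1].
Proof.
move=> d0; have [||th [t0 t1 tn tn']] := @clamp_cpf (fun x => (trigavg L N x - d) / d).
- move=> x; apply: cvgM; last exact: cvg_cst.
  by apply: cvgB; [exact: trigavg_cont|exact: cvg_cst].
- by move=> x; rewrite trigavg_per.
exists th; split => // x h.
  by apply: t0; rewrite pmulr_lle0 ?invr_gt0// subr_le0.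
by apply: t1; rewrite ler_pdivlMr// mul1r; lra.
Qed.

Lemma sum_single (T : eqType) (V : nmodType) (r : seq T) (P : pred T) (c : T -> V) :
  uniq r -> (forall p q, p \in r -> q \in r -> c p != 0 -> c q != 0 -> p = q) ->
  \sum_(p <- r | P p) c p = 0 \/
  exists p, [/\ p \in r, P p & \sum_(p <- r | P p) c p = c p].
Proof.
move=> ur H.
have [/hasP[p pr /andP[Pp cp]]|/hasPn Hn] := boolP (has (fun p => P p && (c p != 0)) r).
  right; exists p; split => //; rewrite (big_rem p)//= Pp.
  rewrite big_seq_cond big1 ?addr0// => q /andP[]; rewrite mem_rem_uniq// !inE.
  move=> /andP[qp qr] _; apply/eqP; apply: contraNT qp => cq.
  by rewrite (H _ _ qr pr cq cp).
left; rewrite big_seq_cond big1// => q /andP[qr Pq].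
by have := Hn q qr; rewrite Pq /= negbK => /eqP.
Qed.

Lemma half_pow (x : R) : 0 < x -> exists m, (0 < m)%N /\ 2^-1 ^+ m <= x.
Proof.
move=> x0; pose m := (Num.truncn (x^-1)).+1.
have xm : x^-1 < m%:R.
  have x1 : 0 <= x^-1 by rewrite invr_ge0 ltW.
  by have /andP[] := truncn_itv x1.
exists m; split => //.
rewrite exprVn -[leRHS]invrK lef_pV2 ?posrE ?invr_gt0 ?exprn_gt0//.
rewrite (le_trans (ltW xm))//.
have := bernoulli_ge m (@ler01 R); rewrite mulr1 -[1 + 1]/2 => /(le_trans _); apply.
by rewrite lerDr.
Qed.

Lemma pos_mul_le (a x : R) : 0 <= a -> 0 < x ->
  exists2 y, 0 < y & forall z, z <= y -> a * z <= x.
Proof.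
move=> a0 x0; exists (x / (a + 1)); first by rewrite divr_gt0// ltr_wpDl.
move=> z zy; apply: (@le_trans _ _ (a * (x / (a + 1)))); first by rewrite ler_wpM2l.
by rewrite mulrCA ler_piMr ?(ltW x0)// ler_pdivrMr ?ltr_wpDl// mul1r lerDl.
Qed.

Variable phi : R -> R.
Hypothesis phi_orlicz : orlicz_function phi.
Hypothesis phi_small : phi t / t ^+ 2 @[t --> 0^'+] --> (0 : R).
Hypothesis phi_submult : submultiplicative_at_zero phi.

(** Only finite sets of frequencies occur, so the bound passes to pointwise limits of the
    coefficients. *)
Definition modular_le (a : int -> C) (B : R) : Prop :=
  forall s : seq int, uniq s -> \sum_(n <- s) phi (normc (a n)) <= B.

(** The spectrum of F lies strictly within distance d of 0 and L >= 2 d, so its translates by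
    multiples of L are disjoint and at most one of them contains n. *)
Lemma shift_single (om : nat -> R) (r : seq (int * nat)) F (d L : nat) (n : int) :
  (2 * d <= L)%N ->
  (forall n : int, (d <= `|n|)%N -> coef F n = 0) -> uniq [seq p.1 | p <- r] ->
  let S := \sum_(p <- r | p.1 != 0) (om p.2)%:C%C * coef F (n - L%:Z * p.1) in
  S = 0 \/ exists p, [/\ p \in r, p.1 != 0 &
    S = (om p.2)%:C%C * coef F (n - L%:Z * p.1)].
Proof.
move=> dL Fd ur; apply: sum_single; first exact: map_uniq ur.
have lt_d p : (om p.2)%:C%C * coef F (n - L%:Z * p.1) != 0 ->
    (absz (n - L%:Z * p.1)%R < d)%N.
  by move=> cp; rewrite ltnNge; apply: contra cp => /Fd ->; rewrite mulr0.
move=> p q pr qr /lt_d np /lt_d nq.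
have p1q1 : p.1 = q.1.
  case: p q np nq {pr qr} => [a i] [b j] /= np nq.
  apply/eqP; apply: contraT => ab.
  have : (L <= absz (L%:Z * (a - b))%R)%N.
    by rewrite abszM absz_nat leq_pmulr// absz_gt0 subr_eq0.
  by rewrite mulrBr; move: (L%:Z * a) (L%:Z * b) np nq => u v *; lia.
have [i ir ip] : exists2 i, (i < size r)%N & nth p r i = p.
  by exists (index p r); rewrite ?index_mem ?nth_index.
have [j jr jq] : exists2 j, (j < size r)%N & nth p r j = q.
  by exists (index q r); rewrite ?index_mem ?nth_index.
have sz k : (k < size r)%N -> (k < size [seq p.1 | p <- r])%N by rewrite size_map.
have := nth_uniq 0 (sz i ir) (sz j jr) ur.
rewrite !(nth_map p)// ip jq p1q1 eqxx => /esym/eqP ij.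
by rewrite -ip ij.
Qed.

(** For each n at most one summand is non-zero, so phi of the sum is bounded by a sum of values of
    phi, and submultiplicativity separates the coefficients [om] from those of F. *)
Lemma coef_shift_sum (A t0 B : R) (om : nat -> R) (r : seq (int * nat)) F (d L : nat)
    (s : seq int) :
  (forall s t, 0 <= s < t0 -> 0 <= t < t0 -> phi (s * t) <= A * (phi s * phi t)) ->
  0 <= A -> (2 * d <= L)%N ->
  (forall n : int, (d <= `|n|)%N -> coef F n = 0) ->
  (forall n, normc (coef F n) < t0) -> modular_le (coef F) B ->
  uniq [seq p.1 | p <- r] -> (forall p, p \in r -> p.1 != 0 -> 2 * `|om p.2| < t0) ->
  uniq s ->
  \sum_(n <- s) phi (2 * normc (\sum_(p <- r | p.1 != 0)
       (om p.2)%:C%C * coef F (n - L%:Z * p.1))) <=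
  A * B * \sum_(p <- r | p.1 != 0) phi (2 * `|om p.2|).
Proof.
move=> HA A0 dL Fd Ft FB ur omt us.
have ur' : uniq r by apply: map_uniq ur.
apply: (@le_trans _ _ (\sum_(n <- s) \sum_(p <- r | p.1 != 0)
   A * (phi (2 * `|om p.2|) * phi (normc (coef F (n - L%:Z * p.1)))))).
  apply: ler_sum => n _.
  have rhs0 p : 0 <= A * (phi (2 * `|om p.2|) * phi (normc (coef F (n - L%:Z * p.1)))).
    by rewrite !mulr_ge0// (phi_ge0 phi_orlicz)// ?normc_ge0// mulr_ge0.
  have [->|[p [pr p0 ->]]] := @shift_single om r F d L n dL Fd ur.
  - by rewrite normc0 mulr0 (phi0 phi_orlicz) sumr_ge0.
  - rewrite (big_rem p)//= p0 normcM normcR mulrA -[leLHS]addr0.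
    apply: lerD; last by apply: sumr_ge0.
    by apply: HA; rewrite ?mulr_ge0 ?normc_ge0 ?Ft ?omt.
rewrite exchange_big mulr_sumr; apply: ler_sum => p _ /=.
rewrite -mulr_sumr -mulr_sumr -mulrA ler_wpM2l// mulrC.
rewrite ler_wpM2r ?(phi_ge0 phi_orlicz) ?mulr_ge0//.
have := FB [seq n - L%:Z * p.1 | n <- s]; rewrite big_map; apply.
by rewrite map_inj_uniq//; exact: addIr.
Qed.

End Step.

(** * One multiplication by a block and a cutoff *)

Section MainStep.
Variable R : realType.
Local Notation C := R[i].
Local Notation ce := (ce R).
Implicit Types f g h F : cpf R.
Variable phi : R -> R.
Hypothesis phi_orlicz : orlicz_function phi.
Hypothesis phi_small : phi t / t ^+ 2 @[t --> 0^'+] --> (0 : R).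
Hypothesis phi_submult : submultiplicative_at_zero phi.

Lemma normc_coef_fejer N f n : normc (coef (fejer N.+1 f) n) <= normc (coef f n).
Proof.
rewrite coef_fejer !normcM normcV !normc_nat ler_piMl ?normc_ge0//.
by rewrite mulrC ler_pdivrMr ?ltr0n// mul1r ler_nat lagcount_le.
Qed.

Lemma coef_fejer_eq0 N f (n : int) : (N <= `|n|)%N -> coef (fejer N f) n = 0.
Proof. by move=> Nn; rewrite coef_fejer lagcount_eq0// mulr0 mul0r. Qed.

Lemma coef_le_l2 f (E e : R) n : 0 <= e ->
  (forall s, uniq s -> \sum_(m <- s) normc (coef f m) ^+ 2 <= E) -> E <= e ^+ 2 ->
  normc (coef f n) <= e.
Proof.
move=> e0 H Ee; have := H [:: n] isT; rewrite big_seq1 => /le_trans/(_ Ee).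
by rewrite ler_pXn2r// nnegrE ?normc_ge0.
Qed.

Lemma coef_mul_trig F (om : nat -> R) (N L : nat) n : om 0%N = 1 ->
  coef (F * \sum_(p <- rfreq N) cc (om p.2)%:C%C * ce (L%:Z * p.1)) n =
  coef F n + \sum_(p <- rfreq N | p.1 != 0) (om p.2)%:C%C * coef F (n - L%:Z * p.1).
Proof.
move=> om0; rewrite mulr_sumr coef_sum.
under eq_bigr do rewrite mulrCA coefZ coefMe.
rewrite (bigD1_seq (0, 0%N)) ?rfreq0 ?(map_uniq (rfreq_uniq N))//= om0 mul1r mulr0 subr0.
congr (_ + _); rewrite big_seq_cond [RHS]big_seq_cond; apply: eq_bigl => -[a m].
have [pr|//] := boolP ((a, m) \in rfreq N); rewrite /= xpair_eqE.
by have /= := rfreq_eq0 pr; case: eqP => // _ <-.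
Qed.

Lemma ler_sum_sqrD (s : seq int) (z x y : int -> R) :
  (forall n, 0 <= z n) -> (forall n, 0 <= x n) -> (forall n, 0 <= y n) ->
  (forall n, z n <= x n + y n) ->
  \sum_(n <- s) z n ^+ 2 <= 2 * \sum_(n <- s) x n ^+ 2 + 2 * \sum_(n <- s) y n ^+ 2.
Proof.
move=> z0 x0 y0 zxy; rewrite !mulr_sumr -big_split; apply: ler_sum => n _.
apply: (@le_trans _ _ ((x n + y n) ^+ 2)).
  by apply: lerXn2r; rewrite ?nnegrE ?addr_ge0.
rewrite -subr_ge0 (_ : _ - _ = (x n - y n) ^+ 2) ?sqr_ge0//=; ring.
Qed.

Lemma absz_sub_far (v L : nat) (n u : int) :
  (2 * v <= L)%N -> (`|n| < v)%N -> (L <= `|u|)%N -> (v <= `|(n - u)%R|)%N.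
Proof. by move=> *; lia. Qed.
Lemma ler_two_halves (S1 S2 u v E : R) :
  S1 <= v -> S2 <= u -> 2 * v <= E / 2 -> 2 * u <= E / 2 -> 2 * S1 + 2 * S2 <= E.
Proof. by move=> *; lra. Qed.
Lemma ler_three_quarters (a b c e : R) : 0 < e ->
  a <= e / 4 -> b <= e / 4 -> c <= e / 4 -> a + b + c <= e.
Proof. by move=> *; lra. Qed.
Lemma ler_add_quarters (u1 u2 u3 u4 B e : R) : 0 < e ->
  u1 <= B -> u2 <= e / 4 -> u3 <= e / 4 -> u4 <= e / 4 -> u1 + u2 + u3 + u4 <= B + e.
Proof. by move=> *; lra. Qed.

(** Here a, b and e stand for the coefficient of F, that of its shifted copies, and the error that
    is small in L^2. If b = 0, [phi_lip] produces a cross term e a, which is split into k a^2 + e^2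
    / k so that l^2 bounds apply to both parts; if a = 0, [phi_half] suffices. *)
Lemma phi_perturb (t1 k a b e : R) : 0 < k ->
  (forall t, 0 <= t < t1 -> phi t <= t ^+ 2) -> 0 <= a -> 0 <= b -> 0 <= e ->
  a <= t1 / 8 -> e <= t1 / 8 -> 0 < t1 -> a = 0 \/ b = 0 ->
  phi (a + b + e) <= phi a + 4 * k * a ^+ 2 + (4 / k + 6) * e ^+ 2 + phi (2 * b) / 2.
Proof.
move=> k0 H a0 b0 e0 at1 et1 t10 ab.
have ek : 0 <= 4 / k * e ^+ 2 by rewrite mulr_ge0 ?sqr_ge0// divr_ge0// ltW.
have pb : 0 <= phi (2 * b) by rewrite (phi_ge0 phi_orlicz)// mulr_ge0.
have e2 := sqr_ge0 e.
have [az|bz] := ab.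
  rewrite az add0r (phi0 phi_orlicz) add0r expr0n mulr0 add0r.
  have h1 := phi_half phi_orlicz b0 e0.
  have h2 : phi (2 * e) <= (2 * e) ^+ 2 by apply: H; apply/andP; split; lra.
  have h3 : (2 * e) ^+ 2 = 4 * e ^+ 2 by ring.
  rewrite mulrDl; move: h1 h2 ek pb e2; rewrite h3.
  move: (phi (b + e)) (phi (2 * b)) (phi (2 * e)) (e ^+ 2) (4 / k * _) => u v w z y *; lra.
rewrite bz addr0 mulr0 (phi0 phi_orlicz) mul0r addr0.
have h1 : phi (a + e) <= phi a + 4 * e * (a + e).
  by apply: (phi_lip phi_orlicz H) => //; lra.
have h2 : e * a <= k * a ^+ 2 + e ^+ 2 / k.
  have h4 : 0 <= (k * a - e) ^+ 2 / k by rewrite divr_ge0 ?sqr_ge0// ltW.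
  have h5 : 0 <= k * a ^+ 2 + e ^+ 2 / k.
    by apply: addr_ge0; [rewrite mulr_ge0 ?sqr_ge0// ltW|rewrite divr_ge0 ?sqr_ge0// ltW].
  have h6 : (k * a - e) ^+ 2 / k = k * a ^+ 2 + e ^+ 2 / k - 2 * (e * a).
    by field; rewrite gt_eqF.
  by have := mulr_ge0 e0 a0; move: h4 h5; rewrite h6 => *; lra.
have h3 : 4 * e * (a + e) = 4 * (e * a) + 4 * e ^+ 2 by ring.
have h4 : (4 / k + 6) * e ^+ 2 = 4 * (e ^+ 2 / k) + 6 * e ^+ 2 by ring.
have h5 : 4 * k * a ^+ 2 = 4 * (k * a ^+ 2) by ring.
rewrite h4 h5; rewrite h3 in h1; move: h1 h2 e2.
move: (e * a) (phi (a + e)) (phi a) (k * a ^+ 2) (e ^+ 2 / k) (e ^+ 2) => u v w z y x *; lra.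
Qed.

(** [dl] and [tS] are fixed before [f], so the step can be iterated with one threshold. The order of
    the choices matters: f, B and e determine m0, hence N and the bound [W] for w; [W] determines
    the degree of the Fejer mean F; the degree determines L. This is possible because [block] is
    uniform in L. *)
Lemma step : exists (dl tS : R), [/\ 0 < dl, 0 < tS &
  forall f (B b e : R) (n0 : nat), 0 < e -> 0 <= B -> modular_le phi (coef f) B ->
    (forall n, normc (coef f n) <= b) -> b < tS ->
  exists f' (L N : nat), [/\ (n0 <= L)%N, (0 < N)%N,
    (forall x, trigavg L N x <= dl -> f' x = 0) /\ (forall x, f x = 0 -> f' x = 0),
    (forall n, normc (coef f' n - coef f n) <= e) &
    modular_le phi (coef f') (B + e)]].
Proof.
have [A [t0 [A1 t00 HA]]] := phi_subm phi_orlicz phi_submult.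
have A0 : 0 <= A by lra.
have [t1 t10 Ht1'] := phi_sq phi_orlicz phi_small (@ltr01 R).
have Ht1 t : 0 <= t < t1 -> phi t <= t ^+ 2 by move=> /Ht1'; rewrite mul1r.
have [tau [r [tau14 r0 Hpar]]] :=
  riesz_params phi_orlicz phi_small A1 t00 HA.
have tau0 : 0 < tau by case/andP: tau14.
have tS0 : 0 < Num.min t0 t1 / 8 by rewrite divr_gt0// lt_min t00.
have tSt0 : Num.min t0 t1 / 8 <= t0 / 8 by rewrite ler_wpM2r// ge_min lexx.
have tSt1 : Num.min t0 t1 / 8 <= t1 / 8 by rewrite ler_wpM2r// ge_min lexx orbT.
exists (tau / 128), (Num.min t0 t1 / 8); split => //; first by rewrite divr_gt0.
move: (Num.min t0 t1 / 8) tS0 tSt0 tSt1 => tS tS0 tSt0 tSt1.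
move=> f B b e n0 e0 B0 fB fb btS.
have [Bf Bf0 HBf] := cpf_bounded f.
have [b1 b1E] : exists b1, b1 = Bf + 1 by exists (Bf + 1).
have b10 : 0 < b1 by rewrite b1E ltr_wpDl.
(* The squares of the coefficients of F sum to at most b1^2, so the terms 4 k a^2 of [phi_perturb]
   cost e / 4 in total. *)
have [k [k0 kE]] : exists k, 0 < k /\ 4 * k * b1 ^+ 2 = e / 4.
  exists (e / 16 / b1 ^+ 2); split; first by rewrite !divr_gt0// exprn_gt0.
  by field; rewrite gt_eqF.
have cE0 : 0 < 4 / k + 6 by rewrite addr_gt0// divr_gt0.
(* [E] is the budget for the squared l^2 norm of the error: its modular cost is e / 4, and each of
   its coefficients stays below e / 4 and t1 / 8. *)
have [E [E0 [E1 [E2 E3]]]] : exists E, 0 < E /\ (4 / k + 6) * E <= e / 4 /\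
    E <= (e / 4) ^+ 2 /\ E <= (t1 / 8) ^+ 2.
  have [y y0 Hy] := pos_mul_le (ltW cE0) (divr_gt0 e0 (ltr0n _ 4)).
  exists (Num.min y (Num.min ((e / 4) ^+ 2) ((t1 / 8) ^+ 2))); split.
    by rewrite !lt_min y0 !exprn_gt0 ?divr_gt0.
  split; first by apply: Hy; rewrite ge_min lexx.
  by rewrite !ge_min !lexx /= !orbT.
have [y1 y10 Hy1] := pos_mul_le (mulr_ge0 A0 B0) (divr_gt0 e0 (ltr0n _ 2)).
have b120 : 0 <= 2 * b1 ^+ 2 by rewrite mulr_ge0 ?sqr_ge0.
have [y2 y20 Hy2] := pos_mul_le b120 (divr_gt0 E0 (ltr0n _ 2)).
have [y3 y30 Hy3] := pos_mul_le (ltW b10) (divr_gt0 e0 (ltr0n _ 4)).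
(* The three bounds control the modular of the shifted copies, the part of F w removed by the
   cutoff, and the size of each shifted coefficient. *)
have [m0 [m00 Hm0]] : exists m, (0 < m)%N /\ 2^-1 ^+ m <= Num.min y1 (Num.min y2 y3).
  by apply: half_pow; rewrite !lt_min y10 y20.
move: Hm0; rewrite !le_min => /and3P[/Hy1 m1 /Hy2 m2 /Hy3 m3] {Hy1 Hy2 Hy3 y10 y20 y30 y1 y2 y3}.
have [om [om0 omz omb Hblock]] := block tau14 m00.
have [P1 P2 P3 P4] := Hpar m0 om m00 omz omb.
have N0 : (0 < r * m0)%N by rewrite muln_gt0 r0.
set N := (r * m0)%N in P1 P2 N0.
have W0 : 0 <= 8 ^+ m0 * 2 ^+ N :> R by rewrite mulr_ge0 ?exprn_ge0.
have {}Hblock L := Hblock N L N0.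
move: (8 ^+ m0 * 2 ^+ N) W0 Hblock => W W0 Hblock.
have WW0 : 0 <= 2 * W ^+ 2 by rewrite mulr_ge0 ?sqr_ge0.
(* The Fejer error f - F gets multiplied by w, so it has to be small compared with 1 / [W]. *)
have [e1 [e10 [e11 [e12 e13]]]] : exists e1, 0 < e1 /\ e1 <= 1 /\ e1 <= e / 4 /\
    2 * W ^+ 2 * e1 <= E / 2.
  have [y y0 Hy] := pos_mul_le WW0 (divr_gt0 E0 (ltr0n _ 2)).
  exists (Num.min y (Num.min 1 (e / 4))); split.
    by rewrite !lt_min y0 ltr01 divr_gt0.
  split; first by rewrite !ge_min lexx orbT.
  split; first by rewrite !ge_min lexx !orbT.
  by apply: Hy; rewrite ge_min lexx.
have [N1 HN1] := fejer_approx f e10.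
have {}HN1 x : normc (f x - fejer N1.+1 f x) <= e1 by apply: HN1.
have cF := normc_coef_fejer N1 f.
have zF := @coef_fejer_eq0 N1.+1 f.
move: (fejer N1.+1 f) HN1 cF zF => F HN1 cF zF.
have Fb1 x : normc (F x) <= b1.
  have -> : F x = f x - (f x - F x) by rewrite subKr.
  by rewrite b1E (le_trans (normcB _ _))// lerD// (le_trans (HN1 x)).
pose L := (n0 + 2 * N1.+1)%N.
have L0 : (0 < L)%N by rewrite /L addn_gt0 muln_gt0 orbT.
have dL : (2 * N1.+1 <= L)%N by rewrite /L leq_addl.
have [wW wT] := Hblock L L0.
set w := \sum_(p <- rfreq N) _ in wW wT.
have t1280 : 0 < tau / 128 by rewrite divr_gt0.
have [th [th0 th1 thn th1n]] := cutoff L N t1280.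
(* f w th = F + D + g: the coefficients of F and D live on disjoint sets, and g is
   small in L^2. *)
pose g := (f - F) * w * th - F * w * (1 - th).
pose D n := \sum_(p <- rfreq N | p.1 != 0) (om p.2)%:C%C * coef F (n - L%:Z * p.1).
have cE n : coef (f * w * th) n = coef F n + D n + coef g n.
  have -> : f * w * th = F * w + g by rewrite /g; ring.
  by rewrite coefD coef_mul_trig.
have gl2 s : uniq s -> \sum_(n <- s) normc (coef g n) ^+ 2 <= E.
  move=> us; pose X n := normc (coef ((f - F) * w * th) n).
  pose Y n := normc (coef (F * w * (1 - th)) n).
  have h1 : \sum_(n <- s) X n ^+ 2 <= (e1 * W) ^+ 2.
    apply: bessel_bound => // x; rewrite !cpfM cpfB !normcM -[leRHS]mulr1.
    apply: ler_pM; rewrite ?normc_ge0 ?mulr_ge0 ?normc_ge0//.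
    by apply: ler_pM; rewrite ?normc_ge0 ?HN1.
  have h2 : \sum_(n <- s) Y n ^+ 2 <= b1 ^+ 2 * 2^-1 ^+ m0.
    apply: le_trans (wT (1 - th) F b1 s Fb1 _ _ us) _.
    - by move=> x; rewrite cpfB cpf1 th1n.
    - move=> x hx; rewrite cpfB cpf1 th1 ?subrr//; apply: le_trans hx.
      by rewrite le_eqVlt; apply/orP; left; apply/eqP; field.
    - by rewrite ler_wpM2l ?sqr_ge0.
  have h3 : 2 * (e1 * W) ^+ 2 <= E / 2.
    apply: le_trans e13.
    have -> : 2 * (e1 * W) ^+ 2 = 2 * W ^+ 2 * (e1 * e1) by ring.
    by rewrite ler_wpM2l// ler_piMl// ltW.
  have h4 : \sum_(n <- s) normc (coef g n) ^+ 2 <=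
      2 * \sum_(n <- s) X n ^+ 2 + 2 * \sum_(n <- s) Y n ^+ 2.
    apply: ler_sum_sqrD => n; [exact: normc_ge0|exact: normc_ge0|exact: normc_ge0|].
    by rewrite /X /Y coefB normcB.
  by apply: le_trans h4 _; apply: (ler_two_halves h1 h2 h3); rewrite mulrA.
have ge4 n : normc (coef g n) <= e / 4.
  by apply: (coef_le_l2 _ _ gl2) => //; rewrite divr_ge0// ltW.
have gt8 n : normc (coef g n) <= t1 / 8.
  by apply: (coef_le_l2 _ _ gl2) => //; rewrite divr_ge0// ltW.
have Dn n : normc (D n) <= e / 4.
  rewrite /D; have [->|[p [pr p0 ->]]] := shift_single om n dL zF (rfreq_uniq N).
    by rewrite normc0 divr_ge0// ltW.
  rewrite normcM normcR mulrC; apply: le_trans m3.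
  apply: ler_pM; rewrite ?normc_ge0// ?P3//.
    by rewrite (le_trans (cF _))// (le_trans (normc_coef_bound _ HBf))// b1E lerDl.
  by rewrite lt0n -(rfreq_eq0 pr).
have D0 n : coef F n = 0 \/ D n = 0.
  have [nN|Nn] := ltnP `|n| N1.+1; last by left; rewrite zF.
  right; rewrite /D big1// => p p0; rewrite zF ?mulr0//.
  apply: (absz_sub_far dL nN).
  by rewrite abszM absz_nat leq_pmulr// absz_gt0.
exists (f * w * th), L, N; split => //.
- by rewrite /L leq_addr.
- split=> x hx; rewrite !cpfM; first by rewrite th0// mulr0.
  by rewrite hx !mul0r.
- move=> n; rewrite cE.
  have -> : coef F n + D n + coef g n - coef f n = coef (F - f) n + D n + coef g n.
    by rewrite [coef (F - f) n]coefB (addrAC _ (coef g n)) (addrAC _ (D n)).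
  have h1 : normc (coef (F - f) n) <= e / 4.
    apply: le_trans e12; apply: normc_coef_bound => x.
    by rewrite cpfB normc_distC HN1.
  apply: le_trans (le_normcD _ _) _.
  apply: le_trans (_ : normc (coef (F - f) n) + normc (D n) + normc (coef g n) <= _).
    by rewrite lerD2r le_normcD.
  exact: (ler_three_quarters e0 h1 (Dn n) (ge4 n)).
move=> s us.
have aF n : normc (coef F n) <= tS by rewrite (le_trans (cF n))// (le_trans (fb n))// ltW.
apply: (@le_trans _ _ (\sum_(n <- s) (phi (normc (coef F n))
   + 4 * k * normc (coef F n) ^+ 2 + (4 / k + 6) * normc (coef g n) ^+ 2
   + phi (2 * normc (D n)) / 2))).
  apply: ler_sum => n _; rewrite cE.
  apply: (@le_trans _ _ (phi (normc (coef F n) + normc (D n) + normc (coef g n)))).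
    apply: (phi_mono phi_orlicz); first exact: normc_ge0.
    by apply: le_trans (le_normcD _ _) _; rewrite lerD2r le_normcD.
  apply: (phi_perturb k0 Ht1); rewrite ?normc_ge0//.
    exact: le_trans (aF n) tSt1.
  by case: (D0 n) => ->; rewrite normc0; [left|right].
rewrite !big_split /=.
have s1 : \sum_(n <- s) phi (normc (coef F n)) <= B.
  apply: le_trans (fB s us); apply: ler_sum => n _.
  by apply: (phi_mono phi_orlicz) (cF n); exact: normc_ge0.
have s2 : \sum_(n <- s) 4 * k * normc (coef F n) ^+ 2 <= e / 4.
  rewrite -mulr_sumr -kE ler_wpM2l//; first by rewrite mulr_ge0// ltW.
  exact: bessel_bound.
have s3 : \sum_(n <- s) (4 / k + 6) * normc (coef g n) ^+ 2 <= e / 4.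
  by rewrite -mulr_sumr; apply: le_trans E1; rewrite ler_wpM2l ?gl2// ltW.
have s4 : \sum_(n <- s) phi (2 * normc (D n)) / 2 <= e / 4.
  rewrite -mulr_suml ler_pdivrMr//.
  have -> : e / 4 * 2 = e / 2 by field.
  apply: le_trans m1.
  apply: le_trans (@coef_shift_sum _ phi phi_orlicz A t0 B om (rfreq N) F N1.+1 L s HA A0 dL zF _ _ (rfreq_uniq N) _ us) _.
  - by move=> n; apply: le_lt_trans (aF n) _; apply: le_lt_trans tSt0 _; rewrite ltr_pdivrMr// ltr_pMr// ltr1n.
  - move=> s' us'; apply: le_trans (fB s' us'); apply: ler_sum => n _.
    by apply: (phi_mono phi_orlicz) (cF n); exact: normc_ge0.
  - by move=> p pr p0; apply: P4; rewrite lt0n -(rfreq_eq0 pr).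
  by rewrite ler_wpM2l ?mulr_ge0.
exact: (ler_add_quarters e0 s1 s2 s3 s4).
Qed.

End MainStep.

(** * The limit distribution *)

Section Translation.
Variable R : realType.
Local Notation C := R[i].
Local Notation ce := (ce R).
Local Notation tau := (@trigo.pi R *+ 2).
Implicit Types f g : cpf R.

Fact tr_spec (h : R) f : {g : cpf R | forall x, g x = f (x + h)}.
Proof.
have H1 : continuous (fun x => complex.Re (f (x + h))).
  move=> x; apply: (@continuous_comp _ _ _ (fun x => x + h)
    (fun x => complex.Re (f x))); last exact: cpf_contRe.
  by apply: cvgD; [exact: cvg_id|exact: cvg_cst].
have H2 : continuous (fun x => complex.Im (f (x + h))).
  move=> x; apply: (@continuous_comp _ _ _ (fun x => x + h)
    (fun x => complex.Im (f x))); last exact: cpf_contIm.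
  by apply: cvgD; [exact: cvg_id|exact: cvg_cst].
have H3 x : f (x + tau + h) = f (x + h) by rewrite addrAC cpf_per.
by exists (@mk_cpf R (fun x => f (x + h)) H1 H2 H3).
Qed.
Definition tr h f : cpf R := sval (tr_spec h f).
Lemma trE h f x : tr h f x = f (x + h). Proof. exact: (svalP (tr_spec h f)). Qed.

Lemma ce_add n x y : ce n (x + y) = ce n x * ce n y.
Proof.
rewrite !ceE mulrzDl cosD sinD.
by rewrite /GRing.mul /= /GRing.mul /=; congr Complex; rewrite addrC.
Qed.

(** Invariance is read off the coefficients for Fejer means and passes to uniform limits, so that no
    change of variables is made in the integral. *)
Lemma M_tr h f : M (tr h f) = M f.
Proof.
apply/eqP; rewrite -subr_eq0; apply/eqP/eq0_normc/eqP.
rewrite eq_le normc_ge0 andbT; apply/ler_addgt0Pr => e e0; rewrite add0r.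
have [N HN] := fejer_approx f (divr_gt0 e0 (ltr0n _ 2)).
have {}HN x := HN N x (leqnn N).
have trF : M (tr h (fejer N.+1 f)) = M (fejer N.+1 f).
  have -> : tr h (fejer N.+1 f) = \sum_(j < N.+1) \sum_(k < N.+1)
      cc (N.+1%:R^-1 * coef f (j%:Z - k%:Z)) *
      (cc (ce (j%:Z - k%:Z) h) * ce (j%:Z - k%:Z)).
    apply: cpfP => x; rewrite trE /fejer !cpf_sum; apply: eq_bigr => j _.
    rewrite !cpf_sum; apply: eq_bigr => k _.
    by rewrite !cpfM !ccE ce_add [ce _ x * _]mulrC.
  rewrite /fejer !raddf_sum; apply: eq_bigr => j _.
  rewrite !raddf_sum; apply: eq_bigr => k _ /=.
  rewrite !MZ M_ce; case: eqP => [->|_]; last by rewrite mulr0.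
  by rewrite ce0 cpf1 mul1r.
have -> : M (tr h f) - M f =
    M (tr h f - tr h (fejer N.+1 f)) - M (f - fejer N.+1 f).
  by rewrite !MB trF opprB addrA subrK.
rewrite (splitr e) (le_trans (normcB _ _))// lerD// normc_M_bound// => x.
  by rewrite cpfB !trE.
Qed.

Lemma coef_tr h f n : coef (tr h f) n = ce n h * coef f n.
Proof.
rewrite /coef -MZ -[RHS](M_tr h); congr M; apply: cpfP => x.
rewrite trE !cpfM ccE trE ce_add.
have : ce n h * ce (- n) h = 1 by rewrite -cpfM -ceD subrr ce0 cpf1.
move: (f _) (ce n h) (ce (- n) h) (ce (- n) x) => a b c d bc.
by rewrite -[a * d]mulr1 -bc; ring.
Qed.

Lemma coef_second_diff f (n : int) (h : R) : cos (h *~ n) = -1 -> sin (h *~ n) = 0 ->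
  coef (tr h f + tr (- h) f - (f + f)) n = - (4 * coef f n).
Proof.
move=> c s; rewrite coefB !coefD !coef_tr !ceE mulNrz cosN sinN c s oppr0.
have -> : (-1 +i* 0)%C = -1 :> C by rewrite complexr0 rmorphN.
by ring.
Qed.

End Translation.

Section RealSecondDiff.
Variable R : realType.

(** The mean value theorem is applied twice: to t |-> v (x + t) + v (x - t) on [0, h], then to v1 on
    [x - c, x + c]. *)
Lemma second_diff_bound (v v1 v2 : R -> R) (x h K : R) : 0 < h ->
  (forall y : R, is_derive y 1 v (v1 y)) -> (forall y : R, is_derive y 1 v1 (v2 y)) ->
  (forall y, `|v2 y| <= K) ->
  `|v (x + h) + v (x - h) - (v x + v x)| <= 2 * h ^+ 2 * K.
Proof.
move=> h0 d1 d2 HK.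
have K0 : 0 <= K by apply: le_trans (HK 0).
have cont (g g' : R -> R) : (forall y : R, is_derive y 1 g (g' y)) -> continuous g.
  by move=> dg y; apply: differentiable_continuous; apply/derivable1_diffP; case: (dg y).
have du (t : R) : is_derive t 1 (fun t => v (x + t) + v (x - t)) (v1 (x + t) - v1 (x - t)).
  have e1 : is_derive t 1 (fun t => v (x + t)) (v1 (x + t)).
    have e : is_derive t 1 (fun t => x + t) (1 : R).
      by apply: is_derive_eq; rewrite add0r mulr1.
    have := @is_derive1_comp _ v (fun t => x + t) t _ _ (d1 _) e.
    by rewrite /GRing.scale /= mulr1.
  have e2 : is_derive t 1 (fun t => v (x - t)) (- v1 (x - t)).
    have e : is_derive t 1 (fun t => x - t) (-1 : R).
      by apply: is_derive_eq; rewrite add0r mul1r.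
    have := @is_derive1_comp _ v (fun t => x - t) t _ _ (d1 _) e.
    by rewrite /GRing.scale /= mulrN1.
  by apply: is_derive_eq.
have [|c cI] := MVT h0 (fun t _ => du t).
  by apply: continuous_subspaceT; apply: cont du.
rewrite addr0 !subr0 => ->.
move: cI; rewrite in_itv /= => /andP[c0 ch].
have xc : x - c < x + c by lra.
have [|d dI ->] := MVT xc (fun t _ => d2 t).
  by apply: continuous_subspaceT; apply: cont d2.
have -> : x + c - (x - c) = 2 * c by ring.
rewrite normrM normrM (gtr0_norm h0) (@gtr0_norm _ (2 * c)) ?mulr_gt0//.
have -> : 2 * h ^+ 2 * K = K * (2 * h) * h by ring.
by rewrite ler_wpM2r ?(ltW h0)// ler_pM// ?mulr_ge0 ?(ltW c0)// ler_wpM2l// ltW.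
Qed.

End RealSecondDiff.

(** * Decay of the Fourier coefficients of smooth functions *)

Section Smooth.
Variable R : realType.
Local Notation C := R[i].
Local Notation ce := (ce R).
Local Notation tau := (@trigo.pi R *+ 2).
Implicit Types (f : cpf R) (g : circle R -> C).

Lemma pi_le4 : trigo.pi <= 4 :> R.
Proof. by have := pihalf_lt2 R; lra. Qed.

Lemma tproj_per (x : R) : tproj (x + tau) = tproj x.
Proof.
rewrite /tproj; apply/eqmodP; apply/asboolP; exists (-1).
by rewrite mulrN1z addrK.
Qed.

Lemma derive1n_per (u : R -> R) k : (forall x, u (x + tau) = u x) ->
  forall x, (u^`(k)%classic) (x + tau) = (u^`(k)%classic) x.
Proof.
move=> pu; elim: k => // k IH x.
rewrite !derive1nS /derive1.
have -> : (fun h : R => h^-1 *: ((u^`(k)%classic) (h + (x + tau)) - (u^`(k)%classic) (x + tau))) =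
    (fun h : R => h^-1 *: ((u^`(k)%classic) (h + x) - (u^`(k)%classic) x)).
  by apply/funext => h; rewrite addrA !IH.
by [].
Qed.

Lemma derivable_cont (u : R -> R) : (forall x : R, derivable u x 1) -> continuous u.
Proof.
by move=> du y; apply: differentiable_continuous; apply/derivable1_diffP.
Qed.

Lemma smooth_dern_cpf g k : smooth g -> exists f, forall x, f x = dern k g x.
Proof.
move=> sg.
have H1 : continuous (fun x => complex.Re (dern k g x)).
  have -> : (fun x => complex.Re (dern k g x)) = (lift_re g)^`(k)%classic by [].
  by apply: derivable_cont => x; exact: (proj1 (sg k x)).
have H2 : continuous (fun x => complex.Im (dern k g x)).
  have -> : (fun x => complex.Im (dern k g x)) = (lift_im g)^`(k)%classic by [].
  by apply: derivable_cont => x; exact: (proj2 (sg k x)).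
have H3 x : dern k g (x + tau) = dern k g x.
  by rewrite /dern !derive1n_per// => y; rewrite /lift_re /lift_im tproj_per.
by exists (@mk_cpf R (fun x => dern k g x) H1 H2 H3).
Qed.

Lemma smooth_cpf g : smooth g -> exists f, forall x, f x = g (tproj x).
Proof.
move=> sg; have [f fE] := smooth_dern_cpf 0 sg; exists f => x; rewrite fE /dern.
by rewrite /= /lift_re /lift_im; case: (g (tproj x)).
Qed.

Lemma dern_sup g k x : smooth g ->
  normc (dern k g x) <= sup (range (fun x => normc (dern k g x))).
Proof.
move=> sg; have [f fE] := smooth_dern_cpf k sg; have [B B0 HB] := cpf_bounded f.
apply: sup_upper_bound; last by exists x.
split; first by exists (normc (dern k g 0)); exists 0.
by exists B => _ [y _ <-]; rewrite -fE.
Qed.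

Lemma dern_Cnorm g k N x : smooth g -> (k <= N)%N -> normc (dern k g x) <= Cnorm N g.
Proof.
move=> sg kN; apply: (le_trans (dern_sup _ _ sg)); rewrite /Cnorm.
have kN' : (k < N.+1)%N by [].
rewrite (bigD1 (Ordinal kN'))//= lerDl sumr_ge0// => i _.
by apply: le_trans (dern_sup i 0 sg); exact: normc_ge0.
Qed.

(** Two derivatives give decay of order n^(-2), which is summable. The factor 16 comes from pi <= 4,
    and 6 from (m + 1)(m + 2) <= 6 m^2 for m >= 1. *)
Lemma smooth_decay g f : smooth g -> (forall x, f x = g (tproj x)) ->
  forall n : int, normc (coef f n) <= 16 * Cnorm 2 g * (6 / ((`|n|.+1 * `|n|.+2)%:R : R)).
Proof.
move=> sg fg n.
have C0 : 0 <= Cnorm 2 g by apply: le_trans (dern_Cnorm (k := 0) 0 sg isT); exact: normc_ge0.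
have f0 x : normc (f x) <= Cnorm 2 g.
  apply: le_trans (dern_Cnorm (k := 0) x sg isT); rewrite fg /dern /lift_re /lift_im /=.
  by case: (g (tproj x)).
have [->|n0] := eqVneq n 0.
  rewrite absz0 mul1n; apply: le_trans (normc_coef_bound 0 f0) _.
  have -> : 16 * Cnorm 2 g * (6 / 2%:R) = 48 * Cnorm 2 g by field.
  by rewrite ler_peMl// ler1n.
have m0 : (0 < `|n|)%N by rewrite absz_gt0.
have mR : 0 < (`|n|%:R : R) by rewrite ltr0n.
(* The second difference with step pi / n multiplies the n-th coefficient by -4. *)
pose h : R := pi / `|n|%:R.
have h0 : 0 < h by rewrite divr_gt0// pi_gt0.
have hn : h *~ n = pi \/ h *~ n = - pi.
  have hm : h *+ `|n| = pi by rewrite -mulr_natr /h mulfVK// gt_eqF.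
  case: (n) hm => m /=; first by left.
  by rewrite NegzE => hm; right; rewrite mulrNz; congr (- _).
have cs : cos (h *~ n) = -1 /\ sin (h *~ n) = 0.
  by case: hn => ->; rewrite ?cosN ?sinN cospi sinpi ?oppr0.
have := coef_second_diff f (proj1 cs) (proj2 cs).
move=> /(congr1 (@normc R)); rewrite normcN normcM normc_nat => c4.
have sd x : normc ((tr h f + tr (- h) f - (f + f)) x) <= 4 * h ^+ 2 * Cnorm 2 g.
  have der (u : R -> R) k : (forall x : R, derivable u^`(k)%classic x 1) ->
      forall y : R, is_derive y 1 u^`(k)%classic (u^`(k.+1)%classic y).
    move=> du y; apply: DeriveDef; first exact: du.
    by rewrite derive1nS derive1E.
  have r1 := @second_diff_bound R (lift_re g) _ _ x h (Cnorm 2 g) h0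
    (der _ 0 (fun y => proj1 (sg 0 y))) (der _ 1 (fun y => proj1 (sg 1 y))).
  have r2 := @second_diff_bound R (lift_im g) _ _ x h (Cnorm 2 g) h0
    (der _ 0 (fun y => proj2 (sg 0 y))) (der _ 1 (fun y => proj2 (sg 1 y))).
  apply: le_trans (normc_ReIm _) _.
  have -> : 4 * h ^+ 2 * Cnorm 2 g = 2 * h ^+ 2 * Cnorm 2 g + 2 * h ^+ 2 * Cnorm 2 g by ring.
  have d2 y := dern_Cnorm y sg (leqnn 2).
  have ReE (z w y : C) : complex.Re (z + w - (y + y)) =
      complex.Re z + complex.Re w - (complex.Re y + complex.Re y).
    by case: z w y => ? ? [? ?] [].
  have ImE (z w y : C) : complex.Im (z + w - (y + y)) =
      complex.Im z + complex.Im w - (complex.Im y + complex.Im y).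
    by case: z w y => ? ? [? ?] [].
  rewrite cpfB !cpfD !trE !fg ReE ImE; apply: lerD.
    by apply: r1 => y; apply: le_trans (d2 y); apply: le_trans (normc_Re _).
  by apply: r2 => y; apply: le_trans (d2 y); apply: le_trans (normc_Im _).
have cb : normc (coef f n) <= h ^+ 2 * Cnorm 2 g.
  have cb := normc_coef_bound n sd; rewrite c4 in cb.
  by rewrite -(ler_pM2l (ltr0n R 4 : 0 < 4)) mulrA.
apply: le_trans cb _.
have h2 : h ^+ 2 <= 16 / `|n|%:R ^+ 2.
  rewrite /h expr_div_n ler_wpM2r ?invr_ge0 ?exprn_ge0//.
  have -> : 16 = 4 ^+ 2 :> R by rewrite -natrX.
  apply: lerXn2r; rewrite ?nnegrE ?(pi_ge0 R)//.
  exact: pi_le4.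
apply: (@le_trans _ _ (16 / `|n|%:R ^+ 2 * Cnorm 2 g)); first by rewrite ler_wpM2r.
rewrite mulrAC ler_wpM2l ?mulr_ge0//.
rewrite ler_pdivlMr ?ltr0n// mulrC ler_pdivrMr ?exprn_gt0// -natrX -natrM ler_nat.
by move: (`|n|)%N m0 => m; case: m => // m _; rewrite expnS expn1; lia.
Qed.

End Smooth.

(** * Limits with geometric rate *)

Section Limits.
Variable R : realType.
Local Notation C := R[i].

(** The intervals of radius K 2^(-j) around u_j are nested; the limit is the supremum of their left
    ends. *)
Lemma geo_limit_real (u : nat -> R) (K : R) :
  (forall j, `|u j.+1 - u j| <= K * 2^-1 ^+ j.+1) ->
  exists l, forall j, `|l - u j| <= K * 2^-1 ^+ j.
Proof.
move=> H; have K0 : 0 <= K.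
  by have := le_trans (normr_ge0 _) (H 0%N); rewrite pmulr_lge0// exprn_gt0 ?invr_gt0.
pose q j : R := K * 2^-1 ^+ j.
have qE j : q j = 2 * q j.+1 by rewrite /q exprS; field.
have step1 i j : (i <= j)%N -> `|u j - u i| <= q i - q j.
  elim: j => [|j IH]; first by rewrite leqn0 => /eqP ->; rewrite !subrr normr0.
  rewrite leq_eqVlt => /orP[/eqP ->|]; first by rewrite !subrr normr0.
  rewrite ltnS => /IH h; have h2 := H j; rewrite -/(q j.+1) in h2.
  have := ler_normD (u j.+1 - u j) (u j - u i); rewrite addrA subrK => /le_trans; apply.
  by have := qE j => e; lra.
have q0 j : 0 <= q j by rewrite mulr_ge0 ?exprn_ge0.
pose S := range (fun j => u j - q j).
have ubS j : ubound S (u j + q j).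
  move=> _ [i _ <-]; have [ij|ij] := leqP i j.
    by have := step1 _ _ ij; have := q0 j; rewrite ler_norml => ? /andP[? ?]; lra.
  by have := step1 _ _ (ltnW ij); have := q0 i; rewrite ler_norml => ? /andP[? ?]; lra.
have hS : has_sup S.
  by split; [exists (u 0%N - q 0%N); exists 0%N|exists (u 0%N + q 0%N); exact: ubS].
exists (sup S) => j; rewrite -/(q j).
have h1 : u j - q j <= sup S by apply: sup_upper_bound => //; exists j.
have h2 : sup S <= u j + q j by apply: ge_sup; [case: hS|exact: ubS].
by rewrite ler_norml; apply/andP; split; lra.
Qed.

Lemma geo_limit (a : nat -> C) (K : R) :
  (forall j, normc (a j.+1 - a j) <= K * 2^-1 ^+ j.+1) ->
  exists l, forall j, normc (l - a j) <= 2 * K * 2^-1 ^+ j.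
Proof.
move=> H.
have ReB (z w : C) : complex.Re (z - w) = complex.Re z - complex.Re w by case: z w => ? ? [].
have ImB (z w : C) : complex.Im (z - w) = complex.Im z - complex.Im w by case: z w => ? ? [].
have [l1 H1] : exists l, forall j, `|l - complex.Re (a j)| <= K * 2^-1 ^+ j.
  by apply: geo_limit_real => j; rewrite -ReB (le_trans (normc_Re _)).
have [l2 H2] : exists l, forall j, `|l - complex.Im (a j)| <= K * 2^-1 ^+ j.
  by apply: geo_limit_real => j; rewrite -ImB (le_trans (normc_Im _)).
exists (l1 +i* l2)%C => j; apply: le_trans (normc_ReIm _) _; rewrite ReB ImB /=.
have -> : 2 * K * 2^-1 ^+ j = K * 2^-1 ^+ j + K * 2^-1 ^+ j by ring.
exact: lerD.
Qed.

Definition clim (a : nat -> C) (l : C) : Prop :=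
  forall e, 0 < e -> exists j0, forall j, (j0 <= j)%N -> normc (l - a j) <= e.

Lemma half_pow_small (K e : R) : 0 <= K -> 0 < e ->
  exists j0, forall j, (j0 <= j)%N -> K * 2^-1 ^+ j <= e.
Proof.
move=> K0 e0; have [y y0 Hy] := pos_mul_le K0 e0.
have [m [_ Hm]] := half_pow y0; exists m => j mj; apply: Hy.
by apply: le_trans Hm; rewrite ler_wiXn2l ?invr_ge0// invf_le1// ler1n.
Qed.

Lemma geo_clim (a : nat -> C) (K : R) (l : C) : 0 <= K ->
  (forall j, normc (l - a j) <= K * 2^-1 ^+ j) -> clim a l.
Proof.
move=> K0 H e e0; have [j0 Hj] := half_pow_small K0 e0.
by exists j0 => j jj; apply: le_trans (H j) (Hj j jj).
Qed.

Lemma clim_uniq a l m : clim a l -> clim a m -> l = m.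
Proof.
move=> la ma; apply/eqP; rewrite -subr_eq0; apply/eqP/eq0_normc/eqP.
rewrite eq_le normc_ge0 andbT; apply/ler_addgt0Pr => e e0; rewrite add0r.
have e2 : 0 < e / 2 by rewrite divr_gt0.
have [j1 H1] := la _ e2; have [j2 H2] := ma _ e2.
have -> : l - m = (l - a (maxn j1 j2)) - (m - a (maxn j1 j2)) by rewrite opprB addrA subrK.
rewrite (le_trans (normcB _ _))// (splitr e) lerD//.
  by rewrite H1// leq_maxl.
by rewrite H2// leq_maxr.
Qed.

Lemma clim_lin (c : C) a b l m : clim a l -> clim b m ->
  clim (fun j => c * a j + b j) (c * l + m).
Proof.
move=> la mb e e0; have c1 : 0 < normc c + 1 by rewrite ltr_wpDl ?normc_ge0.
have [|j1 H1] := la (e / 2 / (normc c + 1)); first by rewrite !divr_gt0.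
have [|j2 H2] := mb (e / 2); first by rewrite divr_gt0.
exists (maxn j1 j2) => j; rewrite geq_max => /andP[jj1 jj2].
have -> : c * l + m - (c * a j + b j) = c * (l - a j) + (m - b j) by ring.
rewrite (le_trans (le_normcD _ _))// (splitr e) lerD ?H2// normcM.
apply: le_trans (ler_wpM2l (normc_ge0 c) (H1 j jj1)) _.
by rewrite mulrCA ler_piMr ?divr_ge0 ?(ltW e0)// ler_pdivrMr// mul1r lerDl.
Qed.

Lemma clim_eq (a b : nat -> C) l : (forall j, a j = b j) -> clim a l -> clim b l.
Proof. by move=> ab H e e0; have [j0 Hj] := H e e0; exists j0 => j; rewrite -ab; exact: Hj. Qed.

Lemma clim0 (a : nat -> C) j0 : (forall j, (j0 <= j)%N -> a j = 0) -> clim a 0.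
Proof. by move=> a0 e e0; exists j0 => j jj; rewrite a0// subr0 normc0 ltW. Qed.

End Limits.

(** * Iteration of the step *)

Section Sequence.
Variable R : realType.
Local Notation C := R[i].
Variable phi : R -> R.
Hypothesis phi_orlicz : orlicz_function phi.
Hypothesis phi_small : phi t / t ^+ 2 @[t --> 0^'+] --> (0 : R).
Hypothesis phi_submult : submultiplicative_at_zero phi.

Lemma product_sequence : exists (dl kap Bd : R) (fs : nat -> cpf R) (Ls Ns : nat -> nat),
  [/\ 0 < dl, 0 < kap /\ 4 * kap <= normc (coef (fs 0%N) 0),
      (forall j, (j <= Ls j)%N /\ (0 < Ns j)%N),
      (forall j x, (trigavg (Ls j) (Ns j) x <= dl -> fs j.+1 x = 0) /\
         (fs j x = 0 -> fs j.+1 x = 0)) &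
      (forall j n, normc (coef (fs j.+1) n - coef (fs j) n) <= kap * 2^-1 ^+ j.+1) /\ (forall j, modular_le phi (coef (fs j)) Bd)].
Proof.
have [dl [tS [dl0 tS0 Hstep]]] := step phi_orlicz phi_small phi_submult.
(* All coefficients stay below 2 c < tS, so [step] keeps applying. The bound kap <= 1 limits the
   total growth of the modular to 1, and kap <= c / 4 keeps the coefficient at 0 away from zero in
   the limit. *)
pose c := tS / 4; have c0 : 0 < c by rewrite divr_gt0.
pose kap := Num.min 1 (c / 4).
have k0 : 0 < kap by rewrite lt_min ltr01 divr_gt0.
have k1 : kap <= 1 by rewrite ge_min lexx.
have kc : kap <= c / 4 by rewrite ge_min lexx orbT.
have pc0 : 0 <= phi c by apply: (phi_ge0 phi_orlicz); exact: ltW.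
pose h j : R := 2^-1 ^+ j.
have h0 j : 0 < h j by rewrite exprn_gt0// invr_gt0.
have hS j : h j = 2 * h j.+1 by rewrite /h exprS; field.
have h1 j : h j <= 1 by rewrite exprn_ile1// ?invr_ge0// invf_le1// ler1n.
pose good (j : nat) (f : cpf R) := modular_le phi (coef f) (phi c + (1 - h j)) /\
  forall n, normc (coef f n) <= c + c * (1 - h j).
pose rel (jf : nat * cpf R) (y : cpf R * nat * nat) :=
  good jf.1 jf.2 -> [/\ good jf.1.+1 y.1.1, (jf.1 <= y.1.2)%N /\ (0 < y.2)%N,
   (forall x, (trigavg y.1.2 y.2 x <= dl -> y.1.1 x = 0) /\ (jf.2 x = 0 -> y.1.1 x = 0)) &
   forall n, normc (coef y.1.1 n - coef jf.2 n) <= kap * h jf.1.+1].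
have /choice[G HG] : forall jf, exists y, rel jf y.
  (* Where [good] fails, [rel] holds vacuously and the default triple is arbitrary. *)
  move=> [j f]; have [gd|ngd] := pselect (good j f); last by exists (f, 0%N, 0%N).
  have [gB gb] := gd; have hj0 := h0 j; have hj1 := h1 j; have hjS := hS j; have hj10 := h0 j.+1.
  have e0 : 0 < kap * h j.+1 by rewrite mulr_gt0.
  have B0 : 0 <= phi c + (1 - h j) by rewrite addr_ge0// subr_ge0.
  have bS : c + c * (1 - h j) < tS.
    have : c * (1 - h j) <= c by rewrite ler_piMr ?(ltW c0)// gerBl ltW.
    by rewrite /c => ?; lra.
  have [f' [L [N [a1 a2 a3 a4 a5]]]] := Hstep f _ _ _ j e0 B0 gB gb bS.
  exists (f', L, N) => _; split => //=.
    split=> [s us|n].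
      apply: le_trans (a5 s us) _; rewrite -addrA lerD2l hjS.
      have : kap * h j.+1 <= h j.+1 by rewrite ler_piMl// ltW.
      by move=> ?; lra.
    have -> : coef f' n = coef f n + (coef f' n - coef f n) by rewrite addrC subrK.
    apply: le_trans (le_normcD _ _) _; have := lerD (gb n) (a4 n); move/le_trans; apply.
    rewrite hjS -addrA lerD2l.
    have : kap * h j.+1 <= c * h j.+1 by rewrite ler_wpM2r ?(ltW hj10)//; lra.
    by rewrite !mulrBr !mulr1 mulrCA => ?; lra.
  by move=> x; case: a3 => a31 a32; split; [exact: a31|exact: a32].
pose fs := fix fs j := if j is i.+1 then (G (i, fs i)).1.1 else cc c%:C%C.
pose Ls j := (G (j, fs j)).1.2; pose Ns j := (G (j, fs j)).2.
have gd j : good j (fs j).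
  elim: j => [|j IH]; last by have [] := HG (j, fs j) IH.
  split=> [s us|n].
    rewrite /h expr0 subrr addr0.
    have [sn|sn] := boolP (0 \in s).
      rewrite (bigD1_seq 0)//= coef_cc eqxx mulr1 normcR gtr0_norm// big1 ?addr0//.
      by move=> n /negbTE n0; rewrite coef_cc n0 mulr0 normc0 (phi0 phi_orlicz).
    rewrite big_seq big1// => n ns.
    have /negbTE n0 : n != 0 by apply: contraNneq sn => <-.
    by rewrite coef_cc n0 mulr0 normc0 (phi0 phi_orlicz).
  rewrite coef_cc normcM normcR normc_nat gtr0_norm//.
  rewrite /h expr0 subrr mulr0 addr0 ler_piMr ?(ltW c0)//.
  by case: (n == 0).
exists dl, kap, (phi c + 1), fs, Ls, Ns; split => //.
- split => //; rewrite coef_cc eqxx mulr1 normcR gtr0_norm//; lra.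
- by move=> j; have [] := HG (j, fs j) (gd j).
- by move=> j x; have [_ _ H _] := HG (j, fs j) (gd j); exact: H.
split=> [j n|j s us]; first by have [_ _ _ H] := HG (j, fs j) (gd j); exact: H.
apply: le_trans ((gd j).1 s us) _; rewrite lerD2l gerBl ltW//.
Qed.

End Sequence.

(** * Periodic functions on the quotient, and its compactness *)

Section CircleTopology.
Variable R : realType.
Local Notation C := R[i].
Local Notation tau := (@trigo.pi R *+ 2).

Lemma tproj_repr (t : circle R) : tproj (repr t) = t.
Proof. exact: reprK. Qed.

Lemma tproj_eq (x y : R) : tproj x = tproj y -> exists k : int, y = x + tau *~ k.
Proof. by move=> /eqmodP/asboolP. Qed.

Lemma cpf_repr (f : cpf R) x : f (repr (tproj x)) = f x.
Proof.
have [k ->] := tproj_eq (esym (tproj_repr (tproj x))).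
by rewrite cpf_perz.
Qed.

Lemma real_repr (u : R -> R) x : continuous u -> (forall y, u (y + tau) = u y) ->
  u (repr (tproj x)) = u x.
Proof.
move=> cu pu; have [f fE] := real_cpf cu pu.
by have := cpf_repr f x; rewrite !fE => -[].
Qed.

Lemma continuous_repr (u : R -> R) : continuous u -> (forall y, u (y + tau) = u y) ->
  continuous (fun t : circle R => u (repr t)).
Proof.
move=> cu pu; apply: (repr_comp_continuous cu) => a b /eqP ab; apply/eqP.
by rewrite -(real_repr a cu pu) -(real_repr b cu pu); congr (u (repr _)).
Qed.

Lemma compact_circle : compact [set: circle R].
Proof.
have -> : [set: circle R] = (@tproj R) @` `[0, tau].
  apply/seteqP; split => // t _.
  have [k /andP[k1 k2]] := near0_shift (repr t - pi).
  exists (repr t + tau *~ k).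
    by rewrite /= in_itv /=; apply/andP; split; lra.
  rewrite -[RHS]tproj_repr; apply/eqmodP; apply/asboolP; exists (- k).
  by rewrite mulrNz addrK.
apply: continuous_compact; last exact: segment_compact.
by apply: continuous_subspaceT => x; exact: pi_continuous.
Qed.

End CircleTopology.

Section Trigonometric.
Variable R : realType.
Local Notation C := R[i].

Lemma trig_is_derive (a b : R) (n : int) (x : R) :
  is_derive x 1 (fun x : R => a * cos (x *~ n) + b * sin (x *~ n))
    ((b * n%:~R) * cos (x *~ n) + (- a * n%:~R) * sin (x *~ n)).
Proof.
have d1 := is_derive_mulz n x.
have d2 : is_derive x 1 (fun x => sin (x *~ n)) (cos (x *~ n) *: n%:~R).
  exact: (@is_derive1_comp _ sin (fun x => x *~ n)).
have d3 : is_derive x 1 (fun x => cos (x *~ n)) (- sin (x *~ n) *: n%:~R).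
  exact: (@is_derive1_comp _ cos (fun x => x *~ n)).
by apply: is_derive_eq; rewrite /GRing.scale /=; ring.
Qed.

Lemma trig_derive1n (n : int) k (a b : R) : exists a' b' : R,
  (fun x : R => a * cos (x *~ n) + b * sin (x *~ n))^`(k)%classic =
  (fun x : R => a' * cos (x *~ n) + b' * sin (x *~ n)).
Proof.
elim: k => [|k [a' [b' IH]]]; first by exists a, b.
exists (b' * n%:~R), (- a' * n%:~R).
rewrite derive1nS IH; apply/funext => x; rewrite derive1E.
by have := trig_is_derive a' b' n x; case.
Qed.

Lemma smooth_expi (n : int) : smooth (@expi R n).
Proof.
have dk k (a b x : R) :
   derivable (fun x : R => a * cos (x *~ n) + b * sin (x *~ n))^`(k)%classic x 1.
  have [a' [b' ->]] := trig_derive1n n k a b.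
  by have := trig_is_derive a' b' n x; case.
have re : lift_re (@expi R n) = fun x : R => 1 * cos (x *~ n) + 0 * sin (x *~ n).
  by apply/funext => x; rewrite /lift_re expiE /= mul1r mul0r addr0.
have im : lift_im (@expi R n) = fun x : R => 0 * cos (x *~ n) + 1 * sin (x *~ n).
  by apply/funext => x; rewrite /lift_im expiE /= mul1r mul0r add0r.
by move=> k x; rewrite re im.
Qed.

End Trigonometric.

(** * The distribution S, its coefficients and its support *)

Section Distribution.
Variable R : realType.
Local Notation C := R[i].
Local Notation ce := (ce R).
Variable phi : R -> R.
Hypothesis phi_orlicz : orlicz_function phi.
Variables (dl kap Bd : R) (fs : nat -> cpf R) (Ls Ns : nat -> nat).
Hypothesis kap_gt0 : 0 < kap.
Hypothesis kap_coef : 4 * kap <= normc (coef (fs 0%N) 0).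
Hypothesis fs_zero : forall j x, (trigavg (Ls j) (Ns j) x <= dl -> fs j.+1 x = 0) /\
  (fs j x = 0 -> fs j.+1 x = 0).
Hypothesis fs_coef :
  forall j n, normc (coef (fs j.+1) n - coef (fs j) n) <= kap * 2^-1 ^+ j.+1.
Hypothesis fs_modular : forall j, modular_le phi (coef (fs j)) Bd.

(** f_j acts as the measure f_j dx / (2 pi), so that its coefficients as a distribution are those
    given by [coef]. Using [cmean] instead of [M] allows arbitrary g. *)
Definition pairing (g : circle R -> C) (j : nat) : C :=
  cmean (fun x => fs j x * g (tproj x)).

(** The default 0 is taken if the pairings diverge, which never happens for smooth g. *)
Definition limit_val (g : circle R -> C) : C := xget 0 [set l | clim (pairing g) l].

Lemma pairingE g (f : cpf R) j : (forall x, f x = g (tproj x)) ->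
  pairing g j = M (fs j * f).
Proof.
move=> fg; rewrite /M; congr cmean; apply/funext => x.
by rewrite cpfM fg.
Qed.

(** The coefficients of f_(j+1) - f_j are uniformly small and those of g are summable; 192 = 12 * 16
    combines [pairing_bound] with [smooth_decay]. *)
Lemma pairing_geo g j : smooth g ->
  normc (pairing g j.+1 - pairing g j) <= (192 * kap * Cnorm 2 g) * 2^-1 ^+ j.+1.
Proof.
move=> sg; have [f fg] := smooth_cpf sg.
rewrite !(pairingE _ fg) -MB -mulrBl.
have C0 : 0 <= Cnorm 2 g by apply: le_trans (dern_Cnorm (k := 0) 0 sg isT); exact: normc_ge0.
have h0 : 0 <= kap * 2^-1 ^+ j.+1 by rewrite mulr_ge0 ?(ltW kap_gt0)// exprn_ge0// invr_ge0.
have q0 : 0 <= 16 * Cnorm 2 g by rewrite mulr_ge0.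
have := pairing_bound h0 q0 (g := fs j.+1 - fs j) (f := f) _ (smooth_decay sg fg).
have cb n : normc (coef (fs j.+1 - fs j) n) <= kap * 2^-1 ^+ j.+1.
  by rewrite coefB.
move=> /(_ cb) /le_trans; apply; rewrite le_eqVlt; apply/orP; left; apply/eqP.
by move: (Cnorm _ _) (2^-1 ^+ _) => u v; ring.
Qed.

Lemma limit_geo g : smooth g ->
  (forall j, normc (limit_val g - pairing g j) <= 384 * kap * Cnorm 2 g * 2^-1 ^+ j) /\
  clim (pairing g) (limit_val g).
Proof.
move=> sg; have [l Hl] := geo_limit (fun j => pairing_geo j sg).
have C0 : 0 <= Cnorm 2 g by apply: le_trans (dern_Cnorm (k := 0) 0 sg isT); exact: normc_ge0.
have eK : 2 * (192 * kap * Cnorm 2 g) = 384 * kap * Cnorm 2 g by ring.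
rewrite eK in Hl.
have cl : clim (pairing g) l.
  apply: geo_clim Hl; apply: mulr_ge0 => //.
  by apply: mulr_ge0; [exact: ler0n|exact: ltW].
have -> : limit_val g = l.
  apply: (clim_uniq _ cl); exact: (@xgetPex _ 0 _ (ex_intro _ l cl)).
by [].
Qed.

Lemma limit_linear (a : C) f g : smooth f -> smooth g ->
  limit_val (fun t => a * f t + g t) = a * limit_val f + limit_val g.
Proof.
move=> sf sg; have [_ lf] := limit_geo sf; have [_ lg] := limit_geo sg.
have cl : clim (pairing (fun t => a * f t + g t)) (a * limit_val f + limit_val g).
  apply: clim_eq (clim_lin a lf lg) => j.
  have [ff fE] := smooth_cpf sf; have [gg gE] := smooth_cpf sg.
  rewrite (pairingE _ fE) (pairingE _ gE) -MZ -MD.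
  rewrite (@pairingE _ (cc a * ff + gg)); last first.
    by move=> x; rewrite cpfD cpfM ccE fE gE.
  by congr M; ring.
by apply: (clim_uniq _ cl); exact: (@xgetPex _ 0 _ (ex_intro _ _ cl)).
Qed.

Lemma limit_bounded : exists (K : R) (N : nat), forall f,
  smooth f -> normc (limit_val f) <= K * Cnorm N f.
Proof.
have [B B0 HB] := cpf_bounded (fs 0%N).
exists (384 * kap + 192 * B), 2%N => g sg.
have [H _] := limit_geo sg; have := H 0%N; rewrite expr0 mulr1 => h1.
have [f fg] := smooth_cpf sg.
have C0 : 0 <= Cnorm 2 g by apply: le_trans (dern_Cnorm (k := 0) 0 sg isT); exact: normc_ge0.
have q0 : 0 <= 16 * Cnorm 2 g by rewrite mulr_ge0.
have h2 := pairing_bound B0 q0 (fun n => normc_coef_bound n HB) (smooth_decay sg fg).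
rewrite -(pairingE _ fg) in h2.
have -> : limit_val g = (limit_val g - pairing g 0%N) + pairing g 0%N by rewrite subrK.
apply: le_trans (le_normcD _ _) _; rewrite mulrDl; apply: lerD => //.
by apply: le_trans h2 _; rewrite le_eqVlt; apply/orP; left; apply/eqP; ring.
Qed.

Definition limit_distribution : schwartz_distribution R :=
  SchwartzDistribution limit_linear limit_bounded.

Lemma pairing_expi n j : pairing (expi (- n)) j = coef (fs j) n.
Proof. by rewrite (@pairingE _ (ce (- n)))// => x; rewrite expiE ceE. Qed.

Lemma fourier_clim n : clim (fun j => coef (fs j) n) (dist_fourier limit_distribution n).
Proof.
have [_ H] := limit_geo (smooth_expi (- n)).
by apply: clim_eq H => j; exact: pairing_expi.
Qed.

Lemma limit_nonzero : dist_nonzero limit_distribution.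
Proof.
exists (expi (- 0)); first exact: smooth_expi.
rewrite -[limit_distribution _]/(dist_fourier limit_distribution 0).
have [l Hl] := geo_limit (fun j => fs_coef j 0).
have lE : dist_fourier limit_distribution 0 = l.
  apply: (clim_uniq (fourier_clim 0)); apply: geo_clim Hl.
  by rewrite mulr_ge0// ltW.
(* The limit is within 2 kap of the initial coefficient, whose modulus is at least 4 kap. *)
rewrite lE; apply/eqP => l0; have := Hl 0%N.
rewrite l0 sub0r normcN expr0 mulr1 => h; have := le_trans kap_coef h.
by rewrite ler_pM2r// ler_nat.
Qed.

(** A Fatou argument: on a finite set of frequencies, half the modulus of the limit is eventually
    below that of the coefficient of f_j. Taking rho = 2 provides this half and dispenses with
    continuity of phi. *)
Lemma limit_orlicz : orlicz_space phi (dist_fourier limit_distribution).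
Proof.
exists 2 => //; apply: (@le_lt_trans _ _ Bd%:E); last by rewrite ltry.
apply: ge_ereal_sup => _ [A [finA _] <-].
rewrite fsbig_finite//= sumEFin lee_fin.
have us := fset_uniq (fset_set A).
move: (enum_fset (fset_set A)) us => s us.
pose c := dist_fourier limit_distribution.
have half n : exists j0, forall j, (j0 <= j)%N -> normc (c n) / 2 <= normc (coef (fs j) n).
  have [c0|c0] := eqVneq (normc (c n)) 0.
    by exists 0%N => j _; rewrite c0 mul0r normc_ge0.
  have cp : 0 < normc (c n) by rewrite lt_neqAle eq_sym c0 normc_ge0.
  have [j0 Hj] := fourier_clim n (divr_gt0 cp (ltr0n _ 2)).
  exists j0 => j /Hj h.
  have : normc (c n) <= normc (c n - coef (fs j) n) + normc (coef (fs j) n).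
    by apply: le_trans (le_normcD _ _); rewrite subrK.
  by move: h; rewrite -/c => h ?; lra.
have [j Hj] : exists j, forall n, n \in s -> normc (c n) / 2 <= normc (coef (fs j) n).
  have /choice[J HJ] := half; exists (\max_(n <- s) J n)%N => n ns; apply: HJ.
  exact: leq_bigmax_seq.
apply: le_trans (fs_modular j us); rewrite big_seq [leRHS]big_seq.
apply: ler_sum => n ns; apply: (phi_mono phi_orlicz); last exact: Hj.
by rewrite divr_ge0// normc_ge0.
Qed.

Lemma trigavg_circle_open j :
  open [set t : circle R | trigavg (Ls j) (Ns j) (repr t) < dl].
Proof.
have /continuousP/(_ [set y | y < dl] (@open_lt _ dl)) :=
  continuous_repr (@trigavg_cont R (Ls j) (Ns j)) (@trigavg_per R (Ls j) (Ns j)).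
by [].
Qed.

Lemma trigavg_circle_closed :
  closed [set t : circle R | forall j, dl <= trigavg (Ls j) (Ns j) (repr t)].
Proof.
set K := [set t | _]; rewrite -[K]setCK; apply: open_closedC.
rewrite (_ : ~` K = \bigcup_j [set t : circle R | trigavg (Ls j) (Ns j) (repr t) < dl]).
  by apply: bigcup_open => i _; exact: trigavg_circle_open.
apply/seteqP; split => t.
  by move=> /existsNP[j /negP]; rewrite -ltNge => ?; exists j.
by move=> [j _] /= tj /(_ j); rewrite leNgt tj.
Qed.

(** A test function supported off K has compact support, covered by finitely many of the open sets
    where some P_k is below [dl]. Zeros persist along the sequence, so from some index on f_i
    vanishes on that support and the pairing is 0. *)
Lemma limit_support : dist_support limit_distribution `<=`
  [set t | forall j, dl <= trigavg (Ls j) (Ns j) (repr t)].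
Proof.
move=> t tS j; rewrite leNgt; apply/negP => tj; apply: tS.
exists (~` [set t | forall j, dl <= trigavg (Ls j) (Ns j) (repr t)]); last first.
  by move=> /(_ j); rewrite leNgt tj.
split; first exact/closed_openC/trigavg_circle_closed.
move=> g sg gU; apply: clim_uniq (proj2 (limit_geo sg)) _.
have cK : compact (closure [set t | g t != 0]).
  by apply: (subclosed_compact _ (@compact_circle R)) => //; exact: closed_closure.
move: cK; rewrite compact_cover => /(_ nat setT
  (fun j => [set t : circle R | trigavg (Ls j) (Ns j) (repr t) < dl])).
case.
- by move=> i _; exact: trigavg_circle_open.
- by move=> u /gU/existsNP[i /negP]; rewrite -ltNge => ui; exists i.
move=> D _ cov; pose J := (\max_(i <- enum_fset D) i.+1)%N.
apply: (clim0 (j0 := J)) => i Ji.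
have [f fg] := smooth_cpf sg; rewrite (pairingE _ fg).
rewrite (_ : fs i * f = 0) ?raddf0//; apply: cpfP => x; rewrite cpfM cpf0 fg.
have [->|gx] := eqVneq (g (tproj x)) 0; first by rewrite mulr0.
have [k kD kx] : (cover [set` D] (fun j => [set t : circle R | trigavg (Ls j) (Ns j) (repr t) < dl])) (tproj x).
  by apply: cov; apply: subset_closure.
have xk : trigavg (Ls k) (Ns k) x <= dl.
  by rewrite -(real_repr x (@trigavg_cont R (Ls k) (Ns k)) (@trigavg_per R (Ls k) (Ns k))) ltW.
have zk : fs k.+1 x = 0 by exact: (proj1 (fs_zero k x)).
have zi m : fs (k.+1 + m)%N x = 0.
  by elim: m => [|m IH]; [rewrite addn0|rewrite addnS; exact: (proj2 (fs_zero _ x))].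
have ki : (k.+1 <= i)%N.
  by apply: leq_trans Ji; apply: (leq_bigmax_seq _ kD).
by rewrite -(subnKC ki) zi mul0r.
Qed.

End Distribution.

(** * Measures whose coefficients vanish at infinity *)

Section Arcs.
Variable R : realType.
Local Notation tau := (@trigo.pi R *+ 2).

(** An arc with rational data, described by the cosine of the angle to its centre: this form is
    periodic and needs no case for arcs across the endpoint of a period. Countability of the family
    allows passage from open sets to countable unions. *)
Definition arc (q : rat * rat) : set (circle R) :=
  [set t | ratr q.2 < cos (repr t - ratr q.1)].

Lemma cos_abs_le (d y : R) : 0 <= d <= pi -> - pi <= y <= pi -> cos d < cos y -> `|y| < d.
Proof.
move=> hd /andP[y1 y2]; have -> : cos y = cos `|y| by case: (ger0P y); rewrite ?cosN.
rewrite ltr_cos// in_itv/=; first by rewrite normr_ge0 ler_norml y1 y2.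
Qed.

Lemma arc_base (U : set (circle R)) (t : circle R) : open U -> U t ->
  exists q, arc q t /\ arc q `<=` U.
Proof.
move=> oU Ut; pose x := repr t.
have [r r0 Hr] : exists2 r, 0 < r & forall y, `|x - y| < r -> U (tproj y).
  have : nbhs x [set y | U (tproj y)].
    apply: open_nbhs_nbhs; split; last by rewrite /= /x tproj_repr.
    exact: oU.
  by case/nbhs_ballP => r r0 Hr; exists r.
pose d : R := Num.min (r / 2) 1.
have d0 : 0 < d by rewrite lt_min divr_gt0//= ltr01.
have dr : d + d <= r by rewrite [leRHS]splitr lerD// ge_min lexx.
have dpi : d <= pi.
  by apply: (@le_trans _ _ 2); [rewrite ge_min ler1n orbT|exact: pi_ge2].
have [q /andP[xq qx]] : exists q : rat, x < ratr q < x + d.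
  have [q] := rat_in_itvoo (ltr_pwDr d0 (lexx x)).
  by rewrite in_itv/= => h; exists q.
have dq : `|x - ratr q| < d by rewrite distrC ltr_norml; move: xq qx d0 => *; lra.
have cosd : cos d < cos (x - ratr q).
  have -> : cos (x - ratr q) = cos `|x - ratr q| by case: (ger0P (x - ratr q)); rewrite ?cosN.
  rewrite ltr_cos// in_itv/= ?normr_ge0 ?(ltW d0)//.
  exact: le_trans (ltW dq) dpi.

have [c] := rat_in_itvoo cosd; rewrite in_itv/= => /andP[c1 c2].
exists (q, c); split => // s /=; rewrite /arc/= => cs.
have [k Hk] := near0_shift (repr s - ratr q).
have := @cos_abs_le d _ _ Hk; rewrite (ltW d0) dpi => /(_ isT).
have -> : cos (repr s - ratr q + tau *~ k) = cos (repr s - ratr q).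
  have := cpf_perz (cosn R 1) (repr s - ratr q) k; rewrite !cosnE !mulr1z.
  by case.
move=> /(_ (lt_trans c1 cs)) hk.
have -> : s = tproj (repr s + tau *~ k).
  rewrite -[LHS]tproj_repr; apply/eqmodP/asboolP; by exists k.
apply: Hr; move: hk dq dr; rewrite !ltr_norml.
by move: (tau *~ k) (repr s) (ratr q : R) => a b z h1 h2 ?; move: h1 h2 => /andP[? ?] /andP[? ?]; apply/andP; split; lra.
Qed.

Lemma arc_cozero q : exists u : R -> R, [/\ continuous u, forall x, u (x + tau) = u x,
  forall x, 0 <= u x & arc q = [set t | 0 < u (repr t)]].
Proof.
pose c : R := ratr q.2; pose v x := cos (x - ratr q.1 : R) - c.
have cv : continuous v.
  move=> x; apply: (@cvgB _ R^o); last exact: cvg_cst.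
  apply: (@continuous_comp _ _ _ (fun x : R => x - ratr q.1) cos); last exact: continuous_cos.
  by apply: (@cvgB _ R^o); [exact: cvg_id|exact: cvg_cst].
exists (fun x => `|v x| + v x); split.
- move=> x; apply: (@cvgD _ R^o); last exact: cv.
  by apply: (@cvg_norm _ R^o); exact: cv.
- by move=> x; rewrite /v addrAC cosD2pi.
- by move=> x; rewrite -[leLHS](subrr `|v x|) lerD2l lerNl ler_normr lexx orbT.
- apply/seteqP; split => t /=; rewrite /arc/= -/c -subr_gt0 -/(v (repr t)).
    by move=> h; rewrite ltr_wpDl.
  by apply: contraTT; rewrite -!leNgt => h; rewrite ler0_norm// addNr.
Qed.

(** Pairs of rationals are enumerated by [pickle]; u_i belongs to the i-th arc if that arc lies in
    U, and is 0 otherwise. *)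
Lemma open_cozero (U : set (circle R)) : open U -> exists u : nat -> R -> R,
  [/\ forall i, continuous (u i), forall i x, u i (x + tau) = u i x,
    forall i x, 0 <= u i x & U = [set t | exists i, 0 < u i (repr t)]].
Proof.
move=> oU.
have /choice[u Hu] : forall i : nat, exists u : R -> R, [/\ continuous u, forall x, u (x + tau) = u x,
    forall x, 0 <= u x & ([set t | 0 < u (repr t)] `<=` U) /\
      forall q : rat * rat, choice.pickle q = i -> arc q `<=` U -> arc q `<=` [set t | 0 < u (repr t)]].
  move=> i; have [[q qi qU]|nq] := pselect (exists2 q : rat * rat, choice.pickle q = i & arc q `<=` U).
    have [u [u1 u2 u3 u4]] := arc_cozero q; exists u; split => //.
    split; first by rewrite -u4.
    by move=> q' q'i _; rewrite -u4 (pcan_inj choice.pickleK (etrans q'i (esym qi))).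
  exists (fun=> 0); split => //; first by move=> x; exact: cvg_cst.
  split; first by move=> t /=; rewrite ltxx.
  by move=> q qi qU; exfalso; apply: nq; exists q.
exists u; split; [by move=> i; case: (Hu i)|by move=> i; case: (Hu i)|by move=> i; case: (Hu i)|].
apply/seteqP; split => t /=.
  move=> Ut; have [q [qt qU]] := arc_base oU Ut; exists (choice.pickle q).
  by case: (Hu (choice.pickle q)) => _ _ _ [_ /(_ q erefl qU)]; exact.
by case=> i; case: (Hu i) => _ _ _ [h _]; exact: h.
Qed.

End Arcs.

(** * Integrals of continuous functions over Borel subsets of the circle *)

Section CircleIntegral.
Variable R : realType.
Local Notation C := R[i].
Local Notation X := (borel_circle R).
Local Notation tau := (@trigo.pi R *+ 2).
Implicit Types (f g : cpf R) (m : {measure set X -> \bar R}) (A B : set X).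

Lemma open_circle_measurable (U : set (circle R)) : open U -> measurable (U : set X).
Proof. exact: sub_sigma_algebra. Qed.

Lemma continuous_circle_measurable (u : circle R -> R) : continuous u ->
  measurable_fun [set: X] (u : X -> R).
Proof.
move=> /continuousP cu; apply: (measurability _ (measurable_realfun.RGenOpens.measurableE R)).
move=> _ [_ [a [b ->] <-]]; rewrite setTI; apply: open_circle_measurable.
exact/cu/interval_open.
Qed.

Lemma fin_subset m A : (m setT < +oo)%E -> measurable A -> (m A < +oo)%E.
Proof.
move=> fm mA; apply: le_lt_trans fm; apply: le_measure => //.
- exact: mem_set.
- exact/mem_set/measurableT.
Qed.

Lemma bounded_cont_integrable m A (u : R -> R) : (m setT < +oo)%E -> measurable A ->
  continuous u -> (forall x, u (x + tau) = u x) ->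
  m.-integrable A (EFin \o (fun t : X => u (repr t))).
Proof.
move=> fm mA cu pu; apply: measurable_bounded_integrable => //.
- exact: fin_subset.
- apply: measurable_funTS; apply: continuous_circle_measurable.
  exact: continuous_repr.
- have [f fE] := real_cpf cu pu; have [b b0 fb] := cpf_bounded f.
  exists b; split; first exact: num_real.
  move=> c bc t _ /=; apply: le_trans (ltW bc); apply: le_trans (fb (repr t)).
  by rewrite fE normcR.
Qed.

Lemma cpf_integrable m A f : (m setT < +oo)%E -> measurable A ->
  m.-integrable A (EFin \o (fun t : X => complex.Re (f (repr t)))) /\
  m.-integrable A (EFin \o (fun t : X => complex.Im (f (repr t)))).
Proof.
move=> fm mA; split.
  apply: (@bounded_cont_integrable m A (fun x => complex.Re (f x))) => //.
    exact: cpf_contRe.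
  by move=> x; rewrite cpf_per.
apply: (@bounded_cont_integrable m A (fun x => complex.Im (f x))) => //.
  exact: cpf_contIm.
by move=> x; rewrite cpf_per.
Qed.

Definition cint m A f : C :=
  ((\int[m]_(t in A) complex.Re (f (repr t)))%R +i*
   (\int[m]_(t in A) complex.Im (f (repr t)))%R)%C.

Lemma cintD m A f g : (m setT < +oo)%E -> measurable A ->
  cint m A (f + g) = cint m A f + cint m A g.
Proof.
move=> fm mA; have [fr fi] := cpf_integrable f fm mA.
have [gr gi] := cpf_integrable g fm mA; rewrite /cint.
under eq_Rintegral do rewrite cpfD raddfD.
rewrite RintegralD//.
under [X in (_ +i* X)%C = _]eq_Rintegral do rewrite cpfD raddfD.
by rewrite RintegralD.
Qed.

Lemma cintZ m A a f : (m setT < +oo)%E -> measurable A ->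
  cint m A (cc a * f) = a * cint m A f.
Proof.
move=> fm mA; have [fr fi] := cpf_integrable f fm mA.
case: a => a b; rewrite /cint.
have Zl (c : R) (u : X -> R) : m.-integrable A (EFin \o u) ->
    m.-integrable A (EFin \o (fun t => c * u t)).
  by move=> iu; have := integrableZl mA c iu; apply: eq_integrable.
rewrite (@eq_Rintegral _ _ _ m A (fun t : X => a * complex.Re (f (repr t)) - b * complex.Im (f (repr t)))); last first.
  by move=> t _; rewrite cpfM ccE; case: (f (repr t)).
rewrite RintegralB ?RintegralZl//; try exact: Zl.
rewrite [X in (_ +i* X)%C = _](@eq_Rintegral _ _ _ m A (fun t : X => a * complex.Im (f (repr t)) + b * complex.Re (f (repr t)))); last first.
  by move=> t _; rewrite cpfM ccE; case: (f (repr t)).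
by rewrite RintegralD ?RintegralZl//; try exact: Zl.
Qed.

Lemma eq_cint m A f g : (forall t, A t -> f (repr t) = g (repr t)) ->
  cint m A f = cint m A g.
Proof.
by move=> fg; rewrite /cint; congr (_ +i* _)%C; apply: eq_Rintegral => t /set_mem/fg ->.
Qed.

Lemma cint_setD m A B f : (m setT < +oo)%E -> measurable A -> measurable B -> B `<=` A ->
  cint m (A `\` B) f = cint m A f - cint m B f.
Proof.
move=> fm mA mB BA; apply/eqP; rewrite eq_sym subr_eq; apply/eqP.
have mD : measurable (A `\` B) by exact: measurableD.
have AE : A = (A `\` B) `|` B by rewrite setUC setDUK.
have [fr fi] := cpf_integrable f fm mA.
have dAB : [disjoint A `\` B & B] by apply/disj_setPS => t [[]].
rewrite /cint [in LHS]AE !Rintegral_setU -?AE//.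
Qed.

Lemma Rintegral_bound m A (u : X -> R) (b : R) : (m setT < +oo)%E -> measurable A ->
  m.-integrable A (EFin \o u) -> (forall t, A t -> `|u t| <= b) ->
  `|\int[m]_(t in A) u t| <= b * fine (m A).
Proof.
move=> fm mA iu ub; apply: le_trans (le_normr_Rintegral mA iu) _.
rewrite -Rintegral_cst//; apply: le_Rintegral => //.
- exact: integrable_norm.
- apply: measurable_bounded_integrable => //.
  + exact: fin_subset.
  + exists `|b|; split; first exact: num_real.
    by move=> c bc t _ /=; exact: ltW.
Qed.

Lemma cint_bound m A f (b : R) : (m setT < +oo)%E -> measurable A ->
  (forall t, A t -> normc (f (repr t)) <= b) ->
  normc (cint m A f) <= 2 * b * fine (m A).
Proof.
move=> fm mA fb; have [fr fi] := cpf_integrable f fm mA.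
apply: le_trans (normc_ReIm _) _; rewrite /= mulr_natl mulrnAl mulr2n.
apply: lerD; apply: Rintegral_bound => // t /fb; apply: le_trans.
  exact: normc_Re.
exact: normc_Im.
Qed.

End CircleIntegral.

(** * Restriction to Borel sets preserves decay of coefficients *)

Section Rajchman.
Variable R : realType.
Local Notation C := R[i].
Local Notation X := (borel_circle R).
Local Notation tau := (@trigo.pi R *+ 2).
Local Notation ce := (ce R).
Implicit Types (f g : cpf R) (A B : set X).

Lemma null_tail (m : {measure set X -> \bar R}) (F : (set X)^nat) (e : R) :
  (m setT < +oo)%E -> (forall k, measurable (F k)) ->
  {homo F : i j / (i <= j)%N >-> i `<=` j} -> 0 < e ->
  exists k0, forall k, (k0 <= k)%N -> fine (m ((\bigcup_i F i) `\` F k)) <= e.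
Proof.
move=> fm mF homF e0; pose D k := (\bigcup_i F i) `\` F k.
have mD k : measurable (D k) by apply: measurableD => //; exact: bigcup_measurable.
have capD : \bigcap_k D k = set0.
  by apply/seteqP; split => // t Dt; have [[k _ Fk] _] := Dt 0%N I; have [_] := Dt k I.
have mcap : measurable (\bigcap_k D k) by rewrite capD.
have homD : {homo D : i j / (i <= j)%N >-> (i >= j)%O}.
  by move=> i j ij; apply/subsetPset => t [Ft nFt]; split => // /(homF _ _ ij).
have := nonincreasing_cvg_mu (fin_subset fm (mD 0%N)) mD mcap homD.
rewrite capD measure0 => /fine_cvg/cvgrPdist_le/(_ e e0)[k0 _ H].
exists k0 => k /H /=; rewrite sub0r normrN ger0_norm ?fine_ge0//.
Qed.

Variables (m1 m2 : {measure set X -> \bar R}).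
Hypothesis fin1 : (m1 setT < +oo)%E.
Hypothesis fin2 : (m2 setT < +oo)%E.

(** Integration against the signed measure m1 - m2, kept as a pair so that the two Jordan parts can
    be exchanged. *)
Definition dint A f : C := cint m1 A f - cint m2 A f.
Definition mass A : R := fine (m1 A) + fine (m2 A).

Definition decays A f := forall e, 0 < e -> exists N : nat, forall n : nat,
  (N <= n)%N -> normc (dint A (f * ce n%:Z)) <= e.

Lemma dintD A f g : measurable A -> dint A (f + g) = dint A f + dint A g.
Proof. by move=> mA; rewrite /dint !cintD// addrACA opprD. Qed.

Lemma dintZ A a f : measurable A -> dint A (cc a * f) = a * dint A f.
Proof. by move=> mA; rewrite /dint !cintZ// mulrBr. Qed.

Lemma dint_sum I (s : seq I) A (F : I -> cpf R) : measurable A ->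
  dint A (\sum_(i <- s) F i) = \sum_(i <- s) dint A (F i).
Proof.
move=> mA; elim: s => [|i s IH]; last by rewrite !big_cons dintD// IH.
by rewrite !big_nil; have := dintZ 0 0 mA; rewrite mulr0 mul0r.
Qed.

Lemma dint_setD A B f : measurable A -> measurable B -> B `<=` A ->
  dint (A `\` B) f = dint A f - dint B f.
Proof. by move=> mA mB BA; rewrite /dint !cint_setD// !opprD addrACA. Qed.

Lemma eq_dint A f g : (forall t, A t -> f (repr t) = g (repr t)) -> dint A f = dint A g.
Proof. by move=> fg; rewrite /dint; congr (_ - _); exact: eq_cint. Qed.

Lemma dint_bound A f (b : R) : measurable A -> (forall t, A t -> normc (f (repr t)) <= b) ->
  normc (dint A f) <= 2 * b * mass A.
Proof.
move=> mA fb; apply: le_trans (normcB _ _) _; rewrite /mass mulrDr.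
by apply: lerD; exact: cint_bound.
Qed.

Lemma mass_ge0 A : 0 <= mass A.
Proof. by rewrite addr_ge0 ?fine_ge0 ?measure_ge0. Qed.

Lemma mass_tail (F : (set X)^nat) (e : R) : (forall k, measurable (F k)) ->
  {homo F : i j / (i <= j)%N >-> i `<=` j} -> 0 < e ->
  exists k, mass ((\bigcup_i F i) `\` F k) <= e.
Proof.
move=> mF homF e0; have e20 : 0 < e / 2 by rewrite divr_gt0.
have [k1 H1] := null_tail fin1 mF homF e20.
have [k2 H2] := null_tail fin2 mF homF e20.
exists (maxn k1 k2); rewrite [leRHS]splitr; apply: lerD.
  by apply: H1; rewrite leq_maxl.
by apply: H2; rewrite leq_maxr.
Qed.

(** Decay survives approximation uniform in n; the passages to limits below are instances of
    this. *)
Lemma decays_approx A f :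
  (forall e, 0 < e -> exists A' f', decays A' f' /\
     forall n : nat, normc (dint A (f * ce n%:Z) - dint A' (f' * ce n%:Z)) <= e) ->
  decays A f.
Proof.
move=> H e e0; have e20 : 0 < e / 2 by rewrite divr_gt0.
have [A' [f' [d' Hd]]] := H _ e20; have [N HN] := d' _ e20.
exists N => n Nn; rewrite -(subrK (dint A' (f' * ce n%:Z)) (dint A _)).
apply: le_trans (le_normcD _ _) _; rewrite [leRHS]splitr.
by apply: lerD; [exact: Hd|exact: HN].
Qed.

Lemma decaysD A f g : measurable A -> decays A f -> decays A g -> decays A (f + g).
Proof.
move=> mA df dg e e0; have e20 : 0 < e / 2 by rewrite divr_gt0.
have [N HN] := df _ e20; have [N' HN'] := dg _ e20.
exists (maxn N N') => n; rewrite geq_max => /andP[h h']; rewrite mulrDl dintD//.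
apply: le_trans (le_normcD _ _) _; rewrite [leRHS]splitr.
by apply: lerD; [exact: HN|exact: HN'].
Qed.

Lemma decaysZ A a f : measurable A -> decays A f -> decays A (cc a * f).
Proof.
move=> mA df e e0; have a0 : 0 < normc a + 1 by rewrite ltr_wpDl ?normc_ge0.
have [N HN] := df _ (divr_gt0 e0 a0).
exists N => n /HN h; rewrite -mulrA dintZ// normcM.
have e1 : e = (normc a + 1) * (e / (normc a + 1)) by rewrite mulrC divfK// gt_eqF.
by rewrite [leRHS]e1; apply: ler_pM; rewrite ?normc_ge0// lerDl.
Qed.

Lemma decays0 A : measurable A -> decays A 0.
Proof.
move=> mA e e0; exists 0%N => n _; rewrite mul0r.
have -> : dint A 0 = 0 by have := dintZ 0 0 mA; rewrite mulr0 mul0r.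
by rewrite normc0 ltW.
Qed.

Lemma decays_sum I (s : seq I) A (F : I -> cpf R) : measurable A ->
  (forall i, decays A (F i)) -> decays A (\sum_(i <- s) F i).
Proof.
move=> mA dF; elim: s => [|i s IH]; first by rewrite big_nil; exact: (decays0 mA).
rewrite big_cons; exact: decaysD mA (dF i) IH.
Qed.

Lemma decays_ce A (k : int) : decays A 1 -> decays A (ce k).
Proof.
move=> d1 e e0; have [N HN] := d1 _ e0; exists (N + `|k|)%N => n Nn.
have -> : ce k * ce n%:Z = 1 * ce (absz (k + n%:Z)%R)%:Z.
  rewrite mul1r -ceD; congr (ce _); lia.
by apply: HN; lia.
Qed.

Hypothesis decaysT : decays setT 1.

(** For trigonometric polynomials decay is a shift of the index, and Fejer means approximate f
    uniformly. *)
Lemma decays_cpf f : decays setT f.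
Proof.
have mT : measurable [set: X] by exact: measurableT.
apply: decays_approx => e e0.
have c0 : 0 < 2 * mass setT + 1 by rewrite ltr_wpDl// mulr_ge0// mass_ge0.
have [N0 HN] := fejer_approx f (divr_gt0 e0 c0).
exists setT, (fejer N0.+1 f); split.
  apply: (decays_sum _ mT) => i; apply: (decays_sum _ mT) => j.
  exact: (decaysZ _ mT (decays_ce _ decaysT)).
move=> n; have -> : dint setT (f * ce n%:Z) - dint setT (fejer N0.+1 f * ce n%:Z) =
    dint setT ((f - fejer N0.+1 f) * ce n%:Z).
  by apply/eqP; rewrite subr_eq -(dintD _ _ mT) -mulrDl subrK.
apply: le_trans (@dint_bound _ _ (e / (2 * mass setT + 1)) mT _) _.
  by move=> t _; rewrite cpfM normcM normc_ce mulr1 cpfB; exact: HN.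
rewrite mulrAC mulrA ler_pdivrMr// [leRHS]mulrC ler_pM2r//.
by rewrite lerDl.
Qed.

Lemma decays_setD A B : measurable A -> measurable B -> B `<=` A ->
  decays A 1 -> decays B 1 -> decays (A `\` B) 1.
Proof.
move=> mA mB BA dA dB e e0; have e20 : 0 < e / 2 by rewrite divr_gt0.
have [N HN] := dA _ e20; have [N' HN'] := dB _ e20.
exists (maxn N N') => n; rewrite geq_max => /andP[h h']; rewrite dint_setD//.
apply: le_trans (normcB _ _) _; rewrite [leRHS]splitr.
by apply: lerD; [exact: HN|exact: HN'].
Qed.

Lemma decays_bigcup (F : (set X)^nat) : (forall k, measurable (F k)) ->
  {homo F : i j / (i <= j)%N >-> i `<=` j} -> (forall k, decays (F k) 1) ->
  decays (\bigcup_k F k) 1.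
Proof.
move=> mF homF dF; apply: decays_approx => e e0.
have e20 : 0 < e / 2 by rewrite divr_gt0.
have [k Hk] := mass_tail mF homF e20.
exists (F k), 1; split => // n.
have mU : measurable (\bigcup_k F k) by exact: bigcup_measurable.
have FU : F k `<=` \bigcup_k F k by move=> t Ft; exists k.
rewrite mul1r -dint_setD//; apply: le_trans (@dint_bound _ _ 1 _ _) _.
- exact: measurableD.
- by move=> t _; rewrite normc_ce.
- by rewrite mulr1 mulrC -ler_pdivlMr.
Qed.

(** The clamp of (k + 1) u vanishes off the set and equals 1 where u > 1 / (k + 1); it differs from
    the indicator only on a set whose mass tends to 0. *)
Lemma decays_cozero (u : R -> R) : continuous u -> (forall x, u (x + tau) = u x) ->
  (forall x, 0 <= u x) -> decays [set t | 0 < u (repr t)] 1.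
Proof.
move=> cu pu u0; set A : set X := [set t | _].
have cur := continuous_repr cu pu.
pose F k : set X := [set t | k.+1%:R^-1 < u (repr t)].
have mset (a : R) : measurable ([set t | a < u (repr t)] : set X).
  apply: open_circle_measurable.
  by have /continuousP/(_ _ (@open_gt _ a)) := cur.
have mA : measurable A by exact: mset.
have mF k : measurable (F k) by exact: mset.
have homF : {homo F : i j / (i <= j)%N >-> i `<=` j}.
  move=> i j ij t; apply: le_lt_trans.
  by rewrite lef_pV2 ?posrE ?ltr0n ?ler_nat.
have FA : \bigcup_k F k = A.
  apply/seteqP; split => [t [k _]|t] /=.
    by apply: lt_trans; rewrite invr_gt0 ltr0n.
  rewrite /A /= => ut; have [k _ /(_ k (leqnn k)) Hk] := near_infty_natSinv_lt (PosNum ut).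
  by exists k.
apply: decays_approx => e e0.
have e20 : 0 < e / 2 by rewrite divr_gt0.
have [k Hk] := mass_tail mF homF e20.
have [||f [f0 f1 _ fn]] := @clamp_cpf R (fun x => k.+1%:R * u x).
- by move=> x; apply: (@cvgM _ R^o); [exact: cvg_cst|exact: cu].
- by move=> x; rewrite pu.
exists setT, f; split; first exact: decays_cpf.
move=> n; rewrite mul1r.
have -> : dint setT (f * ce n%:Z) = dint A (f * ce n%:Z).
  apply/eqP; rewrite -subr_eq0 -dint_setD//.
  rewrite (@eq_dint _ _ (cc 0 * 1)); first by rewrite dintZ ?mul0r//; exact: measurableD.
  move=> t [_ /negP]; rewrite -leNgt => ut.
  rewrite !cpfM f0; first by rewrite cc0 cpf0 !mul0r.
  by rewrite pmulr_rle0 ?ltr0n.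
have FkA : F k `<=` A by move=> t; rewrite -FA => ?; exists k.
have -> : dint A (ce n%:Z) - dint A (f * ce n%:Z) = dint (A `\` F k) ((1 - f) * ce n%:Z).
  have mD : measurable (A `\` F k) by exact: measurableD.
  have E : ce n%:Z = (1 - f) * ce n%:Z + f * ce n%:Z by rewrite -mulrDl subrK mul1r.
  rewrite [X in dint A X - _]E dintD// addrK dint_setD//.
  rewrite [X in _ = _ - X](@eq_dint _ _ (cc 0 * 1)) ?dintZ ?mul0r ?subr0// => t Ft.
  rewrite !cpfM cpfB cpf1 f1 ?subrr ?cc0 ?cpf0 ?mul0r//.
  by have := ltW Ft; rewrite -[X in X <= _]mul1r ler_pdivrMr ?ltr0n// mulrC.
apply: le_trans (@dint_bound _ _ 1 _ _) _.
- exact: measurableD.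
- by move=> t _; rewrite cpfM normcM normc_ce mulr1 cpfB cpf1.
- by rewrite mulr1 mulrC -ler_pdivlMr -?FA.
Qed.

(** Partial sums of the functions u_i turn the countable union into an increasing one, as
    [decays_bigcup] requires. *)
Lemma decays_open (U : set (circle R)) : open U -> decays U 1.
Proof.
move=> oU; have [u [cu pu u0 UE]] := open_cozero oU.
pose w k x : R := \sum_(i < k) u i x.
pose F k : set X := [set t | 0 < w k (repr t)].
have cw k : continuous (w k).
  elim: k => [|k IH] x.
    by rewrite (_ : w 0%N = fun=> 0); [exact: cvg_cst|apply/funext => y; rewrite /w big_ord0].
  rewrite (_ : w k.+1 = fun y => w k y + u k y); last by apply/funext => y; rewrite /w big_ord_recr.
  by apply: (@cvgD _ R^o); [exact: IH|exact: cu].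
have pw k x : w k (x + tau) = w k x by apply: eq_bigr => i _; exact: pu.
have w0 k x : 0 <= w k x by exact: sumr_ge0.
have -> : U = \bigcup_k F k.
  rewrite UE; apply/seteqP; split => t.
    move=> [i ui]; exists i.+1 => //; rewrite /F /= /w.
    by rewrite (bigD1 ord_max)//= ltr_pwDl// sumr_ge0.
  move=> [k _]; rewrite /F /= /w => h; apply: contrapT => nu.
  suff : \sum_(i < k) u i (repr t) <= 0 by rewrite leNgt h.
  by apply: sumr_le0 => i _; rewrite leNgt; apply/negP => ?; apply: nu; exists i.
apply: decays_bigcup.
- move=> k; apply: open_circle_measurable.
  by have /continuousP/(_ _ (@open_gt _ 0)) := continuous_repr (cw k) (pw k).
- move=> i j ij t; rewrite /F /=; move/lt_le_trans; apply.
  by rewrite /w -(subnKC ij) big_split_ord /= lerDl sumr_ge0.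
- by move=> k; apply: decays_cozero.
Qed.

Lemma decays_measurable A : measurable A -> decays A 1.
Proof.
pose H : set (set X) := [set A | measurable A /\ decays A 1].
have lH : lambda_system setT H.
  split => //.
  - move=> B D DB [mB dB] [mD dD]; split; first exact: measurableD.
    exact: decays_setD.
  - move=> F homF HF; split; first by apply: bigcup_measurable => i _; case: (HF i).
    apply: decays_bigcup => [k|i j ij|k]; try by case: (HF k).
    by apply/subsetPset; exact: homF.
have oI : setI_closed (@open (circle R)) by move=> U V; exact: openI.
have oH : @open (circle R) `<=` H.
  by move=> U oU; split; [exact: open_circle_measurable|exact: decays_open].
by move=> mA; have [] := lambda_system_subset oI lH oH (fun Y _ t _ => I) mA.
Qed.

End Rajchman.

(** * Real charges carried by K *)

Section MeasureSide.
Variable R : realType.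
Local Notation C := R[i].
Local Notation X := (borel_circle R).
Local Notation tau := (@trigo.pi R *+ 2).
Local Notation ce := (ce R).
Implicit Types (f g : cpf R) (A B : set X).

(** Otherwise infinitely many terms of the modular would be at least phi (e / rho), which is
    positive by non-degeneracy. *)
Lemma orlicz_vanishing (phi : R -> R) (x : int -> C) (e : R) :
  orlicz_function phi -> ~ degenerate phi -> orlicz_space phi x -> 0 < e ->
  exists N : nat, forall n : int, (N <= `|n|)%N -> normc (x n) <= e.
Proof.
move=> phi_orlicz nondeg [rho rho0 S] e0; pose E := [set n | e < normc (x n)].
have c0 : 0 < phi (e / rho) by rewrite (phi_gt0 phi_orlicz nondeg)// divr_gt0.
have fE : finite_set E.
  apply: contrapT => infE; move: S; set s := (\esum_(_ in _) _)%E => S.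
  have s0 : (0 <= s)%E.
    apply: esum_ge0 => n _; rewrite lee_fin; apply: (phi_ge0 phi_orlicz).
    by rewrite divr_ge0 ?normc_ge0// ltW.
  have sE : s = (fine s)%:E by rewrite fineK// ge0_fin_numE.
  have [k /(_ k (leqnn k)) Hk] : exists k : nat, forall j, (k <= j)%N -> fine s < phi (e / rho) * j%:R.
    exists (Num.bound (fine s / phi (e / rho))) => j kj.
    rewrite mulrC -ltr_pdivrMr//; apply: lt_le_trans (_ : (Num.bound (fine s / phi (e / rho)))%:R <= _); last by rewrite ler_nat.
    by apply: archi_boundP; rewrite divr_ge0 ?fine_ge0// ltW.
  have [B BE kB] := infinite_set_fset k infE.
  have : (s >= (phi (e / rho) * k%:R)%:E)%E.
    apply: esum_ge; exists [set` B]; first by split => //; exact: finite_fset.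
    rewrite fsbig_finite//= set_fsetK sumEFin lee_fin.
    apply: (@le_trans _ _ (\sum_(n <- B) phi (e / rho))).
      rewrite big_const_seq count_predT iter_addr_0 -[leRHS]mulr_natr.
      by rewrite ler_pM2l// ler_nat.
    rewrite big_seq [leRHS]big_seq; apply: ler_sum => n nB.
    have := BE n nB; rewrite /E /= => en.
    apply: (phi_mono phi_orlicz); first by rewrite divr_ge0// ltW.
    by rewrite ler_pM2r ?invr_gt0// ltW.
  by rewrite sE lee_fin leNgt Hk.
exists (\max_(n <- fset_set E) `|n|.+1)%N => n; rewrite leNgt; apply: contraTN => en.
rewrite -ltnNge.
apply: (leq_bigmax_seq (F := fun n : int => (absz n).+1)) => //.
by rewrite in_fset_set//; exact: mem_set.
Qed.

Lemma cint_cj (m : {measure set X -> \bar R}) A f : (m setT < +oo)%E -> measurable A ->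
  cint m A (cj f) = (cint m A f)^*%C.
Proof.
move=> fm mA; have [_ fi] := cpf_integrable f fm mA.
rewrite /cint /=; congr (_ +i* _)%C.
  by apply: eq_Rintegral => t _; rewrite cjE; case: (f _).
rewrite -mulN1r -RintegralZl//.
by apply: eq_Rintegral => t _; rewrite cjE; case: (f _) => a b; rewrite /= mulN1r.
Qed.

(** The average P_j with exponentials in place of cosines: its frequencies are all positive, so
    decay at plus infinity is enough, and its real part is still P_j. *)
Definition trigcpf (L N : nat) : cpf R :=
  cc (N%:R^-1)%:C%C * \sum_(k < N) ce (L * 9 ^ k)%N%:Z.

Lemma trigcpf_Re L N x : complex.Re (trigcpf L N x) = trigavg L N x.
Proof.
rewrite /trigcpf cpfM ccE cpf_sum /trigavg.
have -> (a : R) (z : C) : complex.Re (a%:C%C * z) = a * complex.Re z.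
  by case: z => u v /=; rewrite mul0r subr0.
rewrite mulrC raddf_sum; congr (_ * _).
by apply: eq_bigr => k _; rewrite ceE.
Qed.

Lemma decays_null (m1 m2 : {measure set X -> \bar R}) A (dl : R) (Ls Ns : nat -> nat) :
  (m1 setT < +oo)%E -> (m2 setT < +oo)%E -> decays m1 m2 setT 1 -> measurable A ->
  m2 A = 0%E -> 0 < dl -> (forall j, (j <= Ls j)%N /\ (0 < Ns j)%N) ->
  (forall t, A t -> forall j, dl <= trigavg (Ls j) (Ns j) (repr t)) -> m1 A = 0%E.
Proof.
move=> fin1 fin2 d1 mA m2A dl0 LN At.
have fA : (m1 A < +oo)%E by exact: fin_subset.
have m1E : m1 A = (fine (m1 A))%:E by rewrite fineK// ge0_fin_numE.
rewrite m1E; congr (_%:E); apply/eqP; rewrite eq_le fine_ge0// andbT.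
rewrite -(pmulr_rle0 _ dl0); apply/ler_addgt0Pr => e e0; rewrite add0r.
(* The threshold for decay itself serves as the index: every frequency of [trigcpf] is at least Ls j
   >= j. *)
have [j Hj] := decays_measurable fin1 fin2 d1 mA e0.
have [jL N0] := LN j; pose T := trigcpf (Ls j) (Ns j).
have [Tr _] := cpf_integrable T fin1 mA.
have mean_le : normc (dint m1 m2 A T) <= e.
  have N1 : 0 < (Ns j)%:R^-1 :> R by rewrite invr_gt0 ltr0n.
  rewrite /T /trigcpf dintZ// dint_sum// normcM normcR gtr0_norm//.
  rewrite mulrC ler_pdivrMr ?ltr0n//; apply: le_trans (normc_le_sum _ _ _) _.
  apply: (@le_trans _ _ (\sum_(k < Ns j) e)).
    apply: ler_sum => k _; rewrite -[ce _]mul1r; apply: Hj.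
    by rewrite (leq_trans jL)// leq_pmulr// expn_gt0.
  by rewrite sumr_const card_ord mulr_natr.
have c2 : cint m2 A T = 0.
  have [b b0 Tb] := cpf_bounded T; apply: eq0_normc; apply/eqP.
  rewrite eq_le normc_ge0 andbT; apply: le_trans (cint_bound fin2 mA (fun t _ => Tb (repr t))) _.
  by rewrite m2A mulr0.
apply: le_trans mean_le; rewrite /dint c2 subr0.
apply: le_trans (normc_Re _); apply: le_trans (ler_norm _).
rewrite -Rintegral_cst// /cint /=; apply: le_Rintegral => //.
  apply: measurable_bounded_integrable => //.
  by exists `|dl|; split; [exact: num_real|move=> c ? t _ /=; exact: ltW].
by move=> t /At/(_ j); rewrite trigcpf_Re.
Qed.

Section Hahn.
Variables (nu : {charge set X -> \bar R}) (P N : set X).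
Hypothesis nuPN : hahn_decomposition nu P N.

Let mP : measurable P. Proof. by case: nuPN => [[]]. Qed.
Let mN : measurable N. Proof. by case: nuPN => _ []. Qed.

Lemma jordan_pos_val A : measurable A -> jordan_pos nuPN A = nu (A `&` P).
Proof. by move=> mA; rewrite jordan_posE cjordan_posE /crestr0 mem_set. Qed.

Lemma jordan_neg_val A : measurable A -> jordan_neg nuPN A = (- nu (A `&` N))%E.
Proof. by move=> mA; rewrite jordan_negE charge.cjordan_negE /crestr0 mem_set. Qed.

Lemma jordan_zero A : measurable A -> jordan_pos nuPN A = 0%E -> jordan_neg nuPN A = 0%E ->
  nu A = 0%E.
Proof.
move=> mA pA nA; rewrite (jordan_decomp nuPN mA) /cadd /= pA.
by rewrite /cscale /= nA mule0 adde0.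
Qed.

Lemma jordan_fin : (jordan_pos nuPN setT < +oo)%E /\ (jordan_neg nuPN setT < +oo)%E.
Proof. by split; rewrite -ge0_fin_numE// fin_num_measure. Qed.

(** Rational arcs reduce the cover to a countable one. A charge is not monotone, so negligibility is
    transferred to the two Jordan parts, where countable unions are harmless. *)
Lemma charge_null_local (W : set X) :
  (forall t, W t -> exists U : set (circle R), [/\ open U, U t &
     forall A, measurable A -> A `<=` U -> nu A = 0%E]) ->
  forall A, measurable A -> A `<=` W -> nu A = 0%E.
Proof.
move=> HW A mA AW.
have /choice[B HB] : forall i : nat, exists B : set X, [/\ measurable B,
    forall A, measurable A -> A `<=` B -> nu A = 0%E &
    forall q : rat * rat, choice.pickle q = i ->
      (forall A, measurable A -> A `<=` arc q -> nu A = 0%E) -> arc q `<=` B].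
  move=> i; have [[q qi qn]|nq] := pselect (exists2 q : rat * rat, choice.pickle q = i &
      forall A, measurable A -> A `<=` arc q -> nu A = 0%E).
    exists (arc q); split => //.
      have [u [cu pu _ ->]] := arc_cozero R q; apply: open_circle_measurable.
      by have /continuousP/(_ _ (@open_gt _ 0)) := continuous_repr cu pu.
    by move=> q' q'i _; rewrite (pcan_inj choice.pickleK (etrans q'i (esym qi))).
  exists set0; split => //.
    by move=> A' _; rewrite subset0 => ->; rewrite charge0.
  by move=> q qi qn; exfalso; apply: nq; exists q.
have AB : A `<=` \bigcup_i B i.
  move=> t /AW/HW[U [oU Ut Un]]; have [q [qt qU]] := arc_base oU Ut.
  exists (choice.pickle q) => //; have [_ _ h] := HB (choice.pickle q).
  by apply: (h q) => // A' mA' /subset_trans/(_ qU); exact: Un.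
have null (m : {measure set X -> \bar R}) : (forall i, m (B i) = 0%E) -> m A = 0%E.
  move=> mB; apply: measure_negligible => //; apply: negligibleS AB _.
  apply: negligible_bigcup => i; have [mBi _ _] := HB i.
  exact: (negligibleP m mBi).2 (mB i).
apply: jordan_zero => //.
  apply: (null (jordan_pos nuPN)) => i; have [mB nB _] := HB i.
  by apply: etrans (jordan_pos_val mB) _; rewrite nB//; exact: measurableI.
apply: (null (jordan_neg nuPN)) => i; have [mB nB _] := HB i.
by apply: etrans (jordan_neg_val mB) _; rewrite nB ?oppe0//; exact: measurableI.
Qed.

(** The negative part vanishes on the intersection of P and K, so [decays_null] applies to the
    positive part there; exchanging the Jordan parts treats N. *)
Lemma charge_zero (dl : R) (Ls Ns : nat -> nat) :
  decays (jordan_pos nuPN) (jordan_neg nuPN) setT 1 ->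
  0 < dl -> (forall j, (j <= Ls j)%N /\ (0 < Ns j)%N) ->
  (forall A, measurable A ->
     A `<=` ~` [set t | forall j, dl <= trigavg (Ls j) (Ns j) (repr t)] -> nu A = 0%E) ->
  forall A, measurable A -> nu A = 0%E.
Proof.
move=> dT dl0 LN; set K : set X := [set t | _] => nuK A mA.
have [fp fn] := jordan_fin.
have mK : measurable K.
  rewrite -[K]setCK; apply: measurableC; apply: open_circle_measurable.
  exact/closed_openC/trigavg_circle_closed.
have [_ _ PNT PN0] := nuPN.
have dT' : decays (jordan_neg nuPN) (jordan_pos nuPN) setT 1.
  move=> e e0; have [n0 Hn0] := dT e e0; exists n0 => n /Hn0.
  by rewrite /dint normc_distC.
have mPK : measurable (P `&` K) by exact: measurableI.
have mNK : measurable (N `&` K) by exact: measurableI.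
have pPK : jordan_pos nuPN (P `&` K) = 0%E.
  apply: (decays_null fp fn dT mPK _ dl0 LN) => [|t [_ tK]//].
  by apply: etrans (jordan_neg_val mPK) _; rewrite setIAC PN0 set0I charge0 oppe0.
have nNK : jordan_neg nuPN (N `&` K) = 0%E.
  apply: (decays_null fn fp dT' mNK _ dl0 LN) => [|t [_ tK]//].
  by apply: etrans (jordan_pos_val mNK) _; rewrite setIAC [N `&` P]setIC PN0 set0I charge0.
have split_nu D : measurable D -> nu (D `&` K) = 0%E -> nu D = 0%E.
  move=> mD DK; rewrite -(setUIDK D K) chargeU.
  - by rewrite DK add0e; apply: nuK; [exact: measurableD|move=> t []].
  - exact: measurableI.
  - exact: measurableD.
  - by rewrite setDE setIACA setICr setI0.
have val_le (m : {measure set X -> \bar R}) B : measurable B -> m B = 0%E ->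
    forall D, measurable D -> D `<=` B -> m D = 0%E.
  move=> mB B0 D mD DB; apply: measure_negligible => //.
  by exists B.
have pA : nu (A `&` P) = 0%E.
  apply: split_nu; first exact: measurableI.
  have -> : A `&` P `&` K = (A `&` (P `&` K)) `&` P by apply/seteqP; split => t; rewrite /setI/=; tauto.
  rewrite -jordan_pos_val; last exact: measurableI.
  by apply: (val_le (jordan_pos nuPN) _ mPK pPK); [exact: measurableI|move=> t []].
have nA : nu (A `&` N) = 0%E.
  apply: split_nu; first exact: measurableI.
  have -> : A `&` N `&` K = (A `&` (N `&` K)) `&` N by apply/seteqP; split => t; rewrite /setI/=; tauto.
  apply/eqP; rewrite -oppe_eq0 -jordan_neg_val; last exact: measurableI.
  by apply/eqP/(val_le (jordan_neg nuPN) _ mNK nNK); [exact: measurableI|move=> t []].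
apply: jordan_zero => //.
  by apply: etrans (jordan_pos_val mA) _.
by apply: etrans (jordan_neg_val mA) _; rewrite nA oppe0.
Qed.

End Hahn.

End MeasureSide.

(** * Complex measures carried by K *)

Section NoMeasure.
Variable R : realType.
Local Notation C := R[i].
Local Notation X := (borel_circle R).
Local Notation ce := (ce R).

Definition charge_coef (nu : {charge set X -> \bar R}) (n : int) : C :=
  dint (jordan_plus nu) (jordan_minus nu) setT (ce n).

Lemma charge_coefN nu n : charge_coef nu (- n) = (charge_coef nu n)^*%C.
Proof.
have [fp fn] := jordan_fin (projT2 (cid (projT2 (cid (Hahn_decomposition nu))))).
have mT : measurable [set: X] by exact: measurableT.
rewrite /charge_coef -cj_ce /dint (cint_cj _ fp mT) (cint_cj _ fn mT).
by rewrite -(rmorphB (@conjc R)).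
Qed.

Lemma cm_fourierE (mu : complex_measure R) n :
  cm_fourier mu n = charge_coef (cm_re mu) (- n) + 'i%C * charge_coef (cm_im mu) (- n).
Proof.
have eE : expi (- n) = fun t : circle R => ce (- n) (repr t).
  by apply/funext => t; rewrite ceE.
rewrite /cm_fourier eE /charge_coef /dint.
rewrite /cm_integral /charge_integral /cint /=.
by congr (_ +i* _)%C; rewrite ?mul0r ?mul1r ?sub0r ?add0r.
Qed.

(** For real charges, coefficients at n and -n are conjugate. The two quantities bounded by e are
    thus the coefficients of a complex measure at opposite frequencies, and together they control
    its real and imaginary parts separately. *)
Lemma coef_split_bound (z w : C) (e : R) : normc (z + 'i%C * w) <= e ->
  normc (z^*%C + 'i%C * w^*%C) <= e -> normc z <= 2 * e /\ normc w <= 2 * e.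
Proof.
case: z => a b; case: w => c d h1 h2.
have := le_trans (normc_Re _) h1; have := le_trans (normc_Im _) h1.
have := le_trans (normc_Re _) h2; have := le_trans (normc_Im _) h2.
rewrite /= !mul0r !mul1r !sub0r !add0r opprK => {h1 h2}.
rewrite !ler_norml => /andP[? ?] /andP[? ?] /andP[? ?] /andP[? ?].
split; apply: le_trans (normc_ReIm _) _; rewrite /= mulr_natl mulr2n.
  by apply: lerD; rewrite ler_norml; apply/andP; split; lra.
by apply: lerD; rewrite ler_norml; apply/andP; split; lra.
Qed.

Lemma no_measure (phi : R -> R) (mu : complex_measure R) (dl : R) (Ls Ns : nat -> nat) :
  orlicz_function phi -> ~ degenerate phi -> orlicz_space phi (cm_fourier mu) ->
  0 < dl -> (forall j, (j <= Ls j)%N /\ (0 < Ns j)%N) ->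
  cm_support mu `<=` [set t | forall j, dl <= trigavg (Ls j) (Ns j) (repr t)] ->
  ~ cm_nonzero mu.
Proof.
move=> ophi ndeg omu dl0 LN supp [A mA]; apply/negP; rewrite negbK.
have dec : decays (jordan_plus (cm_re mu)) (jordan_minus (cm_re mu)) setT 1 /\
    decays (jordan_plus (cm_im mu)) (jordan_minus (cm_im mu)) setT 1.
  suff H e : 0 < e -> exists n0 : nat, forall n : nat, (n0 <= n)%N ->
      normc (charge_coef (cm_re mu) n%:Z) <= e /\ normc (charge_coef (cm_im mu) n%:Z) <= e.
    split=> e /H[n0 Hn0]; exists n0 => n /Hn0[? ?]; by rewrite mul1r.
  move=> e0; have e20 : 0 < e / 2 by rewrite divr_gt0.
  have [n0 Hn0] := orlicz_vanishing ophi ndeg omu e20.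
  exists n0 => n nn.
  have := @coef_split_bound (charge_coef (cm_re mu) n%:Z) (charge_coef (cm_im mu) n%:Z) (e / 2).
  rewrite [2 * _]mulrC divfK// -!charge_coefN -cm_fourierE -[n%:Z in X in X -> _]opprK -cm_fourierE.
  by rewrite !opprK; apply; apply: Hn0; rewrite ?abszN.
have null (nu : {charge set X -> \bar R}) : (forall B, measurable B -> cm_val mu B = 0 -> nu B = 0%E) ->
    decays (jordan_plus nu) (jordan_minus nu) setT 1 -> nu A = 0%E.
  move=> nu0 dnu; apply: (charge_zero dnu dl0 LN) mA.
  (* A point off K is off the support of mu, hence has an open neighbourhood on which mu
     vanishes. *)
  apply: (charge_null_local (projT2 (cid (projT2 (cid (Hahn_decomposition nu)))))) => t tK.
  have : ~ cm_support mu t by move=> /supp.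
  move=> /contrapT[U [oU Un] Ut]; exists U; split => // B mB BU.
  by apply: nu0 => //; exact: Un.
have fin_nu (nu : {charge set X -> \bar R}) B : measurable B -> fine (nu B) = 0 -> nu B = 0%E.
  by move=> mB nB; rewrite -(fineK (fin_num_measure nu _ mB)) nB.
have [dre dim] := dec.
have re0 : cm_re mu A = 0%E by apply: null dre => B mB [/(fin_nu _ _ mB)].
have im0 : cm_im mu A = 0%E by apply: null dim => B mB [_ /(fin_nu _ _ mB)].
by rewrite /cm_val re0 im0.
Qed.

End NoMeasure.

Theorem theorem5p1 (R : realType) (phi : R -> R)
    (phi_orlicz : orlicz_function phi)
    (phi_nondegenerate : ~ degenerate phi)
    (phi_small : phi t / t ^+ 2 @[t --> 0^'+] --> (0 : R))
    (phi_delta2 : delta2_at_zero phi)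
    (phi_submult : submultiplicative_at_zero phi) :
  exists K : set (circle R),
    [/\ compact K,
        exists S : schwartz_distribution R,
          [/\ dist_support S `<=` K, dist_nonzero S
            & orlicz_space phi (dist_fourier S)]
      & ~ exists mu : complex_measure R,
          [/\ cm_support mu `<=` K, cm_nonzero mu
            & orlicz_space phi (cm_fourier mu)]].
Proof.
have [dl [kap [Bd [fs [Ls [Ns [dl0 [kap0 fs0] LN fsz [fsc fsm]]]]]]]] :=
  product_sequence phi_orlicz phi_small phi_submult.
pose K := [set t : circle R | forall j, dl <= trigavg (Ls j) (Ns j) (repr t)].
exists K; split.
- apply: (subclosed_compact _ (@compact_circle R)) => //.
  exact: trigavg_circle_closed.
- exists (limit_distribution kap0 fsc); split.
  + exact: (@limit_support R dl kap fs Ls Ns kap0 fsz fsc).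
  + exact: (limit_nonzero kap0 fs0 fsc).
  + exact: (limit_orlicz phi_orlicz kap0 fsc fsm).
- by case=> mu [muK mu0 omu]; exact: no_measure phi_orlicz phi_nondegenerate omu dl0 LN muK mu0.
Qed.
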